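(* Let $\varepsilon=-1$. Suppose $R>0$ and $q\in C_0^\infty([-R,R])$, and let $\alpha(\lambda)=\alpha(\lambda;q)$ be the $(1,1)$ entry of the transition matrix of $q$. Let $\{\lambda_i\}_{i=1}^m$ be the (finitely many) zeros of $\alpha$ in $\mathbb C^-\cup\mathbb R$ and let $D(\lambda_i,r_i)$, $1\le i\le m$, be non-overlapping discs centered at these zeros. (i) Suppose that $\lambda_i\neq0$ is one of these zeros, of multiplicity $n\ge2$, i.e. $\alpha(\lambda)=(\lambda-\lambda_i)^ng(\lambda)$ for some analytic function $g$ with $g(\lambda_i)\ne0$. Then, for some $\varphi\in C_0^\infty(\mathbb R)$ and all sufficiently small $\mu\neq0$, the function $\alpha(\,\cdot\,;q+\mu\varphi)$ has $n$ simple zeros in the disc $D(\lambda_i,r_i)$. (ii) Let $\tilde q=q+\mu\varphi$ be the potential after the perturbation described in part (i), and suppose that $\Lambda_j\ne0$ is a simple zero of $\alpha(\,\cdot\,;\tilde q)$ on the real axis. Then there is a function $\psi\in C_0^\infty(\mathbb R)$ such that, for all real, nonzero and sufficiently small $\mu'$, $\alpha(\,\cdot\,;\tilde q+\mu'\psi)$ has no zeros on the real axis near $\Lambda_j$. In both cases, the perturbing function ($\varphi$, respectively $\psi$) may be chosen to have support in $(-2R,-R)\cup(R,2R)$.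
   Context: $\mathbb C^-=\{\operatorname{Im}\lambda<0\}$, $\sigma_3=\operatorname{diag}(1,-1)$. For a potential $q$ and $\lambda\in\mathbb R$, let $\Psi^\pm(x;\lambda)$ be the unique matrix solutions of $$\Psi_x=\begin{pmatrix}-i\lambda+\frac i2|q|^2 & q\\ -\lambda\overline q & i\lambda-\frac i2|q|^2\end{pmatrix}\Psi ,\qquad \lim_{x\to\pm\infty}\Psi^\pm(x;\lambda)e^{i\lambda x\sigma_3}=I .$$ The transition matrix $T(\lambda,q)$ is defined by $\Psi^+=\Psi^-T$, and $\alpha(\lambda;q)$ is its $(1,1)$ entry. For $q\in C_0^\infty(\mathbb R)$, $\alpha(\,\cdot\,;q)$ extends to an entire function of $\lambda$ with at most finitely many zeros in $\mathbb C^-\cup\mathbb R$. *)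

(* Defs.v *)
From Stdlib Require Export Reals List ClassicalEpsilon.
From Coquelicot Require Export Coquelicot.
Open Scope R_scope.

Definition Csmooth (f : R -> C) : Prop :=
  forall (n : nat) (x : R),
    ex_derive_n (fun y => Re (f y)) n x /\ ex_derive_n (fun y => Im (f y)) n x.

(* Membership in the closure of {x | f x <> 0}. *)
Definition supp (f : R -> C) (x : R) : Prop :=
  ~ locally x (fun y => f y = RtoC 0).

Definition C0infty (f : R -> C) : Prop :=
  Csmooth f /\ exists M : R, forall x, supp f x -> Rabs x <= M.

Definition C0infty_on (a b : R) (f : R -> C) : Prop :=
  Csmooth f /\ forall x, supp f x -> a <= x <= b.

Definition supp_in_annulus (R0 : R) (f : R -> C) : Prop :=
  forall x, supp f x -> (- (2 * R0) < x < - R0) \/ (R0 < x < 2 * R0).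

Definition perturb (q : R -> C) (mu : C) (phi : R -> C) : R -> C :=
  fun x => (q x + mu * phi x)%C.

Definition analytic_at (f : C -> C) (z0 : C) : Prop :=
  exists (a : nat -> C) (r : R), 0 < r /\
    forall z : C, Cmod (z - z0) < r ->
      is_pseries (K := C_AbsRing) (V := C_NormedModule) a (z - z0)%C (f z).

Definition entire (f : C -> C) : Prop := forall z0 : C, analytic_at f z0.

(* Away from z0 the factor g inherits analyticity from f, so that only
   analyticity at z0 is required of it. *)
Definition zero_of_order (f : C -> C) (z0 : C) (n : nat) : Prop :=
  exists g : C -> C,
    analytic_at g z0 /\ g z0 <> RtoC 0 /\
    forall z : C, f z = ((z - z0) ^ n * g z)%C.

Definition simple_zero (f : C -> C) (z0 : C) : Prop := zero_of_order f z0 1.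

Definition disc (c : C) (r : R) (z : C) : Prop := Cmod (z - c) < r.

Definition M2 : Type := @matrix C 2 2.

Definition entry (A : M2) (i j : nat) : C := coeff_mat (RtoC 0) A i j.

Definition mat2 (a b c d : C) : M2 :=
  mk_matrix 2 2 (fun i j =>
    match i, j with
    | O, O => a | O, _ => b | _, O => c | _, _ => d
    end).

Definition mul2 (A B : M2) : M2 := @Mmult C_Ring 2 2 2 A B.

Definition Cexpi (t : R) : C := (cos t, sin t).

Definition exp_sigma3 (t : R) : M2 :=
  mat2 (Cexpi t) (RtoC 0) (RtoC 0) (Cexpi (- t)).

(* The case epsilon = -1 of the spectral problem. *)
Definition lax (lambda : R) (q : R -> C) (x : R) : M2 :=
  let d := (- Ci * RtoC lambda + Ci / RtoC 2 * RtoC (Cmod (q x) ^ 2))%C in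
  mat2 d (q x)
       (- RtoC lambda * Cconj (q x))%C (- d)%C.

Definition lax_solution (lambda : R) (q : R -> C) (Psi : R -> M2) : Prop :=
  forall (x : R) (i j : nat), (i < 2)%nat -> (j < 2)%nat ->
    is_derive (K := R_AbsRing) (V := C_R_NormedModule)
      (fun y => entry (Psi y) i j) x (entry (mul2 (lax lambda q x) (Psi x)) i j).

Definition normalized_at (s : Rbar) (lambda : R) (Psi : R -> M2) : Prop :=
  forall i j : nat, (i < 2)%nat -> (j < 2)%nat ->
    filterlim (fun x => entry (mul2 (Psi x) (exp_sigma3 (lambda * x))) i j)
      (Rbar_locally s) (locally (entry (@Mone C_Ring 2) i j)).

Definition is_jost (s : Rbar) (lambda : R) (q : R -> C) (Psi : R -> M2) : Prop :=
  lax_solution lambda q Psi /\ normalized_at s lambda Psi.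

Definition is_transition (lambda : R) (q : R -> C) (T : M2) : Prop :=
  exists Psip Psim : R -> M2,
    is_jost p_infty lambda q Psip /\ is_jost m_infty lambda q Psim /\
    forall x, Psip x = mul2 (Psim x) T.

Definition is_alpha (q : R -> C) (a : C -> C) : Prop :=
  entire a /\
  forall lambda : R, exists T : M2,
    is_transition lambda q T /\ a (RtoC lambda) = entry T 0 0.

(* For q in C_0^infty(R) exactly one function satisfies [is_alpha q]; the
   value for other q is irrelevant. *)
Definition alpha (q : R -> C) : C -> C :=
  epsilon (inhabits (fun _ : C => RtoC 0)) (is_alpha q).

(* lam 0, ..., lam (m - 1) enumerates, without repetition, the zeros in the
   closed lower half-plane. *)
Definition enumerates_zeros (f : C -> C) (m : nat) (lam : nat -> C) : Prop :=
  (forall i, (i < m)%nat -> Im (lam i) <= 0 /\ f (lam i) = RtoC 0) /\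
  (forall z, Im z <= 0 -> f z = RtoC 0 -> exists i, (i < m)%nat /\ lam i = z) /\
  (forall i j, (i < m)%nat -> (j < m)%nat -> lam i = lam j -> i = j).

Definition non_overlapping_discs (m : nat) (lam : nat -> C) (r : nat -> R) : Prop :=
  (forall i, (i < m)%nat -> 0 < r i) /\
  (forall i j, (i < m)%nat -> (j < m)%nat -> i <> j ->
    forall z, ~ (disc (lam i) (r i) z /\ disc (lam j) (r j) z)).

(* The disc contains n distinct simple zeros of f1, and these are all the
   zeros of f1 in it.  Non-overlapping discs isolate only the zeros of the
   unperturbed f in the closed lower half-plane; if the disc also reaches
   zeros of f in the open upper half-plane, these persist under perturbation,
   so the last clause is then not asserted. *)
Definition has_n_simple_zeros
    (f f1 : C -> C) (n : nat) (c : C) (r : R) : Prop :=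
  exists zs : list C,
    length zs = n /\ NoDup zs /\
    (forall z, In z zs -> disc c r z /\ simple_zero f1 z) /\
    ((forall z, 0 < Im z -> Cmod (z - c) <= r -> f z <> RtoC 0) ->
     forall z, disc c r z -> f1 z = RtoC 0 -> In z zs).

(* The perturbation parameter is complex, like the potentials. *)
Definition splits_zero
    (q phi : R -> C) (n : nat) (c : C) (r delta : R) : Prop :=
  forall mu : C, 0 < Cmod mu < delta ->
    has_n_simple_zeros (alpha q) (alpha (perturb q mu phi)) n c r.

Definition no_real_zeros_near (f : C -> C) (x0 rho : R) : Prop :=
  forall x : R, Rabs (x - x0) < rho -> f (RtoC x) <> RtoC 0.

(* Main.v *)
(* Write the first column of Psi^+ as e^{-i l x} (u, v).  Then (u, v) solves a
   linear system that is affine in l, and for q supported in [a, b] with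
   (u, v)(b) = (1, 0) one has alpha(l) = u(a); this makes alpha entire.

   Perturb q by mu phi with phi supported to the right of supp q.  The transition
   matrices multiply, so that
     alpha(l; q + mu phi) = alpha(l; q) U(l, s) + conj(mu) beta(l) W(l, s),
   s = |mu|^2, where U(l, 0) = 1 and W(l, 0) is a Fourier-type integral of phi,
   which can be given any value at a prescribed l <> 0.  Since alpha and beta
   never vanish simultaneously, near an n-fold zero l_i the equation is
     (l - l_i)^n g(l) + conj(mu) h(l) = O(mu^2),   g, h <> 0,
   whose solutions are, after scaling by |mu|^{1/n}, close to the n distinct
   n-th roots of - conj(mu) h / (|mu| g).  For a simple real zero Lambda the phase
   of W(Lambda, 0) is chosen so that Lambda moves off the real axis to first
   order in mu'. *)
Require Import Defs.
From Stdlib Require Import Lra Lia Psatz Classical.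
From Stdlib Require FinFun.

(** * Differentiation along the line and Gronwall estimates *)

(** The dependence on [mu] is not holomorphic: [mu] enters through [Cconj mu] and [Cmod mu ^ 2], and
    one delta must serve all its directions. The argument principle and analytic implicit functions
    in [mu] are therefore replaced by estimates that are Lipschitz jointly in l and s, uniformly on
    bounded sets, and by a contraction on each of the n branches; the phase of conj mu is a factor
    of modulus one that the constants never see. Simplicity of the zeros comes from a linear lower
    bound near each of them, without differentiating in l. Two obstacles lie outside the
    perturbation argument. [alpha] is a choice among entire functions prescribed on the real axis
    only, so its values at complex l rest on an identity theorem. And the count near the multiple
    zero must become a count in the whole disc: the remaining closed annulus is compact and, under
    the condition of the last clause of [has_n_simple_zeros], free of zeros of [alpha q], which is
    therefore bounded below there and admits no new zeros for small mu. *)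

Definition cderiv (f : R -> C) (x : R) (l : C) : Prop :=
  is_derive (fun y => Re (f y)) x (Re l) /\ is_derive (fun y => Im (f y)) x (Im l).

Definition ccont (f : R -> C) : Prop :=
  forall x, continuous (fun y => Re (f y)) x /\ continuous (fun y => Im (f y)) x.

Ltac triangle := eapply Rle_trans; [apply Cmod_triangle|idtac].

Lemma C_ext (z w : C) : Re z = Re w -> Im z = Im w -> z = w.
Proof. destruct z, w; simpl; intros; subst; reflexivity. Qed.

Lemma RtoC_neq_0 (x : R) : x <> 0 -> RtoC x <> RtoC 0.
Proof. intros H E. injection E. exact H. Qed.

(** Componentwise derivatives give direct access to the real mean value theorem, [auto_derive] and
    [RInt]; this equivalence connects them with the complex-valued derivative in [lax_solution]. *)
Lemma cderiv_is_derive (f : R -> C) (x : R) (l : C) :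
  cderiv f x l <-> is_derive (K := R_AbsRing) (V := C_R_NormedModule) f x l.
Proof.
  split.
  - intros [H1 H2].
    apply (is_derive_ext (K := R_AbsRing) (V := C_R_NormedModule)
      (fun y => (Re (f y), Im (f y)))).
    { intro t. symmetry. apply surjective_pairing. }
    rewrite (surjective_pairing l).
    apply (filterdiff_ext_lin _ (fun y : R => (y * Re l, y * Im l))).
    + apply (filterdiff_comp_2 (K := R_AbsRing) (T := R_NormedModule)
        (U := R_NormedModule) (V := R_NormedModule) (W := C_R_NormedModule)
        (fun y => Re (f y)) (fun y => Im (f y)) (fun a b => (a, b)) _ _ (fun a b => (a, b))).
      * exact H1.
      * exact H2.
      * apply (filterdiff_ext_lin _ (fun u : prod_NormedModule R_AbsRing R_NormedModule R_NormedModule => u)).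
        -- apply (filterdiff_ext (fun u : prod_NormedModule R_AbsRing R_NormedModule R_NormedModule => u)).
           ++ intros [a b]; reflexivity.
           ++ apply filterdiff_id.
        -- intros [a b]; reflexivity.
    + intro y. reflexivity.
  - intro H. split.
    + refine (filterdiff_ext_lin _ _ _ (filterdiff_comp' f (fun z : C_R_NormedModule => fst z : R_NormedModule) x _ (fun z => fst z) H _) _).
      * apply filterdiff_linear, is_linear_fst.
      * intro y. reflexivity.
    + refine (filterdiff_ext_lin _ _ _ (filterdiff_comp' f (fun z : C_R_NormedModule => snd z : R_NormedModule) x _ (fun z => snd z) H _) _).
      * apply filterdiff_linear, is_linear_snd.
      * intro y. reflexivity.
Qed.

Lemma cderiv_eq (f : R -> C) (x : R) (l l' : C) : cderiv f x l -> l = l' -> cderiv f x l'.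
Proof. intros H <-; exact H. Qed.

Lemma cderiv_ext (f g : R -> C) (x : R) (l : C) :
  (forall y, f y = g y) -> cderiv f x l -> cderiv g x l.
Proof.
  intros E [H1 H2]; split; [eapply is_derive_ext; [|exact H1]|eapply is_derive_ext; [|exact H2]];
  intro t; simpl; rewrite E; reflexivity.
Qed.

Lemma cderiv_const (c : C) (x : R) : cderiv (fun _ => c) x (RtoC 0).
Proof. split; apply (is_derive_const (V := R_NormedModule)). Qed.

Lemma cderiv_plus (f g : R -> C) (x : R) (a b : C) :
  cderiv f x a -> cderiv g x b -> cderiv (fun y => (f y + g y)%C) x (a + b)%C.
Proof.
  intros [H1 H2] [H3 H4]; split;
  [exact (is_derive_plus (V := R_NormedModule) _ _ _ _ _ H1 H3)
  |exact (is_derive_plus (V := R_NormedModule) _ _ _ _ _ H2 H4)].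
Qed.

Lemma cderiv_opp (f : R -> C) (x : R) (a : C) :
  cderiv f x a -> cderiv (fun y => (- f y)%C) x (- a)%C.
Proof.
  intros [H1 H2]; split;
  [exact (is_derive_opp (V := R_NormedModule) _ _ _ H1)
  |exact (is_derive_opp (V := R_NormedModule) _ _ _ H2)].
Qed.

Lemma cderiv_minus (f g : R -> C) (x : R) (a b : C) :
  cderiv f x a -> cderiv g x b -> cderiv (fun y => (f y - g y)%C) x (a - b)%C.
Proof. intros H1 H2; apply cderiv_plus; [|apply cderiv_opp]; assumption. Qed.

Lemma cderiv_mult (f g : R -> C) (x : R) (a b : C) :
  cderiv f x a -> cderiv g x b ->
  cderiv (fun y => (f y * g y)%C) x (a * g x + f x * b)%C.
Proof.
  intros [H1 H2] [H3 H4].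
  assert (mr : forall (u v : R -> R) (p q : R), is_derive u x p -> is_derive v x q ->
    is_derive (fun y => u y * v y) x (p * v x + u x * q)).
  { intros u v p q Hu Hv. apply (is_derive_mult (K := R_AbsRing)); auto.
    intros; apply Rmult_comm. }
  assert (D1 := is_derive_minus (V := R_NormedModule) _ _ _ _ _
    (mr _ _ _ _ H1 H3) (mr _ _ _ _ H2 H4)).
  assert (D2 := is_derive_plus (V := R_NormedModule) _ _ _ _ _
    (mr _ _ _ _ H1 H4) (mr _ _ _ _ H2 H3)).
  split.
  - replace (Re (a * g x + f x * b)%C) with
      ((Re a * Re (g x) + Re (f x) * Re b) - (Im a * Im (g x) + Im (f x) * Im b))
      by (unfold Re, Im; simpl; ring).
    exact D1.
  - replace (Im (a * g x + f x * b)%C) with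
      ((Re a * Im (g x) + Re (f x) * Im b) + (Im a * Re (g x) + Im (f x) * Re b))
      by (unfold Re, Im; simpl; ring).
    exact D2.
Qed.

Lemma cderiv_scal (c : C) (f : R -> C) (x : R) (a : C) :
  cderiv f x a -> cderiv (fun y => (c * f y)%C) x (c * a)%C.
Proof.
  intro H. eapply cderiv_eq; [apply cderiv_mult; [apply cderiv_const|exact H]|cbv beta; ring].
Qed.

Lemma cderiv_RtoC (f : R -> R) (x a : R) :
  is_derive f x a -> cderiv (fun y => RtoC (f y)) x (RtoC a).
Proof.
  intro H; split; simpl; [exact H|apply (is_derive_const (V := R_NormedModule))].
Qed.

Lemma cderiv_ccont (f : R -> C) : (forall x, exists l, cderiv f x l) -> ccont f.
Proof.
  intros H x; destruct (H x) as [l [H1 H2]]; split;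
  apply (ex_derive_continuous (V := R_NormedModule)); eexists; eassumption.
Qed.

Lemma ccont_const (c : C) : ccont (fun _ => c).
Proof. intro x; split; apply continuous_const. Qed.

Lemma ccont_plus (f g : R -> C) : ccont f -> ccont g -> ccont (fun x => (f x + g x)%C).
Proof.
  intros Hf Hg x; destruct (Hf x), (Hg x); split; simpl;
  apply (continuous_plus (V := R_NormedModule)); assumption.
Qed.

Lemma ccont_opp (f : R -> C) : ccont f -> ccont (fun x => (- f x)%C).
Proof.
  intros Hf x; destruct (Hf x); split; simpl;
  apply (continuous_opp (V := R_NormedModule)); assumption.
Qed.

Lemma ccont_mult (f g : R -> C) : ccont f -> ccont g -> ccont (fun x => (f x * g x)%C).
Proof.
  intros Hf Hg x; destruct (Hf x), (Hg x); split; simpl.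
  - apply (continuous_minus (V := R_NormedModule));
    apply (continuous_mult (K := R_AbsRing)); assumption.
  - apply (continuous_plus (V := R_NormedModule));
    apply (continuous_mult (K := R_AbsRing)); assumption.
Qed.

Lemma ccont_conj (f : R -> C) : ccont f -> ccont (fun x => Cconj (f x)).
Proof.
  intros Hf x; destruct (Hf x); split; simpl; [assumption|].
  apply (continuous_opp (V := R_NormedModule)); assumption.
Qed.

Lemma ccont_ext (f g : R -> C) : (forall x, f x = g x) -> ccont f -> ccont g.
Proof.
  intros E H x; destruct (H x) as [H1 H2]; split;
  [eapply continuous_ext; [|exact H1]|eapply continuous_ext; [|exact H2]];
  intro y; simpl; rewrite E; reflexivity.
Qed.

Lemma ccont_Cmod2 (f : R -> C) : ccont f -> ccont (fun x => RtoC (Cmod (f x) ^ 2)).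
Proof.
  intro H. apply (ccont_ext (fun x => (f x * Cconj (f x))%C)).
  - intro x. symmetry. apply Cmod2_conj.
  - apply ccont_mult; [|apply ccont_conj]; assumption.
Qed.

Lemma ccont_inv (f : R -> C) : ccont f -> (forall x, f x <> RtoC 0) -> ccont (fun x => (/ f x)%C).
Proof.
  intros H Hn x.
  assert (D : forall y, Re (f y) ^ 2 + Im (f y) ^ 2 <> 0).
  { intros y E. apply (Hn y). apply C_ext; simpl; unfold Re, Im in *; nra. }
  assert (Ci : continuous (fun y => / (Re (f y) ^ 2 + Im (f y) ^ 2)) x).
  { apply continuous_comp.
    - destruct (H x) as [H1 H2].
      assert (sqr : forall g : R -> R, continuous g x -> continuous (fun y => g y ^ 2) x).
      { intros g Hg. apply (continuous_comp g (fun t => t ^ 2)); [exact Hg|].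
        apply (ex_derive_continuous (V := R_NormedModule) (fun t => t ^ 2)).
        auto_derive. exact I. }
      exact (continuous_plus (V := R_NormedModule) _ _ _ (sqr _ H1) (sqr _ H2)).
    - apply continuous_Rinv. apply D. }
  destruct (H x) as [H1 H2]; split; simpl;
  apply (continuous_mult (K := R_AbsRing)); try assumption.
  apply (continuous_opp (V := R_NormedModule)); assumption.
Qed.

Lemma Im_le_Cmod (c : C) : Rabs (Im c) <= Cmod c.
Proof. eapply Rle_trans; [apply Rmax_r|apply (Rmax_Cmod c)]. Qed.

Lemma Cmod_le_Re_Im (c : C) : Cmod c <= Rabs (Re c) + Rabs (Im c).
Proof.
  replace c with (RtoC (Re c) + Ci * RtoC (Im c))%C at 1.
  - triangle.
    rewrite Cmod_mult, Cmod_Ci, !Cmod_R. lra.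
  - apply C_ext; simpl; ring.
Qed.

Lemma ccont_bounded (f : R -> C) (a b : R) :
  ccont f -> exists M, 0 < M /\ forall x, a <= x <= b -> Cmod (f x) <= M.
Proof.
  intro H. destruct (Rle_dec a b) as [Hab|Hab].
  2:{ exists 1; split; [lra|intros; lra]. }
  assert (B : forall g : R -> R, (forall x, continuous g x) ->
    exists M, forall x, a <= x <= b -> Rabs (g x) <= M).
  { intros g Hg.
    destruct (continuity_ab_maj (fun x => Rabs (g x)) a b Hab) as [m [Hm _]].
    - intros c _. apply continuity_pt_filterlim.
      apply (continuous_comp g Rabs); [apply Hg|apply continuous_Rabs].
    - exists (Rabs (g m)). exact Hm. }
  destruct (B (fun x => Re (f x))) as [M1 H1]; [intro x; apply (H x)|].
  destruct (B (fun x => Im (f x))) as [M2 H2]; [intro x; apply (H x)|].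
  exists (Rabs M1 + Rabs M2 + 1). split.
  - pose proof (Rabs_pos M1); pose proof (Rabs_pos M2); lra.
  - intros x Hx. eapply Rle_trans; [apply Cmod_le_Re_Im|].
    specialize (H1 x Hx); specialize (H2 x Hx).
    pose proof (Rle_abs M1); pose proof (Rle_abs M2); lra.
Qed.

Lemma sum_sqr_derive (f g h k : R -> R) (c x f' g' h' k' : R) :
  is_derive f x f' -> is_derive g x g' -> is_derive h x h' -> is_derive k x k' ->
  is_derive (fun y => f y ^ 2 + g y ^ 2 + (h y ^ 2 + k y ^ 2) + c) x
    (2 * (f x * f' + g x * g' + (h x * h' + k x * k'))).
Proof.
  intros H1 H2 H3 H4. auto_derive.
  - repeat split; eexists; eassumption.
  - replace (Derive (fun y => f y) x) with f' by (symmetry; apply is_derive_unique; exact H1).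
    replace (Derive (fun y => g y) x) with g' by (symmetry; apply is_derive_unique; exact H2).
    replace (Derive (fun y => h y) x) with h' by (symmetry; apply is_derive_unique; exact H3).
    replace (Derive (fun y => k y) x) with k' by (symmetry; apply is_derive_unique; exact H4).
    ring.
Qed.

Lemma exp_le_mono (x y : R) : x <= y -> exp x <= exp y.
Proof. intros [H| ->]; [left; apply exp_increasing; exact H|right; reflexivity]. Qed.

Lemma exp_scale_derive (f : R -> R) (s x f' : R) :
  is_derive f x f' ->
  is_derive (fun y => exp (s * y) * f y) x (exp (s * x) * (f' + s * f x)).
Proof.
  intro H. auto_derive.
  - eexists; exact H.
  - replace (Derive (fun y => f y) x) with f' by (symmetry; apply is_derive_unique; exact H).
    ring.
Qed.

(* With N = |u|^2 + |v|^2, the function N + delta^2 changes at relative rate at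
   most 4 K + 2. *)
Lemma gronwall (u v u' v' : R -> C) (a b K delta : R) :
  0 <= K -> 0 <= delta ->
  (forall x, a <= x <= b -> cderiv u x (u' x) /\ cderiv v x (v' x)) ->
  (forall x, a <= x <= b ->
     Cmod (u' x) <= K * (Cmod (u x) + Cmod (v x)) + delta /\
     Cmod (v' x) <= K * (Cmod (u x) + Cmod (v x)) + delta) ->
  forall x y, a <= x <= b -> a <= y <= b ->
    Cmod (u x) ^ 2 + Cmod (v x) ^ 2 + delta ^ 2 <=
    exp ((4 * K + 2) * (b - a)) * (Cmod (u y) ^ 2 + Cmod (v y) ^ 2 + delta ^ 2).
Proof.
  intros HK Hd Hder Hbd.
  set (kap := 4 * K + 2).
  set (N := fun x => Re (u x) ^ 2 + Im (u x) ^ 2 + (Re (v x) ^ 2 + Im (v x) ^ 2) + delta ^ 2).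
  set (N' := fun x => 2 * (Re (u x) * Re (u' x) + Im (u x) * Im (u' x)
                     + (Re (v x) * Re (v' x) + Im (v x) * Im (v' x)))).
  assert (EN : forall x, Cmod (u x) ^ 2 + Cmod (v x) ^ 2 + delta ^ 2 = N x).
  { intro x. rewrite !Cmod2_alt. reflexivity. }
  assert (DN : forall x, a <= x <= b -> is_derive N x (N' x)).
  { intros x Hx. destruct (Hder x Hx) as [[H1 H2] [H3 H4]].
    exact (sum_sqr_derive _ _ _ _ _ _ _ _ _ _ H1 H2 H3 H4). }
  assert (CS : forall z w : C, Rabs (Re z * Re w + Im z * Im w) <= Cmod z * Cmod w).
  { intros z w. replace (Re z * Re w + Im z * Im w) with (Re (Cconj z * w)%C)
      by (unfold Re, Im; simpl; ring).
    eapply Rle_trans; [apply re_le_Cmod|]. rewrite Cmod_mult, Cmod_conj. lra. }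
  assert (BN : forall x, a <= x <= b -> Rabs (N' x) <= kap * N x).
  { intros x Hx. destruct (Hbd x Hx) as [B1 B2]. rewrite <- EN. unfold N'.
    rewrite Rabs_mult, (Rabs_right 2) by lra.
    assert (Rabs (Re (u x) * Re (u' x) + Im (u x) * Im (u' x)
                     + (Re (v x) * Re (v' x) + Im (v x) * Im (v' x)))
      <= Cmod (u x) * Cmod (u' x) + Cmod (v x) * Cmod (v' x)).
    { eapply Rle_trans; [apply Rabs_triang|]. apply Rplus_le_compat; apply CS. }
    pose proof (Cmod_ge_0 (u x)); pose proof (Cmod_ge_0 (v x)).
    set (p := Cmod (u x)) in *; set (q := Cmod (v x)) in *.
    assert (p * Cmod (u' x) <= p * (K * (p + q) + delta)) by (apply Rmult_le_compat_l; lra).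
    assert (q * Cmod (v' x) <= q * (K * (p + q) + delta)) by (apply Rmult_le_compat_l; lra).
    (* [4 * K] comes from (p + q)^2 <= 2 (p^2 + q^2), and the extra [2] from 2 p delta <= p^2 +
       delta^2 and its analogue for q. *)
    assert (Q : 2 * (p * (K * (p + q) + delta) + q * (K * (p + q) + delta))
      <= kap * (p ^ 2 + q ^ 2 + delta ^ 2)).
    { assert (0 <= K * (p - q) ^ 2) by (apply Rmult_le_pos; [exact HK|apply pow2_ge_0]).
      assert (0 <= K * delta ^ 2) by (apply Rmult_le_pos; [exact HK|apply pow2_ge_0]).
      pose proof (pow2_ge_0 (p - delta)); pose proof (pow2_ge_0 (q - delta)).
      pose proof (pow2_ge_0 p); pose proof (pow2_ge_0 q).
      unfold kap. lra. }
    lra. }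
  (* With s = kap the product exp (s t) N t is nondecreasing, with s = - kap nonincreasing; the two
     signs give the estimate in both directions of x. *)
  assert (mv : forall (s : R) x y, a <= x <= b -> a <= y <= b -> x <= y ->
     exists c, x <= c <= y /\
     exp (s * y) * N y - exp (s * x) * N x = exp (s * c) * (N' c + s * N c) * (y - x)).
  { intros s x y Hx Hy Hxy.
    destruct (MVT_gen (fun t => exp (s * t) * N t) x y
      (fun t => exp (s * t) * (N' t + s * N t))) as [c [Hc Ec]].
    - intros t Ht. rewrite Rmin_left, Rmax_right in Ht by lra.
      apply exp_scale_derive, DN; lra.
    - intros t Ht. rewrite Rmin_left, Rmax_right in Ht by lra.
      apply continuity_pt_filterlim.
      apply (ex_derive_continuous (V := R_NormedModule)
        (fun t => exp (s * t) * N t)).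
      exists (exp (s * t) * (N' t + s * N t)). apply (exp_scale_derive N), DN; lra.
    - rewrite Rmin_left, Rmax_right in Hc by lra. exists c; split; assumption. }
  intros x y Hx Hy. rewrite !EN.
  assert (N0 : 0 <= N y) by (unfold N; nra).
  assert (Hk : 0 <= kap) by (unfold kap; lra).
  assert (shift : forall s p q X Y, exp (s * p) * X <= exp (s * q) * Y ->
    X <= exp (s * (q - p)) * Y).
  { intros s p q X Y Q. replace (s * (q - p)) with (- (s * p) + s * q) by ring.
    rewrite exp_plus, exp_Ropp. apply (Rmult_le_reg_l (exp (s * p))); [apply exp_pos|].
    rewrite <- 2!Rmult_assoc, Rinv_r, Rmult_1_l; [lra|].
    apply Rgt_not_eq, exp_pos. }
  assert (key : exists d, d <= b - a /\ N x <= exp (kap * d) * N y).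
  { destruct (Rle_dec x y) as [L|L].
    - exists (y - x). split; [lra|]. apply shift.
      destruct (mv kap x y Hx Hy L) as [c [Hc Ec]].
      assert (0 <= exp (kap * c) * (N' c + kap * N c) * (y - x)); [|lra].
      apply Rmult_le_pos; [apply Rmult_le_pos; [left; apply exp_pos|]|lra].
      assert (BNc := BN c ltac:(lra)). apply Rabs_le_between in BNc. lra.
    - exists (x - y). split; [lra|].
      replace (kap * (x - y)) with (- kap * (y - x)) by ring. apply shift.
      destruct (mv (- kap) y x Hy Hx ltac:(lra)) as [c [Hc Ec]].
      assert (0 <= exp (- kap * c) * (- (N' c + - kap * N c)) * (x - y)); [|lra].
      apply Rmult_le_pos; [apply Rmult_le_pos; [left; apply exp_pos|]|lra].
      assert (BNc := BN c ltac:(lra)). apply Rabs_le_between in BNc. lra. }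
  destruct key as [d [Hd1 Hd2]].
  eapply Rle_trans; [exact Hd2|]. apply Rmult_le_compat_r; [exact N0|].
  apply exp_le_mono. apply Rmult_le_compat_l; lra.
Qed.

Lemma exp_ge_1 (x : R) : 0 <= x -> 1 <= exp x.
Proof. intro H. rewrite <- exp_0. apply exp_le_mono, H. Qed.

(** Taking square roots in [gronwall] would give the factor sqrt E; since E >= 1, E itself serves,
    and the estimate becomes linear in the data and in delta. *)
Lemma gronwall_Cmod (u v u' v' : R -> C) (a b K delta : R) :
  0 <= K -> 0 <= delta ->
  (forall x, a <= x <= b -> cderiv u x (u' x) /\ cderiv v x (v' x)) ->
  (forall x, a <= x <= b ->
     Cmod (u' x) <= K * (Cmod (u x) + Cmod (v x)) + delta /\
     Cmod (v' x) <= K * (Cmod (u x) + Cmod (v x)) + delta) ->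
  forall x y, a <= x <= b -> a <= y <= b ->
    Cmod (u x) <= exp ((4 * K + 2) * (b - a)) * (Cmod (u y) + Cmod (v y) + delta) /\
    Cmod (v x) <= exp ((4 * K + 2) * (b - a)) * (Cmod (u y) + Cmod (v y) + delta).
Proof.
  intros HK Hd Hder Hbd x y Hx Hy.
  assert (G := gronwall u v u' v' a b K delta HK Hd Hder Hbd x y Hx Hy).
  set (E := exp ((4 * K + 2) * (b - a))) in *.
  assert (HE : 1 <= E) by (apply exp_ge_1, Rmult_le_pos; lra).
  pose proof (Cmod_ge_0 (u x)); pose proof (Cmod_ge_0 (v x)).
  pose proof (Cmod_ge_0 (u y)); pose proof (Cmod_ge_0 (v y)).
  set (p := Cmod (u y)) in *. set (q := Cmod (v y)) in *.
  assert (E * (p ^ 2 + q ^ 2 + delta ^ 2) <= (E * (p + q + delta)) ^ 2).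
  { replace ((E * (p + q + delta)) ^ 2) with (E * (E * (p + q + delta) ^ 2)) by ring.
    apply Rmult_le_compat_l; [lra|].
    assert (0 <= p * q) by (apply Rmult_le_pos; lra).
    assert (0 <= (p + q) * delta) by (apply Rmult_le_pos; lra).
    assert (0 <= (E - 1) * (p + q + delta) ^ 2) by (apply Rmult_le_pos; [lra|apply pow2_ge_0]).
    lra. }
  assert (0 <= E * (p + q + delta)) by (apply Rmult_le_pos; lra).
  pose proof (pow2_ge_0 (Cmod (u x))); pose proof (pow2_ge_0 (Cmod (v x))).
  pose proof (pow2_ge_0 delta).
  split; apply Rsqr_incr_0; try assumption; rewrite !Rsqr_pow2; lra.
Qed.

(** * Linear systems of two equations: stability and uniqueness *)

Definition lin2 (p11 p12 p21 p22 u v : R -> C) : Prop :=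
  forall x, cderiv u x (p11 x * u x + p12 x * v x)%C /\
            cderiv v x (p21 x * u x + p22 x * v x)%C.

Lemma Cmod_lin2_le (p q u v : C) (K : R) :
  Cmod p <= K -> Cmod q <= K -> Cmod (p * u + q * v) <= K * (Cmod u + Cmod v).
Proof.
  intros Hp Hq. triangle. rewrite !Cmod_mult.
  rewrite Rmult_plus_distr_l.
  apply Rplus_le_compat; apply Rmult_le_compat_r; auto using Cmod_ge_0.
Qed.

Lemma ccont4_bounded (p11 p12 p21 p22 : R -> C) (a b : R) :
  ccont p11 -> ccont p12 -> ccont p21 -> ccont p22 ->
  exists K, 0 < K /\ forall x, a <= x <= b ->
    Cmod (p11 x) <= K /\ Cmod (p12 x) <= K /\ Cmod (p21 x) <= K /\ Cmod (p22 x) <= K.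
Proof.
  intros H1 H2 H3 H4.
  destruct (ccont_bounded p11 a b H1) as [K1 [P1 B1]].
  destruct (ccont_bounded p12 a b H2) as [K2 [P2 B2]].
  destruct (ccont_bounded p21 a b H3) as [K3 [P3 B3]].
  destruct (ccont_bounded p22 a b H4) as [K4 [P4 B4]].
  exists (K1 + K2 + K3 + K4). split; [lra|]. intros x Hx.
  specialize (B1 x Hx); specialize (B2 x Hx); specialize (B3 x Hx); specialize (B4 x Hx).
  repeat split; lra.
Qed.

Lemma lin2_comb (p11 p12 p21 p22 u v u1 v1 : R -> C) (c c1 : C) :
  lin2 p11 p12 p21 p22 u v -> lin2 p11 p12 p21 p22 u1 v1 ->
  lin2 p11 p12 p21 p22 (fun x => c * u x + c1 * u1 x)%C (fun x => c * v x + c1 * v1 x)%C.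
Proof.
  intros S S1 x. destruct (S x) as [H1 H2], (S1 x) as [H3 H4].
  split; (eapply cderiv_eq; [apply cderiv_plus; apply cderiv_scal; eassumption|ring]).
Qed.

(** The difference of the solutions satisfies the system with coefficients p and the forcing (p - q)
    applied to (u', v'), which a first use of Gronwall bounds by [delta * (2 * E * N)]; a second use
    treats this forcing as the inhomogeneity. *)
Lemma lin2_stability (p11 p12 p21 p22 q11 q12 q21 q22 u v u' v' : R -> C) (a b K delta : R) :
  0 <= K -> 0 <= delta ->
  (forall t, a <= t <= b -> Cmod (p11 t) <= K /\ Cmod (p12 t) <= K /\ Cmod (p21 t) <= K /\ Cmod (p22 t) <= K) ->
  (forall t, a <= t <= b -> Cmod (q11 t) <= K /\ Cmod (q12 t) <= K /\ Cmod (q21 t) <= K /\ Cmod (q22 t) <= K) ->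
  (forall t, a <= t <= b -> Cmod (p11 t - q11 t) <= delta /\ Cmod (p12 t - q12 t) <= delta /\
     Cmod (p21 t - q21 t) <= delta /\ Cmod (p22 t - q22 t) <= delta) ->
  (forall t, a <= t <= b -> cderiv u t (p11 t * u t + p12 t * v t)%C /\ cderiv v t (p21 t * u t + p22 t * v t)%C) ->
  (forall t, a <= t <= b -> cderiv u' t (q11 t * u' t + q12 t * v' t)%C /\ cderiv v' t (q21 t * u' t + q22 t * v' t)%C) ->
  forall x y, a <= x <= b -> a <= y <= b -> u y = u' y -> v y = v' y ->
  let E := exp ((4 * K + 2) * (b - a)) in let N := Cmod (u' y) + Cmod (v' y) in
    Cmod (u' x) <= E * N /\ Cmod (v' x) <= E * N /\
    Cmod (u x - u' x) <= E * (delta * (2 * E * N)) /\ Cmod (v x - v' x) <= E * (delta * (2 * E * N)).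
Proof.
  intros HK Hd Bp Bq Bd D D' x y Hx Hy Eu Ev E N.
  assert (bound : forall t, a <= t <= b -> Cmod (u' t) <= E * N /\ Cmod (v' t) <= E * N).
  { intros t Ht. unfold N. rewrite <- (Rplus_0_r (Cmod (u' y) + Cmod (v' y))).
    apply (gronwall_Cmod u' v' _ _ a b K 0 HK (Rle_refl 0) D'); try assumption.
    intros r Hr. rewrite Rplus_0_r.
    destruct (Bq r Hr) as [? [? [? ?]]]. split; apply Cmod_lin2_le; assumption. }
  destruct (bound x Hx) as [B1 B2]. split; [exact B1|]. split; [exact B2|].
  assert (PE : 0 < E) by apply exp_pos.
  assert (PN : 0 <= N) by (unfold N; pose proof (Cmod_ge_0 (u' y)); pose proof (Cmod_ge_0 (v' y)); lra).
  assert (PD : 0 <= delta * (2 * E * N)).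
  { apply Rmult_le_pos; [assumption|]. apply Rmult_le_pos; lra. }
  destruct (gronwall_Cmod (fun t => u t - u' t)%C (fun t => v t - v' t)%C
    (fun t => (p11 t * u t + p12 t * v t) - (q11 t * u' t + q12 t * v' t))%C
    (fun t => (p21 t * u t + p22 t * v t) - (q21 t * u' t + q22 t * v' t))%C a b K
    (delta * (2 * E * N)) HK PD) with (x := x) (y := y) as [G1 G2]; try assumption.
  - intros t Ht. destruct (D t Ht), (D' t Ht). split; apply cderiv_minus; assumption.
  - intros t Ht. destruct (Bp t Ht) as [P1 [P2 [P3 P4]]]. destruct (Bd t Ht) as [G1 [G2 [G3 G4]]].
    destruct (bound t Ht) as [T1 T2].
    assert (main : forall p q p' q' : C, Cmod p <= K -> Cmod q <= K ->
      Cmod (p - p') <= delta -> Cmod (q - q') <= delta ->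
      Cmod (p * u t + q * v t - (p' * u' t + q' * v' t)) <=
      K * (Cmod (u t - u' t) + Cmod (v t - v' t)) + delta * (2 * E * N)).
    { intros p q p' q' Hp Hq Hpp Hqq.
      replace (p * u t + q * v t - (p' * u' t + q' * v' t))%C with
        ((p * (u t - u' t) + q * (v t - v' t)) + ((p - p') * u' t + (q - q') * v' t))%C by ring.
      triangle. apply Rplus_le_compat.
      - apply Cmod_lin2_le; assumption.
      - eapply Rle_trans; [apply Cmod_lin2_le; eassumption|]. apply Rmult_le_compat_l; lra. }
    split; apply main; assumption.
  - cbv beta in G1, G2. rewrite Eu, Ev in G1, G2.
    replace (u' y - u' y)%C with (RtoC 0) in G1, G2 by ring.
    replace (v' y - v' y)%C with (RtoC 0) in G1, G2 by ring.
    rewrite Cmod_0, !Rplus_0_l in G1, G2. split; assumption.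
Qed.

(** Stability with [delta = 0]. The equations are assumed on an interval only, because a perturbed
    potential coincides with the old one, or with [mu * phi], only on one side of a point. *)
Lemma lin2_unique_on (p11 p12 p21 p22 u v u' v' : R -> C) (a b y : R) :
  ccont p11 -> ccont p12 -> ccont p21 -> ccont p22 ->
  (forall t, a <= t <= b -> cderiv u t (p11 t * u t + p12 t * v t)%C /\ cderiv v t (p21 t * u t + p22 t * v t)%C) ->
  (forall t, a <= t <= b -> cderiv u' t (p11 t * u' t + p12 t * v' t)%C /\ cderiv v' t (p21 t * u' t + p22 t * v' t)%C) ->
  a <= y <= b -> u y = u' y -> v y = v' y -> forall x, a <= x <= b -> u x = u' x /\ v x = v' x.
Proof.
  intros C1 C2 C3 C4 D D' Hy Eu Ev x Hx.
  destruct (ccont4_bounded p11 p12 p21 p22 a b C1 C2 C3 C4) as [K [HK B]].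
  assert (z : forall w : C, Cmod (w - w) <= 0).
  { intro w. replace (w - w)%C with (RtoC 0) by ring. rewrite Cmod_0. lra. }
  destruct (lin2_stability p11 p12 p21 p22 p11 p12 p21 p22 u v u' v' a b K 0 ltac:(lra) ltac:(lra) B B
    ltac:(intros; repeat split; apply z) D D' x y Hx Hy Eu Ev) as [_ [_ [S1 S2]]].
  rewrite Rmult_0_l, Rmult_0_r in S1, S2.
  split.
  - replace (u x) with ((u x - u' x) + u' x)%C by ring.
    rewrite (Cmod_eq_0 (u x - u' x)%C); [ring|]. pose proof (Cmod_ge_0 (u x - u' x)); lra.
  - replace (v x) with ((v x - v' x) + v' x)%C by ring.
    rewrite (Cmod_eq_0 (v x - v' x)%C); [ring|]. pose proof (Cmod_ge_0 (v x - v' x)); lra.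
Qed.

Lemma lin2_unique (p11 p12 p21 p22 u v u1 v1 : R -> C) (y : R) :
  ccont p11 -> ccont p12 -> ccont p21 -> ccont p22 ->
  lin2 p11 p12 p21 p22 u v -> lin2 p11 p12 p21 p22 u1 v1 ->
  u y = u1 y -> v y = v1 y -> forall x, u x = u1 x /\ v x = v1 x.
Proof.
  intros C1 C2 C3 C4 S S1 Eu Ev x.
  apply (lin2_unique_on _ _ _ _ u v u1 v1 (Rmin x y) (Rmax x y) y C1 C2 C3 C4
    (fun t _ => S t) (fun t _ => S1 t)); try assumption.
  - split; [apply Rmin_r|apply Rmax_r].
  - split; [apply Rmin_l|apply Rmax_l].
Qed.

Lemma lin2_zero (p11 p12 p21 p22 u v : R -> C) (y : R) :
  ccont p11 -> ccont p12 -> ccont p21 -> ccont p22 ->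
  lin2 p11 p12 p21 p22 u v -> u y = RtoC 0 -> v y = RtoC 0 ->
  forall x, u x = RtoC 0 /\ v x = RtoC 0.
Proof.
  intros C1 C2 C3 C4 S.
  apply (lin2_unique _ _ _ _ u v (fun _ => RtoC 0) (fun _ => RtoC 0) y C1 C2 C3 C4 S).
  intro x. split; (eapply cderiv_eq; [apply cderiv_const|ring]).
Qed.

(** * Picard series *)

Definition CSer (a : nat -> C) (l : C) : Prop :=
  is_series (V := C_NormedModule) a l.

Definition CPS (a : nat -> C) (w l : C) : Prop :=
  is_pseries (V := C_NormedModule) a w l.

(** Partial sums written with the concrete operations of C, so that [ring] and [simpl] apply. *)
Fixpoint csum (a : nat -> C) (n : nat) : C :=
  match n with O => a O | S k => (csum a k + a (S k))%C end.

Lemma csum_sum_n (a : nat -> C) (n : nat) :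
  sum_n (G := C_NormedModule) a n = csum a n.
Proof.
  induction n as [|n IH]; simpl.
  - apply sum_O.
  - rewrite sum_Sn, IH. reflexivity.
Qed.

Lemma pow_n_Cpow (w : C) (k : nat) : pow_n (K := C_AbsRing) w k = (w ^ k)%C.
Proof. induction k as [|k IH]; simpl; [reflexivity|rewrite IH; reflexivity]. Qed.

Lemma CPS_CSer (a : nat -> C) (w l : C) : CPS a w l <-> CSer (fun k => w ^ k * a k)%C l.
Proof.
  unfold CPS, CSer, is_pseries.
  assert (E : forall k, scal (V := C_NormedModule)
    (pow_n (K := C_AbsRing) w k) (a k) = (w ^ k * a k)%C).
  { intro k. rewrite pow_n_Cpow. reflexivity. }
  split; apply is_series_ext; intro k; [apply E|symmetry; apply E].
Qed.

Lemma CPS_to_CSer (a : nat -> C) (w l : C) : CPS a w l -> CSer (fun k => w ^ k * a k)%C l.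
Proof. apply CPS_CSer. Qed.

Lemma CSer_eps (a : nat -> C) (l : C) :
  CSer a l <-> forall eps, 0 < eps -> exists N, forall n, (N <= n)%nat -> Cmod (csum a n - l) < eps.
Proof.
  unfold CSer, is_series. split.
  - intros H eps He.
    assert (H' := proj1 (filterlim_locally_ball_norm (K := C_AbsRing) (U := C_NormedModule)
      (F := eventually) _ _) H (mkposreal eps He)).
    destruct H' as [N HN]. exists N. intros n Hn. specialize (HN n Hn).
    rewrite csum_sum_n in HN. exact HN.
  - intro H. apply (filterlim_locally_ball_norm (K := C_AbsRing) (U := C_NormedModule)).
    intros [eps He]. destruct (H eps He) as [N HN]. exists N. intros n Hn.
    rewrite csum_sum_n. exact (HN n Hn).
Qed.

Lemma CSer_unique (a : nat -> C) (l l' : C) : CSer a l -> CSer a l' -> l = l'.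
Proof.
  intros H H'.
  exact (filterlim_locally_unique (V := C_NormedModule) _ _ _ H H').
Qed.

Lemma CSer_constant (a : nat -> C) (l : C) : (forall n, csum a n = l) -> CSer a l.
Proof.
  intro H. apply CSer_eps. intros eps He. exists O. intros n _. rewrite H.
  replace (l - l)%C with (RtoC 0) by ring. rewrite Cmod_0. exact He.
Qed.

Lemma half_pow_small (c eps : R) : 0 <= c -> 0 < eps ->
  exists N, forall n, (N <= n)%nat -> c / 2 ^ n < eps.
Proof.
  intros Hc He.
  destruct (pow_lt_1_zero (1 / 2) ltac:(rewrite Rabs_right; lra) (eps / (c + 1))) as [N HN].
  { apply Rdiv_lt_0_compat; lra. }
  exists N. intros n Hn. specialize (HN n Hn).
  assert (P : 0 < (1 / 2) ^ n) by (apply pow_lt; lra).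
  rewrite Rabs_right in HN by lra.
  replace (c / 2 ^ n) with (c * (1 / 2) ^ n).
  2:{ unfold Rdiv. rewrite Rmult_1_l, pow_inv. reflexivity. }
  apply Rle_lt_trans with ((c + 1) * (1 / 2) ^ n); [nra|].
  apply (Rmult_lt_compat_l (c + 1)) in HN; [|lra].
  replace ((c + 1) * (eps / (c + 1))) with eps in HN by (field; lra). exact HN.
Qed.

(** The bound telescopes, since c / 2^(n+1) = c / 2^n - c / 2^(n+1). *)
Lemma csum_tail (a : nat -> C) (c : R) (N k : nat) : 0 <= c ->
  (forall n, (N < n)%nat -> Cmod (a n) <= c / 2 ^ n) ->
  Cmod (csum a (N + k) - csum a N) <= c / 2 ^ N - c / 2 ^ (N + k).
Proof.
  intros Hc H. induction k as [|k IH].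
  - rewrite Nat.add_0_r. replace (csum a N - csum a N)%C with (RtoC 0) by ring.
    rewrite Cmod_0. lra.
  - replace (N + S k)%nat with (S (N + k)) by lia. simpl csum.
    replace (csum a (N + k) + a (S (N + k)) - csum a N)%C
      with ((csum a (N + k) - csum a N) + a (S (N + k)))%C by ring.
    triangle.
    specialize (H (S (N + k)) ltac:(lia)).
    replace (c / 2 ^ N - c / 2 ^ S (N + k)) with
      ((c / 2 ^ N - c / 2 ^ (N + k)) + c / 2 ^ S (N + k)); [lra|].
    simpl. field. split; apply pow_nonzero; lra.
Qed.

Lemma CSer_tail (a : nat -> C) (l : C) (c : R) (N : nat) : 0 <= c ->
  (forall n, (N < n)%nat -> Cmod (a n) <= c / 2 ^ n) -> CSer a l -> Cmod (csum a N - l) <= c / 2 ^ N.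
Proof.
  intros Hc H Hl. apply le_epsilon. intros eps He.
  destruct (proj1 (CSer_eps a l) Hl eps He) as [M HM].
  specialize (HM (N + M)%nat ltac:(lia)).
  assert (T := csum_tail a c N M Hc H).
  replace (csum a N - l)%C with (- (csum a (N + M) - csum a N) + (csum a (N + M) - l))%C by ring.
  triangle. rewrite Cmod_opp.
  assert (0 <= c / 2 ^ (N + M)).
  { apply Rmult_le_pos; [lra|]. left. apply Rinv_0_lt_compat, pow_lt. lra. }
  lra.
Qed.

Lemma CSer_exists (a : nat -> C) (c : R) : 0 <= c ->
  (forall n, Cmod (a n) <= c / 2 ^ n) -> exists l, CSer a l.
Proof.
  intros Hc H.
  apply (ex_series_le (V := C_CompleteNormedModule) a (fun n => c * (1 / 2) ^ n)).
  - intro n. eapply Rle_trans; [apply H|]. right. unfold Rdiv at 1.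
    rewrite <- pow_inv. f_equal. f_equal. lra.
  - apply (ex_series_scal (V := R_NormedModule)).
    apply ex_series_geom. rewrite Rabs_right; lra.
Qed.

(** * Primitives, exponential majorants and limits of derivatives *)

Definition cint (f : R -> C) (x0 x : R) : C :=
  (RInt (fun y => Re (f y)) x0 x, RInt (fun y => Im (f y)) x0 x).

Lemma cint_cderiv (f : R -> C) (x0 x : R) : ccont f -> cderiv (cint f x0) x (f x).
Proof.
  intro H.
  assert (D : forall g : R -> R, (forall y, continuous g y) ->
    is_derive (fun y => RInt g x0 y) x (g x)).
  { intros g Hg. apply (is_derive_RInt (V := R_NormedModule) g _ x0); [|apply Hg].
    apply filter_forall. intro y.
    apply (RInt_correct (V := R_CompleteNormedModule)).
    apply (ex_RInt_continuous (V := R_CompleteNormedModule)). intros; apply Hg. }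
  split; simpl; apply D; intro y; apply (H y).
Qed.

Lemma cint_point (f : R -> C) (x0 : R) : cint f x0 x0 = RtoC 0.
Proof. unfold cint. rewrite !RInt_point. reflexivity. Qed.

(** The difference between the majorant and either F or - F starts at A >= 0 and has nonnegative
    derivative, so it stays nonnegative. *)
Lemma exp_dominated_right (F F' : R -> R) (A kap x0 L : R) :
  0 <= A -> (forall x, is_derive F x (F' x)) -> F x0 = 0 ->
  (forall x, x0 <= x <= x0 + L -> Rabs (F' x) <= kap * A * exp (kap * (x - x0))) ->
  forall x, x0 <= x <= x0 + L -> Rabs (F x) <= A * exp (kap * (x - x0)).
Proof.
  intros HA HF F0 HB x Hx.
  assert (main : forall s, Rabs s = 1 -> s * F x <= A * exp (kap * (x - x0))).
  { intros s Hs.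
    assert (D : forall t, is_derive (fun t => A * exp (kap * (t - x0)) - s * F t) t
      (kap * A * exp (kap * (t - x0)) - s * F' t)).
    { intro t. assert (Ht := HF t). auto_derive.
      - eexists; exact Ht.
      - replace (Derive (fun x => F x) t) with (F' t)
          by (symmetry; apply is_derive_unique; exact Ht). unfold Rminus; ring. }
    destruct (MVT_gen (fun t => A * exp (kap * (t - x0)) - s * F t) x0 x
       (fun t => kap * A * exp (kap * (t - x0)) - s * F' t)) as [c [Hc Ec]].
    - intros t _. apply D.
    - intros t _. apply continuity_pt_filterlim.
      apply (ex_derive_continuous (V := R_NormedModule)
       (fun t => A * exp (kap * (t - x0)) - s * F t)). eexists; apply D.
    - rewrite Rmin_left, Rmax_right in Hc by lra.
      assert (B := HB c ltac:(lra)).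
      assert (s * F' c <= Rabs (F' c)).
      { eapply Rle_trans; [apply Rle_abs|]. rewrite Rabs_mult, Hs. lra. }
      assert (0 <= (kap * A * exp (kap * (c - x0)) - s * F' c) * (x - x0))
        by (apply Rmult_le_pos; lra).
      rewrite F0 in Ec. rewrite Rminus_diag, Rmult_0_r, exp_0 in Ec. lra. }
  apply Rabs_le. split.
  - assert (M := main (-1) ltac:(rewrite Rabs_left; lra)). lra.
  - assert (M := main 1 ltac:(rewrite Rabs_right; lra)). lra.
Qed.

Lemma exp_dominated (F F' : R -> R) (A kap x0 L : R) :
  0 <= A -> (forall x, is_derive F x (F' x)) -> F x0 = 0 ->
  (forall x, Rabs (x - x0) <= L -> Rabs (F' x) <= kap * A * exp (kap * Rabs (x - x0))) ->
  forall x, Rabs (x - x0) <= L -> Rabs (F x) <= A * exp (kap * Rabs (x - x0)).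
Proof.
  intros HA HF F0 HB x Hx. destruct (Rle_dec x0 x) as [C|C].
  - assert (E : Rabs (x - x0) = x - x0) by (apply Rabs_right; lra). rewrite E in Hx |- *.
    apply (exp_dominated_right F F' A kap x0 L HA HF F0); [|lra].
    intros y Hy. specialize (HB y). rewrite Rabs_right in HB by lra. apply HB. lra.
  - assert (E : Rabs (x - x0) = - (x - x0)) by (apply Rabs_left; lra). rewrite E in Hx |- *.
    (* To the left of x0 the estimate is applied to the reflection y -> F (2 x0 - y). *)
    replace (F x) with (F (2 * x0 - (2 * x0 - x))) by (f_equal; ring).
    replace (- (x - x0)) with (2 * x0 - x - x0) by ring.
    apply (exp_dominated_right (fun y => F (2 * x0 - y)) (fun y => - F' (2 * x0 - y)) A kap x0 L HA);
      [| |  |lra].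
    + intro y. evar_last.
      * apply (is_derive_comp (V := R_NormedModule) F); [apply HF|].
        auto_derive; [exact I|reflexivity].
      * simpl. unfold scal; simpl; unfold mult; simpl. ring.
    + replace (2 * x0 - x0) with x0 by ring. exact F0.
    + intros y Hy. rewrite Rabs_Ropp. specialize (HB (2 * x0 - y)).
      rewrite Rabs_left1 in HB by lra.
      replace (- (2 * x0 - y - x0)) with (y - x0) in HB by ring.
      apply HB. lra.
Qed.

(** Termwise differentiation: the geometric rate makes both convergences uniform on the interval of
    radius 1 around each x. *)
Lemma cderiv_limit (F F' : nat -> R -> C) (f g : R -> C) :
  (forall n y, cderiv (F n) y (F' n y)) -> (forall n, ccont (F' n)) ->
  (forall x, exists c, 0 <= c /\ forall n y, Rabs (y - x) <= 1 ->
      Cmod (F n y - f y) <= c / 2 ^ n /\ Cmod (F' n y - g y) <= c / 2 ^ n) ->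
  forall x, cderiv f x (g x).
Proof.
  intros HD HC HL x. destruct (HL x) as [c [Hc B]].
  assert (main : forall (p : C -> R),
    (forall z w, Rabs (p z - p w) <= Cmod (z - w)) ->
    (forall n y, is_derive (fun t => p (F n t)) y (p (F' n y))) ->
    (forall n y, continuous (fun t => p (F' n t)) y) ->
    is_derive (fun t => p (f t)) x (p (g x))).
  { intros p Hp Dp Cp.
    assert (cvu : CVU (fun n y => p (F' n y)) (fun y => p (g y)) x (mkposreal 1 Rlt_0_1)).
    { intros eps He. destruct (half_pow_small c eps Hc He) as [N HN]. exists N.
      intros n y Hn Hy. unfold Boule in Hy; simpl in Hy.
      rewrite Rabs_minus_sym. eapply Rle_lt_trans; [apply Hp|].
      eapply Rle_lt_trans; [apply B; lra|]. apply HN, Hn. }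
    apply is_derive_Reals.
    apply (Ranalysis5.derivable_pt_lim_CVU (fun n y => p (F n y)) (fun n y => p (F' n y))
      (fun y => p (f y)) (fun y => p (g y)) x x (mkposreal 1 Rlt_0_1)).
    - unfold Boule; simpl. rewrite Rminus_diag, Rabs_R0. lra.
    - intros y n _. apply is_derive_Reals, Dp.
    - intros y Hy eps He. unfold Boule in Hy; simpl in Hy.
      destruct (half_pow_small c eps Hc He) as [N HN]. exists N. intros n Hn.
      unfold Rdist. eapply Rle_lt_trans; [apply Hp|].
      eapply Rle_lt_trans; [apply B; lra|]. apply HN, Hn.
    - exact cvu.
    - intros y Hy.
      apply (CVU_continuity (fun n y => p (F' n y)) (fun y => p (g y)) x (mkposreal 1 Rlt_0_1) cvu);
        [|exact Hy].
      intros n t _. apply continuity_pt_filterlim, Cp. }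
  split; apply main.
  - intros z w. eapply Rle_trans; [|apply re_le_Cmod]. right; reflexivity.
  - intros n y; apply (HD n y).
  - intros n y; apply (HC n y).
  - intros z w. eapply Rle_trans; [|apply Im_le_Cmod]. right; reflexivity.
  - intros n y; apply (HD n y).
  - intros n y; apply (HC n y).
Qed.

Section Picard.
Variables (b11 b12 b21 b22 : R -> C) (x0 : R) (z1 z2 : C).
Hypotheses (C11 : ccont b11) (C12 : ccont b12) (C21 : ccont b21) (C22 : ccont b22).

(** The n-th iterate is the n-th term, not the n-th partial sum, of the Picard series: the solution
    of Z' = mu B Z is the sum of mu^n Z_n, so existence and analyticity in mu come from the same
    iterates. *)
Fixpoint picard (n : nat) : (R -> C) * (R -> C) :=
  match n with
  | O => (fun _ => z1, fun _ => z2)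
  | S k => let (u, v) := picard k in
      (cint (fun x => b11 x * u x + b12 x * v x)%C x0,
       cint (fun x => b21 x * u x + b22 x * v x)%C x0)
  end.

Let Z1 n := fst (picard n).
Let Z2 n := snd (picard n).

Lemma picard_ccont n : ccont (Z1 n) /\ ccont (Z2 n).
Proof.
  induction n as [|n [I1 I2]].
  - split; [exact (ccont_const z1)|exact (ccont_const z2)].
  - unfold Z1, Z2 in *; simpl; destruct (picard n) as [u v]; simpl in *.
    split; apply cderiv_ccont; intro x; eexists; apply cint_cderiv;
    apply ccont_plus; apply ccont_mult; assumption.
Qed.

Lemma picard_cderiv n x :
  cderiv (Z1 (S n)) x (b11 x * Z1 n x + b12 x * Z2 n x)%C /\
  cderiv (Z2 (S n)) x (b21 x * Z1 n x + b22 x * Z2 n x)%C.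
Proof.
  destruct (picard_ccont n) as [I1 I2].
  unfold Z1, Z2 in *; simpl; destruct (picard n) as [u v]; simpl in *.
  split; apply (cint_cderiv (fun x => _)); apply ccont_plus; apply ccont_mult; assumption.
Qed.

Lemma picard_point n : Z1 (S n) x0 = RtoC 0 /\ Z2 (S n) x0 = RtoC 0.
Proof.
  unfold Z1, Z2; simpl; destruct (picard n) as [u v]; simpl. split; apply cint_point.
Qed.

(* The weight exp (8 K |x - x0|) turns every integration into a contraction by
   the factor 1/2. *)
Lemma picard_bound (L : R) : exists c, 0 <= c /\
  forall n x, Rabs (x - x0) <= L -> Cmod (Z1 n x) <= c / 2 ^ n /\ Cmod (Z2 n x) <= c / 2 ^ n.
Proof.
  destruct (ccont4_bounded b11 b12 b21 b22 (x0 - L) (x0 + L) C11 C12 C21 C22) as [K [HK B]].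
  set (c0 := Cmod z1 + Cmod z2).
  assert (H0 : 0 <= c0) by (unfold c0; pose proof (Cmod_ge_0 z1); pose proof (Cmod_ge_0 z2); lra).
  assert (main : forall n x, Rabs (x - x0) <= L ->
    Cmod (Z1 n x) <= c0 / 2 ^ n * exp (8 * K * Rabs (x - x0)) /\
    Cmod (Z2 n x) <= c0 / 2 ^ n * exp (8 * K * Rabs (x - x0))).
  { induction n as [|n IH]; intros x Hx.
    - assert (E : 1 <= exp (8 * K * Rabs (x - x0))).
      { apply exp_ge_1. apply Rmult_le_pos; [lra|apply Rabs_pos]. }
      change (Z1 0%nat x) with z1. change (Z2 0%nat x) with z2.
      unfold Rdiv. rewrite pow_O, Rinv_1, Rmult_1_r.
      pose proof (Cmod_ge_0 z1); pose proof (Cmod_ge_0 z2). unfold c0 in *.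
      set (e := exp _) in *.
      assert (0 <= Cmod z1 * (e - 1)) by (apply Rmult_le_pos; lra).
      assert (0 <= Cmod z2 * (e - 1)) by (apply Rmult_le_pos; lra).
      split; lra.
    - assert (P : 0 <= c0 / 2 ^ n).
      { apply Rmult_le_pos; [lra|]. left. apply Rinv_0_lt_compat, pow_lt. lra. }
      assert (E2 : c0 / 2 ^ S n = c0 / 2 ^ n / 2).
      { simpl. field. apply pow_nonzero. lra. }
      assert (D := picard_cderiv n). destruct (picard_point n) as [P1 P2].
      assert (bound : forall y, Rabs (y - x0) <= L ->
        Cmod (b11 y * Z1 n y + b12 y * Z2 n y) <= 8 * K * (c0 / 2 ^ n / 4) * exp (8 * K * Rabs (y - x0)) /\
        Cmod (b21 y * Z1 n y + b22 y * Z2 n y) <= 8 * K * (c0 / 2 ^ n / 4) * exp (8 * K * Rabs (y - x0))).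
      { intros y Hy. destruct (IH y Hy) as [I1 I2].
        apply Rabs_le_between in Hy. destruct (B y ltac:(lra)) as [B1 [B2 [B3 B4]]].
        replace (8 * K * (c0 / 2 ^ n / 4) * exp (8 * K * Rabs (y - x0))) with
          (K * (c0 / 2 ^ n * exp (8 * K * Rabs (y - x0)) + c0 / 2 ^ n * exp (8 * K * Rabs (y - x0))))
          by (field; apply pow_nonzero; lra).
        split; (eapply Rle_trans; [apply Cmod_lin2_le; eassumption|]);
        apply Rmult_le_compat_l; lra. }
      (* Up to the weight, integration bounds the real and the imaginary part by c0 / 2^n / 4 each;
         their sum is the required half of c0 / 2^n. *)
      assert (dom : forall (Z W : R -> C), Z x0 = RtoC 0 -> (forall y, cderiv Z y (W y)) ->
        (forall y, Rabs (y - x0) <= L -> Cmod (W y) <= 8 * K * (c0 / 2 ^ n / 4) * exp (8 * K * Rabs (y - x0))) ->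
        Cmod (Z x) <= c0 / 2 ^ S n * exp (8 * K * Rabs (x - x0))).
      { intros Z W Zp ZD ZB. eapply Rle_trans; [apply Cmod_le_Re_Im|]. rewrite E2.
        assert (R1 := exp_dominated (fun y => Re (Z y)) (fun y => Re (W y)) (c0 / 2 ^ n / 4) (8 * K) x0 L
          ltac:(lra) (fun y => proj1 (ZD y)) ltac:(cbv beta; rewrite Zp; reflexivity)
          (fun y Hy => Rle_trans _ _ _ (re_le_Cmod _) (ZB y Hy)) x Hx).
        assert (R2 := exp_dominated (fun y => Im (Z y)) (fun y => Im (W y)) (c0 / 2 ^ n / 4) (8 * K) x0 L
          ltac:(lra) (fun y => proj2 (ZD y)) ltac:(cbv beta; rewrite Zp; reflexivity)
          (fun y Hy => Rle_trans _ _ _ (Im_le_Cmod _) (ZB y Hy)) x Hx).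
        simpl in R1, R2. lra. }
      split;
      [exact (dom _ _ P1 (fun y => proj1 (D y)) (fun y Hy => proj1 (bound y Hy)))
      |exact (dom _ _ P2 (fun y => proj2 (D y)) (fun y Hy => proj2 (bound y Hy)))]. }
  set (E := exp (8 * K * L)).
  exists (c0 * E). split; [apply Rmult_le_pos; [lra|left; apply exp_pos]|].
  intros n x Hx. destruct (main n x Hx) as [M1 M2].
  assert (P : 0 <= c0 / 2 ^ n).
  { apply Rmult_le_pos; [lra|]. left. apply Rinv_0_lt_compat, pow_lt. lra. }
  assert (exp (8 * K * Rabs (x - x0)) <= E).
  { apply exp_le_mono. apply Rmult_le_compat_l; lra. }
  assert (c0 / 2 ^ n * exp (8 * K * Rabs (x - x0)) <= c0 * E / 2 ^ n).
  { replace (c0 * E / 2 ^ n) with (c0 / 2 ^ n * E) by (field; apply pow_nonzero; lra).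
    apply Rmult_le_compat_l; assumption. }
  lra.
Qed.

Lemma picard_terms (L : R) : exists c, 0 <= c /\
  forall mu n x, Cmod mu <= 1 -> Rabs (x - x0) <= L ->
    Cmod (mu ^ n * Z1 n x) <= c / 2 ^ n /\ Cmod (mu ^ n * Z2 n x) <= c / 2 ^ n.
Proof.
  destruct (picard_bound L) as [c [Hc B]]. exists c. split; [exact Hc|].
  intros mu n x Hm Hx. destruct (B n x Hx) as [B1 B2]. rewrite !Cmod_mult, Cmod_pow.
  assert (0 <= Cmod mu ^ n <= 1).
  { split; [apply pow_le, Cmod_ge_0|]. rewrite <- (pow1 n). apply pow_incr.
    split; [apply Cmod_ge_0|exact Hm]. }
  assert (forall t, 0 <= t -> Cmod mu ^ n * t <= t).
  { intros t Ht. rewrite <- (Rmult_1_l t) at 2. apply Rmult_le_compat_r; lra. }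
  split; (eapply Rle_trans; [apply H0, Cmod_ge_0|assumption]).
Qed.

(** The index drops by one under differentiation, because each iterate is the integral of the
    preceding one; hence the limit of the derivatives is mu B times the limit itself. *)
Lemma picard_sum_cderiv (mu : C) (n : nat) (x : R) :
  cderiv (fun y => csum (fun k => mu ^ k * Z1 k y)%C (S n)) x
    (mu * (b11 x * csum (fun k => mu ^ k * Z1 k x)%C n + b12 x * csum (fun k => mu ^ k * Z2 k x)%C n))%C /\
  cderiv (fun y => csum (fun k => mu ^ k * Z2 k y)%C (S n)) x
    (mu * (b21 x * csum (fun k => mu ^ k * Z1 k x)%C n + b22 x * csum (fun k => mu ^ k * Z2 k x)%C n))%C.
Proof.
  induction n as [|n [I1 I2]].
  - destruct (picard_cderiv 0 x) as [D1 D2].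
    assert (base : forall (Z : nat -> R -> C) z d, (forall y, Z O y = z) -> cderiv (Z 1%nat) x d ->
      cderiv (fun y => csum (fun k => mu ^ k * Z k y)%C 1) x (mu * d)%C).
    { intros Z z d HZ Hd. apply (cderiv_ext (fun y => z + mu * Z 1%nat y)%C).
      - intro y. cbn [csum Cpow]. rewrite HZ. ring.
      - eapply cderiv_eq; [apply cderiv_plus; [apply cderiv_const|apply cderiv_scal, Hd]|ring]. }
    split.
    + eapply cderiv_eq; [apply (base Z1 z1 _ (fun y => eq_refl) D1)|cbn [csum Cpow]; ring].
    + eapply cderiv_eq; [apply (base Z2 z2 _ (fun y => eq_refl) D2)|cbn [csum Cpow]; ring].
  - destruct (picard_cderiv (S n) x) as [D1 D2].
    assert (step : forall (Z : nat -> R -> C) d e,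
      cderiv (fun y => csum (fun k => mu ^ k * Z k y)%C (S n)) x d -> cderiv (Z (S (S n))) x e ->
      cderiv (fun y => csum (fun k => mu ^ k * Z k y)%C (S (S n))) x (d + mu ^ S (S n) * e)%C).
    { intros Z d e Hd He. exact (cderiv_plus _ _ _ _ _ Hd (cderiv_scal (mu ^ S (S n))%C _ _ _ He)). }
    split.
    + eapply cderiv_eq; [apply (step Z1 _ _ I1 D1)|cbn [csum Cpow]; ring].
    + eapply cderiv_eq; [apply (step Z2 _ _ I2 D2)|cbn [csum Cpow]; ring].
Qed.

Lemma csum_ccont (F : nat -> R -> C) (n : nat) :
  (forall k, ccont (F k)) -> ccont (fun x => csum (fun k => F k x) n).
Proof.
  intro H. induction n as [|n IH]; [exact (H O)|].
  exact (ccont_plus _ _ IH (H (S n))).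
Qed.

(** The closed unit disc is enough: mu = 1 yields solutions of linear systems with continuous
    coefficients, and the disc around 0 yields power series in the spectral parameter valid within
    distance 1. *)
Lemma picard_solution : exists Y1 Y2 : C -> R -> C, forall mu, Cmod mu <= 1 ->
  (forall x, CPS (fun n => Z1 n x) mu (Y1 mu x) /\ CPS (fun n => Z2 n x) mu (Y2 mu x)) /\
  (forall x, cderiv (Y1 mu) x (mu * (b11 x * Y1 mu x + b12 x * Y2 mu x))%C /\
             cderiv (Y2 mu) x (mu * (b21 x * Y1 mu x + b22 x * Y2 mu x))%C) /\
  Y1 mu x0 = z1 /\ Y2 mu x0 = z2.
Proof.
  set (Y1 := fun mu x => epsilon (inhabits (RtoC 0)) (CPS (fun n => Z1 n x) mu)).
  set (Y2 := fun mu x => epsilon (inhabits (RtoC 0)) (CPS (fun n => Z2 n x) mu)).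
  exists Y1, Y2. intros mu Hmu.
  assert (ser : forall x, CPS (fun n => Z1 n x) mu (Y1 mu x) /\ CPS (fun n => Z2 n x) mu (Y2 mu x)).
  { intro x. destruct (picard_terms (Rabs (x - x0))) as [c [Hc B]].
    split; apply epsilon_spec.
    - destruct (CSer_exists (fun n => mu ^ n * Z1 n x)%C c Hc) as [l Hl].
      + intro n. apply B; lra.
      + exists l. apply CPS_CSer. exact Hl.
    - destruct (CSer_exists (fun n => mu ^ n * Z2 n x)%C c Hc) as [l Hl].
      + intro n. apply B; lra.
      + exists l. apply CPS_CSer. exact Hl. }
  set (P1 := fun n x => csum (fun k => mu ^ k * Z1 k x)%C n).
  set (P2 := fun n x => csum (fun k => mu ^ k * Z2 k x)%C n).
  assert (tail : forall x, exists c, 0 <= c /\ forall n y, Rabs (y - x) <= 1 ->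
     Cmod (P1 n y - Y1 mu y) <= c / 2 ^ n /\ Cmod (P2 n y - Y2 mu y) <= c / 2 ^ n).
  { intro x. destruct (picard_terms (Rabs (x - x0) + 1)) as [c [Hc B]]. exists c. split; [exact Hc|].
    intros n y Hy. destruct (ser y) as [S1 S2]. apply CPS_to_CSer in S1. apply CPS_to_CSer in S2.
    assert (Rabs (y - x0) <= Rabs (x - x0) + 1).
    { replace (y - x0) with ((y - x) + (x - x0)) by ring. eapply Rle_trans; [apply Rabs_triang|]. lra. }
    split; (apply CSer_tail; [exact Hc| |assumption]); intros k _; apply (B mu k y Hmu); assumption. }
  assert (lim : forall (p q Y : R -> C) (F : nat -> R -> C), ccont p -> ccont q ->
     (forall n x, cderiv (F (S n)) x (mu * (p x * P1 n x + q x * P2 n x))%C) ->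
     (forall x, exists c, 0 <= c /\ forall n y, Rabs (y - x) <= 1 -> Cmod (F n y - Y y) <= c / 2 ^ n) ->
     forall x, cderiv Y x (mu * (p x * Y1 mu x + q x * Y2 mu x))%C).
  { intros p q Y F Cp Cq HF HT.
    apply (cderiv_limit (fun n => F (S n)) (fun n x => mu * (p x * P1 n x + q x * P2 n x))%C).
    - exact HF.
    - intro n.
      assert (Cc : forall Z : nat -> R -> C, (forall k, ccont (Z k)) ->
        ccont (fun x => csum (fun k => mu ^ k * Z k x)%C n)).
      { intros Z HZ. apply (csum_ccont (fun k x => mu ^ k * Z k x)%C). intro k.
        exact (ccont_mult _ _ (ccont_const _) (HZ k)). }
      exact (ccont_mult _ _ (ccont_const mu) (ccont_plus _ _
        (ccont_mult _ _ Cp (Cc Z1 (fun k => proj1 (picard_ccont k))))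
        (ccont_mult _ _ Cq (Cc Z2 (fun k => proj2 (picard_ccont k)))))).
    - intro x. destruct (ccont4_bounded p q p q (x - 1) (x + 1) Cp Cq Cp Cq) as [K [HK B]].
      destruct (tail x) as [c [Hc T]]. destruct (HT x) as [d [Hd T']].
      exists (d + 2 * K * c). split; [assert (0 <= K * c) by (apply Rmult_le_pos; lra); lra|]. intros n y Hy.
      destruct (T n y Hy) as [T1 T2]. assert (T3 := T' (S n) y Hy).
      apply Rabs_le_between in Hy. destruct (B y ltac:(lra)) as [B1 [B2 _]].
      assert (Q : 0 < / 2 ^ n) by (apply Rinv_0_lt_compat, pow_lt; lra).
      assert (Kc : 0 <= K * c * / 2 ^ n) by (apply Rmult_le_pos; [apply Rmult_le_pos; lra|lra]).
      assert (dn : 0 <= d * / 2 ^ n) by (apply Rmult_le_pos; lra).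
      unfold Rdiv in *. split.
      + eapply Rle_trans; [exact T3|]. simpl. rewrite Rinv_mult. lra.
      + replace (mu * (p y * P1 n y + q y * P2 n y) - mu * (p y * Y1 mu y + q y * Y2 mu y))%C with
          (mu * (p y * (P1 n y - Y1 mu y) + q y * (P2 n y - Y2 mu y)))%C by ring.
        rewrite Cmod_mult.
        assert (L := Cmod_lin2_le (p y) (q y) (P1 n y - Y1 mu y) (P2 n y - Y2 mu y) K B1 B2).
        pose proof (Cmod_ge_0 mu).
        match type of L with ?A <= _ => assert (0 <= A) by apply Cmod_ge_0; set (m := A) in * end.
        assert (Cmod mu * m <= 1 * m) by (apply Rmult_le_compat_r; lra).
        assert (K * (Cmod (P1 n y - Y1 mu y) + Cmod (P2 n y - Y2 mu y)) <= K * (2 * (c * / 2 ^ n)))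
          by (apply Rmult_le_compat_l; lra).
        lra. }
  split; [exact ser|]. split.
  - intro x. split.
    + apply (lim b11 b12 (Y1 mu) P1 C11 C12).
      * intros n t. apply (picard_sum_cderiv mu n t).
      * intro t. destruct (tail t) as [c [Hc T]]. exists c. split; [exact Hc|]. apply T.
    + apply (lim b21 b22 (Y2 mu) P2 C21 C22).
      * intros n t. apply (picard_sum_cderiv mu n t).
      * intro t. destruct (tail t) as [c [Hc T]]. exists c. split; [exact Hc|]. apply T.
  - assert (pt : forall (Z : nat -> R -> C), (forall k, Z (S k) x0 = RtoC 0) ->
      CSer (fun k => mu ^ k * Z k x0)%C (Z O x0)).
    { intros Z HZ. apply CSer_constant. induction n as [|n IH]; simpl; [ring|]. rewrite IH, HZ. ring. }
    destruct (ser x0) as [S1 S2]. apply CPS_to_CSer in S1. apply CPS_to_CSer in S2. split.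
    + exact (CSer_unique _ _ _ S1 (pt Z1 (fun k => proj1 (picard_point k)))).
    + exact (CSer_unique _ _ _ S2 (pt Z2 (fun k => proj2 (picard_point k)))).
Qed.
End Picard.

(** * Complex power series *)

Lemma CSer_minus (a b : nat -> C) (l m : C) :
  CSer a l -> CSer b m -> CSer (fun k => a k - b k)%C (l - m)%C.
Proof. exact (is_series_minus (V := C_NormedModule) a b l m). Qed.

Lemma CSer_ext (a b : nat -> C) (l : C) : (forall k, a k = b k) -> CSer a l -> CSer b l.
Proof. exact (is_series_ext (V := C_NormedModule) a b l). Qed.

Lemma CSer_terms_bounded (a : nat -> C) (l : C) :
  CSer a l -> exists A, 0 <= A /\ forall n, Cmod (a n) <= A.
Proof.
  intro H. destruct (proj1 (CSer_eps a l) H 1 Rlt_0_1) as [N HN].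
  assert (P : forall M, exists A, 0 <= A /\ forall n, (n <= M)%nat -> Cmod (a n) <= A).
  { induction M as [|M [A [HA IH]]].
    - exists (Cmod (a O)). split; [apply Cmod_ge_0|]. intros n Hn.
      replace n with O by lia. lra.
    - exists (A + Cmod (a (S M))). pose proof (Cmod_ge_0 (a (S M))). split; [lra|].
      intros n Hn. destruct (Nat.eq_dec n (S M)) as [->|Hne]; [lra|].
      specialize (IH n ltac:(lia)). lra. }
  destruct (P N) as [A [HA B]]. exists (A + 2). split; [lra|]. intro n.
  destruct (Compare_dec.le_lt_dec n N) as [L|L]; [specialize (B n L); lra|].
  destruct n as [|n]; [lia|].
  assert (H1 := HN n ltac:(lia)). assert (H2 := HN (S n) ltac:(lia)). simpl in H2.
  replace (a (S n)) with ((csum a n + a (S n) - l) - (csum a n - l))%C by ring.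
  unfold Cminus at 1. triangle. rewrite Cmod_opp. lra.
Qed.

(** In place of Cauchy's estimate: the terms of a series that converges at w are bounded. *)
Lemma CPS_coeff_bound (a : nat -> C) (w l : C) : w <> RtoC 0 -> CPS a w l ->
  exists A, 0 <= A /\ forall n, Cmod (a n) <= A / Cmod w ^ n.
Proof.
  intros Hw H. apply CPS_to_CSer in H. destruct (CSer_terms_bounded _ _ H) as [A [HA B]].
  exists A. split; [exact HA|]. intro n. specialize (B n).
  assert (P : 0 < Cmod w ^ n) by (apply pow_lt, Cmod_gt_0, Hw).
  rewrite Cmod_mult, Cmod_pow in B. apply (Rmult_le_reg_l (Cmod w ^ n)); [exact P|].
  replace (Cmod w ^ n * (A / Cmod w ^ n)) with A by (field; lra). exact B.
Qed.

Lemma Cpow_diff_bound (z w : C) (rho : R) (n : nat) : 0 <= rho ->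
  Cmod z <= rho -> Cmod w <= rho ->
  Cmod (z ^ S n - w ^ S n) <= INR (S n) * rho ^ n * Cmod (z - w).
Proof.
  intros Hr Hz Hw. induction n as [|n IH].
  - simpl. rewrite !Cmult_1_r, !Rmult_1_l. lra.
  - replace (z ^ S (S n) - w ^ S (S n))%C with
      (z * (z ^ S n - w ^ S n) + (z - w) * w ^ S n)%C by (simpl; ring).
    triangle. rewrite !Cmod_mult, Cmod_pow.
    assert (Cmod w ^ S n <= rho ^ S n) by (apply pow_incr; split; [apply Cmod_ge_0|exact Hw]).
    pose proof (Cmod_ge_0 (z - w)); pose proof (Cmod_ge_0 z); pose proof (Cmod_ge_0 (z ^ S n - w ^ S n)).
    assert (Cmod z * Cmod (z ^ S n - w ^ S n) <= rho * (INR (S n) * rho ^ n * Cmod (z - w))).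
    { apply Rmult_le_compat; assumption. }
    assert (Cmod (z - w) * Cmod w ^ S n <= Cmod (z - w) * rho ^ S n)
      by (apply Rmult_le_compat_l; assumption).
    rewrite (S_INR (S n)). simpl (rho ^ S n) in *. lra.
Qed.

Lemma INR_le_pow2 (n : nat) : INR n <= 2 ^ n.
Proof.
  induction n as [|n IH]; [simpl; lra|]. rewrite S_INR. simpl.
  assert (1 <= 2 ^ n) by (apply pow_R1_Rle; lra). lra.
Qed.

Lemma Cmod_RtoC_pos (r : R) : 0 <= r -> Cmod (RtoC r) = r.
Proof. intro H. rewrite Cmod_R. apply Rabs_right. lra. Qed.

(** Convergence at distance s = r / 2 bounds the coefficients by A / s^n. On the radius s / 4 the
    differences of n-th powers contribute a factor n / 4^(n-1), and n <= 2^n leaves a geometric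
    series. *)
Lemma analytic_lipschitz (f : C -> C) (z0 : C) : analytic_at f z0 ->
  exists rho L, 0 < rho /\ 0 <= L /\ forall z w, Cmod (z - z0) <= rho -> Cmod (w - z0) <= rho ->
    Cmod (f z - f w) <= L * Cmod (z - w).
Proof.
  intros [a [r [Hr H]]].
  set (s := r / 2). assert (Hs : 0 < s) by (unfold s; lra).
  assert (Hsn : RtoC s <> RtoC 0) by (apply RtoC_neq_0; lra).
  assert (H0 := H (z0 + RtoC s)%C). replace (z0 + RtoC s - z0)%C with (RtoC s) in H0 by ring.
  rewrite Cmod_RtoC_pos in H0 by lra. specialize (H0 ltac:(unfold s; lra)).
  destruct (CPS_coeff_bound a (RtoC s) _ Hsn H0) as [A [HA B]].
  rewrite Cmod_RtoC_pos in B by lra.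
  set (c := A * 4 / s). assert (Hc : 0 <= c).
  { unfold c. apply Rmult_le_pos; [lra|]. left. apply Rinv_0_lt_compat, Hs. }
  exists (s / 4), c. split; [lra|]. split; [exact Hc|]. intros z w Hz Hw.
  assert (Sz := H z ltac:(unfold s in *; lra)). assert (Sw := H w ltac:(unfold s in *; lra)).
  apply CPS_to_CSer in Sz. apply CPS_to_CSer in Sw.
  assert (HS := CSer_minus _ _ _ _ Sz Sw).
  (* The zeroth terms cancel, so the whole difference f z - f w is the tail of the series beyond
     index 0. *)
  assert (T : Cmod (csum (fun k => (z - z0) ^ k * a k - (w - z0) ^ k * a k)%C 0 - (f z - f w))
    <= c * Cmod (z - w) / 2 ^ 0).
  2:{ revert T. cbn [csum Cpow pow].
    replace (1 * a 0%nat - 1 * a 0%nat - (f z - f w))%C with (- (f z - f w))%C by ring.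
    rewrite Cmod_opp. unfold Rdiv. rewrite Rinv_1, Rmult_1_r. auto. }
  apply CSer_tail; [apply Rmult_le_pos; [exact Hc|apply Cmod_ge_0]| |exact HS].
    intros n Hn. destruct n as [|n]; [lia|].
    replace ((z - z0) ^ S n * a (S n) - (w - z0) ^ S n * a (S n))%C with
      (((z - z0) ^ S n - (w - z0) ^ S n) * a (S n))%C by ring.
    rewrite Cmod_mult.
    assert (D := Cpow_diff_bound (z - z0) (w - z0) (s / 4) n ltac:(lra) Hz Hw).
    replace (z - z0 - (w - z0))%C with (z - w)%C in D by ring.
    specialize (B (S n)). assert (I := INR_le_pow2 (S n)).
    pose proof (Cmod_ge_0 (z - w)).
    set (m := Cmod (z - w)) in *.
    assert (P : 0 < (s / 4) ^ n) by (apply pow_lt; lra).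
    apply Rle_trans with ((2 ^ S n * (s / 4) ^ n * m) * (A / s ^ S n)).
    + apply Rmult_le_compat; try apply Cmod_ge_0; [|exact B].
      eapply Rle_trans; [exact D|]. apply Rmult_le_compat_r; [assumption|].
      apply Rmult_le_compat_r; [lra|exact I].
    + right. unfold c. unfold Rdiv. rewrite !Rpow_mult_distr, !pow_inv.
      replace (4 ^ n) with (2 ^ n * 2 ^ n) by (rewrite <- Rpow_mult_distr; f_equal; lra).
      simpl. field. repeat split; try (apply pow_nonzero); lra.
Qed.

Lemma CPS_zero (a : nat -> C) : CPS a (RtoC 0) (a O).
Proof.
  apply CPS_CSer, CSer_constant.
  induction n as [|n IH]; simpl; [ring|]. rewrite IH. ring.
Qed.

Lemma CPS_shift (a : nat -> C) (w l : C) : w <> RtoC 0 -> CPS a w l ->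
  CPS (fun n => a (S n)) w ((l - a O) / w)%C.
Proof.
  intros Hw H.
  assert (D := is_pseries_decr_1 (V := C_NormedModule) a w (/ w)%C l
    ltac:(apply Cinv_l, Hw) H).
  unfold CPS. replace ((l - a O) / w)%C with (scal (V := C_NormedModule) (/ w)%C (plus l (opp (a O)))).
  - exact D.
  - change (/ w * (l + - a O) = (l - a O) / w)%C. unfold Cdiv, Cminus. ring.
Qed.

Lemma CPS_center (f : C -> C) (z0 : C) (a : nat -> C) (r : R) : 0 < r ->
  (forall z, Cmod (z - z0) < r -> CPS a (z - z0)%C (f z)) -> f z0 = a O.
Proof.
  intros Hr H. assert (H0 := H z0). replace (z0 - z0)%C with (RtoC 0) in H0 by ring.
  rewrite Cmod_0 in H0. specialize (H0 Hr).
  assert (H1 := CPS_zero a). apply CPS_to_CSer in H1. apply CPS_to_CSer in H0.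
  exact (CSer_unique _ _ _ H0 H1).
Qed.

Lemma Cminus_neq_0 (z w : C) : z <> w -> (z - w <> 0)%C.
Proof. intros Hne E. apply Hne. replace z with (z - w + w)%C by ring. rewrite E. ring. Qed.

(** The value [a 1] fills the removable singularity; the factorization then holds for every z, not
    only in the disc of convergence. *)
Lemma CPS_divide (f : C -> C) (z0 : C) (a : nat -> C) (r : R) : 0 < r ->
  (forall z, Cmod (z - z0) < r -> CPS a (z - z0)%C (f z)) -> a O = RtoC 0 ->
  exists g, (forall z, Cmod (z - z0) < r -> CPS (fun n => a (S n)) (z - z0)%C (g z)) /\
    forall z, f z = ((z - z0) * g z)%C.
Proof.
  intros Hr H a0. assert (F0 := CPS_center f z0 a r Hr H). rewrite a0 in F0.
  exists (fun z => if excluded_middle_informative (z = z0) then a 1%nat else (f z / (z - z0))%C).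
  split.
  - intros z Hz.
    destruct (excluded_middle_informative (z = z0)) as [->|Hne].
    + replace (z0 - z0)%C with (RtoC 0) by ring. apply (CPS_zero (fun n => a (S n))).
    + assert (D := CPS_shift a (z - z0) (f z) (Cminus_neq_0 _ _ Hne) (H z Hz)). rewrite a0 in D.
      replace (f z / (z - z0))%C with ((f z - 0) / (z - z0))%C; [exact D|].
      unfold Cdiv. ring.
  - intro z. destruct (excluded_middle_informative (z = z0)) as [->|Hne].
    + rewrite F0. ring.
    + field. apply Cminus_neq_0, Hne.
Qed.

Lemma pos_min3 (a b c : R) : 0 < a -> 0 < b -> 0 < c ->
  exists t, 0 < t /\ t <= a /\ t <= b /\ t <= c.
Proof.
  intros Ha Hb Hc. exists (Rmin a (Rmin b c)). split; [repeat apply Rmin_pos; assumption|].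
  pose proof (Rmin_l b c); pose proof (Rmin_r b c); pose proof (Rmin_l a (Rmin b c));
  pose proof (Rmin_r a (Rmin b c)). lra.
Qed.

(** If the cofactor g vanished at z0 it would be O(|z - z0|), making f quadratically small there,
    against the linear lower bound. *)
Lemma simple_zero_of_lower_bound (f : C -> C) (z0 : C) (c rho : R) :
  analytic_at f z0 -> f z0 = RtoC 0 -> 0 < c -> 0 < rho ->
  (forall z, Cmod (z - z0) < rho -> c * Cmod (z - z0) <= Cmod (f z)) ->
  simple_zero f z0.
Proof.
  intros [a [r [Hr0 H]]] F0 Hc Hr Hlow.
  destruct (CPS_divide f z0 a r Hr0 H) as [g [Hga E]].
  { rewrite <- (CPS_center f z0 a r Hr0 H). exact F0. }
  assert (Hg : analytic_at g z0) by (exists (fun n => a (S n)), r; split; assumption).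
  exists g. split; [exact Hg|]. split.
  - intro G0. destruct (analytic_lipschitz g z0 Hg) as [s [L [Hs [HL B]]]].
    assert (HLp : 0 < c / (2 * (L + 1))) by (apply Rdiv_lt_0_compat; lra).
    destruct (pos_min3 (rho / 2) s (c / (2 * (L + 1)))) as [t [Ht [? [? ?]]]]; try lra.
    assert (Ez : Cmod (z0 + RtoC t - z0) = t).
    { replace (z0 + RtoC t - z0)%C with (RtoC t) by ring. apply Cmod_RtoC_pos; lra. }
    assert (B1 := B (z0 + RtoC t)%C z0). rewrite Ez in B1.
    replace (z0 - z0)%C with (RtoC 0) in B1 by ring. rewrite Cmod_0, G0 in B1.
    specialize (B1 ltac:(lra) ltac:(lra)).
    replace (g (z0 + RtoC t) - 0)%C with (g (z0 + RtoC t)%C) in B1 by ring.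
    assert (L1 := Hlow (z0 + RtoC t)%C). rewrite E, Cmod_mult, Ez in L1.
    specialize (L1 ltac:(lra)).
    assert (c <= L * t).
    { apply (Rmult_le_reg_l t); [lra|]. assert (t * Cmod (g (z0 + RtoC t)%C) <= t * (L * t))
        by (apply Rmult_le_compat_l; lra). lra. }
    assert (Q : L * t <= L * (c / (2 * (L + 1)))) by (apply Rmult_le_compat_l; assumption).
    replace (L * (c / (2 * (L + 1)))) with (c / 2 - c / (2 * (L + 1))) in Q by (field; lra). lra.
  - intro z. rewrite E. simpl. ring.
Qed.

(** Dividing by z - z0 lowers the index m of the first nonzero coefficient by one; for m = 0 the
    Lipschitz bound keeps f away from 0. *)
Lemma analytic_isolated_order (m : nat) : forall (f : C -> C) (z0 : C) (a : nat -> C) (r : R),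
  0 < r -> (forall z, Cmod (z - z0) < r -> CPS a (z - z0)%C (f z)) ->
  (forall k, (k < m)%nat -> a k = RtoC 0) -> a m <> RtoC 0 ->
  exists rho, 0 < rho /\ forall z, 0 < Cmod (z - z0) < rho -> f z <> RtoC 0.
Proof.
  induction m as [|m IH]; intros f z0 a r Hr H Hk Hm.
  - assert (E0 := CPS_center f z0 a r Hr H).
    destruct (analytic_lipschitz f z0) as [s [L [Hs [HL B]]]].
    { exists a, r. split; [exact Hr|exact H]. }
    assert (P : 0 < Cmod (a O)) by (apply Cmod_gt_0, Hm).
    assert (Pq : 0 < Cmod (a O) / (L + 1)) by (apply Rdiv_lt_0_compat; lra).
    destruct (pos_min3 s s (Cmod (a O) / (L + 1)) Hs Hs Pq) as [t [Pt [t1 [_ t2]]]].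
    exists t. split; [exact Pt|].
    intros z [_ Hz] Fz.
    assert (B1 := B z0 z). replace (z0 - z0)%C with (RtoC 0) in B1 by ring.
    rewrite Cmod_0, Fz, E0 in B1. specialize (B1 ltac:(lra) ltac:(lra)).
    replace (a O - 0)%C with (a O) in B1 by ring.
    replace (z0 - z)%C with (- (z - z0))%C in B1 by ring. rewrite Cmod_opp in B1.
    pose proof (Cmod_ge_0 (z - z0)).
    assert (Q : (L + 1) * Cmod (z - z0) < (L + 1) * (Cmod (a O) / (L + 1))) by (apply Rmult_lt_compat_l; lra).
    replace ((L + 1) * (Cmod (a O) / (L + 1))) with (Cmod (a O)) in Q by (field; lra). lra.
  - destruct (CPS_divide f z0 a r Hr H (Hk O ltac:(lia))) as [g [Hg E]].
    destruct (IH g z0 (fun n => a (S n)) r Hr Hg) as [rho [Hrho N]].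
    + intros k Hkm. apply Hk. lia.
    + exact Hm.
    + exists rho. split; [exact Hrho|]. intros z Hz. rewrite E. apply Cmult_neq_0; [|apply N, Hz].
      apply Cmod_gt_0. lra.
Qed.

Lemma analytic_isolated (f : C -> C) (z0 : C) : analytic_at f z0 ->
  (exists rho, 0 < rho /\ forall z, Cmod (z - z0) < rho -> f z = RtoC 0) \/
  (exists rho, 0 < rho /\ forall z, 0 < Cmod (z - z0) < rho -> f z <> RtoC 0).
Proof.
  intros [a [r [Hr H]]]. destruct (classic (forall n, a n = RtoC 0)) as [Z|NZ].
  - left. exists r. split; [exact Hr|]. intros z Hz. assert (S := H z Hz). apply CPS_to_CSer in S.
    apply (CSer_unique _ _ _ S), CSer_constant.
    induction n as [|n IH]; cbn [csum]; rewrite Z; [ring|]. rewrite IH. ring.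
  - right. apply not_all_ex_not in NZ.
    assert (W : exists m, a m <> RtoC 0 /\ forall k, (k < m)%nat -> a k = RtoC 0).
    { destruct NZ as [n Hn]. revert Hn. induction n as [n IH] using (well_founded_induction Wf_nat.lt_wf). intro Hn.
      destruct (classic (exists k, (k < n)%nat /\ a k <> RtoC 0)) as [[k [Hk Ak]]|N].
      - exact (IH k Hk Ak).
      - exists n. split; [exact Hn|]. intros k Hk. apply NNPP. intro Q. apply N. exists k. auto. }
    destruct W as [m [Hm Hk]].
    exact (analytic_isolated_order m f z0 a r Hr H Hk Hm).
Qed.

Lemma entire_minus (f g : C -> C) : entire f -> entire g -> entire (fun z => f z - g z)%C.
Proof.
  intros Hf Hg z0. destruct (Hf z0) as [a [r [Hr A]]], (Hg z0) as [b [s [Hs B]]].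
  exists (fun n => a n - b n)%C, (Rmin r s). split; [apply Rmin_pos; assumption|].
  intros z Hz.
  assert (Sa := A z (Rlt_le_trans _ _ _ Hz (Rmin_l _ _))).
  assert (Sb := B z (Rlt_le_trans _ _ _ Hz (Rmin_r _ _))).
  apply CPS_CSer. apply CPS_to_CSer in Sa. apply CPS_to_CSer in Sb.
  apply (CSer_ext (fun k => (z - z0) ^ k * a k - (z - z0) ^ k * b k)%C).
  - intro k. ring.
  - apply CSer_minus; assumption.
Qed.

(** Along the vertical segment p from x to z, let tau be the supremum of the parameters up to which
    f vanishes. Zeros accumulate at p tau, so by the dichotomy of [analytic_isolated] f vanishes
    around p tau, which carries the vanishing past tau unless tau = 1. *)
Lemma entire_zero_on_reals (f : C -> C) : entire f ->
  (forall x : R, f (RtoC x) = RtoC 0) -> forall z, f z = RtoC 0.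
Proof.
  intros Hf HR z. destruct z as [x y].
  destruct (Req_dec y 0) as [->|Hy]; [apply HR|].
  set (p := fun t : R => ((x, t * y) : C)).
  assert (pd : forall s t, Cmod (p s - p t) = Rabs (s - t) * Rabs y).
  { intros s t. replace (p s - p t)%C with (RtoC (s - t) * (RtoC y * Ci))%C.
    - rewrite !Cmod_mult, !Cmod_R, Cmod_Ci. ring.
    - apply C_ext; unfold p, Re, Im; simpl; ring. }
  assert (Hy' : 0 < Rabs y) by (apply Rabs_pos_lt, Hy).
  set (E := fun t => 0 <= t <= 1 /\ forall s, 0 <= s <= t -> f (p s) = RtoC 0).
  assert (E0 : E 0).
  { split; [lra|]. intros s Hs. replace s with 0 by lra.
    unfold p. rewrite Rmult_0_l. apply HR. }
  destruct (completeness E) as [tau [Hub Hlub]].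
  { exists 1. intros t [Ht _]. lra. }
  { exists 0. exact E0. }
  assert (T0 : 0 <= tau) by (apply Hub, E0).
  assert (T1 : tau <= 1) by (apply Hlub; intros t [Ht _]; lra).
  assert (below : forall s, 0 <= s < tau -> f (p s) = RtoC 0).
  { intros s Hs. destruct (classic (exists t, E t /\ s < t)) as [[t [Et Hst]]|N].
    - apply Et. lra.
    - exfalso. assert (tau <= s); [|lra]. apply Hlub. intros t Et.
      apply Rnot_lt_le. intro Q. apply N. exists t. split; assumption. }
  destruct (analytic_isolated f (p tau) (Hf (p tau))) as [[rho [Hrho Z]]|[rho [Hrho N]]].
  - set (t1 := Rmin 1 (tau + rho / (2 * Rabs y))).
    assert (Et1 : E t1).
    { assert (0 < rho / (2 * Rabs y)) by (apply Rdiv_lt_0_compat; lra).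
      split.
      - unfold t1. split; [apply Rmin_glb; lra|apply Rmin_l].
      - intros s Hs. destruct (Rlt_le_dec s tau) as [L|L]; [apply below; lra|].
        apply Z. rewrite pd. rewrite Rabs_right by lra.
        assert (s <= tau + rho / (2 * Rabs y)) by (eapply Rle_trans; [apply Hs|apply Rmin_r]).
        apply Rle_lt_trans with (rho / (2 * Rabs y) * Rabs y); [apply Rmult_le_compat_r; lra|].
        replace (rho / (2 * Rabs y) * Rabs y) with (rho / 2) by (field; lra). lra. }
    assert (t1 <= tau) by (apply Hub, Et1).
    assert (t1 = 1).
    { unfold t1 in *. assert (0 < rho / (2 * Rabs y)) by (apply Rdiv_lt_0_compat; lra).
      unfold Rmin in *. destruct (Rle_dec 1 (tau + rho / (2 * Rabs y))); lra. }
    replace ((x, y) : C) with (p 1) by (unfold p; rewrite Rmult_1_l; reflexivity).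
    apply Et1. lra.
  (* For tau = 0 the accumulating zeros are supplied by the real axis, for tau > 0 by the part of
     the segment before p tau. *)
  - exfalso. destruct (Req_dec tau 0) as [Z|NZ].
    + apply (N (RtoC (x + rho / 2))); [|apply HR].
      replace (RtoC (x + rho / 2) - p tau)%C with (RtoC (rho / 2)).
      * rewrite Cmod_RtoC_pos by lra. lra.
      * rewrite Z. apply C_ext; unfold p, Re, Im; simpl; lra.
    + set (s := Rmax 0 (tau - rho / (2 * Rabs y))).
      assert (0 < rho / (2 * Rabs y)) by (apply Rdiv_lt_0_compat; lra).
      assert (Hs : 0 <= s < tau).
      { unfold s. split; [apply Rmax_l|]. apply Rmax_lub_lt; lra. }
      apply (N (p s)); [|apply below, Hs]. rewrite pd. rewrite Rabs_left by lra.
      assert (tau - rho / (2 * Rabs y) <= s) by apply Rmax_r.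
      split; [apply Rmult_lt_0_compat; lra|].
      apply Rle_lt_trans with (rho / (2 * Rabs y) * Rabs y); [apply Rmult_le_compat_r; lra|].
      replace (rho / (2 * Rabs y) * Rabs y) with (rho / 2) by (field; lra). lra.
Qed.

(** * The transition coefficient *)

Lemma lin2_exists (p11 p12 p21 p22 : R -> C) (y : R) (z1 z2 : C) :
  ccont p11 -> ccont p12 -> ccont p21 -> ccont p22 ->
  exists u v, lin2 p11 p12 p21 p22 u v /\ u y = z1 /\ v y = z2.
Proof.
  intros C1 C2 C3 C4.
  destruct (picard_solution p11 p12 p21 p22 y z1 z2 C1 C2 C3 C4) as [Y1 [Y2 H]].
  destruct (H (RtoC 1)) as [_ [D [E1 E2]]].
  { rewrite Cmod_1. lra. }
  exists (Y1 (RtoC 1)), (Y2 (RtoC 1)). split; [|split; assumption].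
  intro x. destruct (D x) as [D1 D2].
  split; (eapply cderiv_eq; [eassumption|ring]).
Qed.

Lemma lin2_ccont (p11 p12 p21 p22 u v : R -> C) : lin2 p11 p12 p21 p22 u v -> ccont u /\ ccont v.
Proof.
  intro S. split; apply cderiv_ccont; intro x.
  - exists (p11 x * u x + p12 x * v x)%C. exact (proj1 (S x)).
  - exists (p21 x * u x + p22 x * v x)%C. exact (proj2 (S x)).
Qed.

(** A vanishing determinant at x makes the columns dependent there; by uniqueness the same
    dependence holds at y, where the data form the identity matrix. *)
Lemma lin2_det_neq_0 (p11 p12 p21 p22 u1 v1 u2 v2 : R -> C) (y : R) :
  ccont p11 -> ccont p12 -> ccont p21 -> ccont p22 ->
  lin2 p11 p12 p21 p22 u1 v1 -> lin2 p11 p12 p21 p22 u2 v2 ->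
  u1 y = RtoC 1 -> v1 y = RtoC 0 -> u2 y = RtoC 0 -> v2 y = RtoC 1 ->
  forall x, (u1 x * v2 x - u2 x * v1 x)%C <> RtoC 0.
Proof.
  intros C1 C2 C3 C4 S1 S2 E1 E2 E3 E4 x D.
  assert (dep : forall c d : C, (c * u1 x + d * u2 x)%C = RtoC 0 ->
     (c * v1 x + d * v2 x)%C = RtoC 0 -> c = RtoC 0 /\ d = RtoC 0).
  { intros c d H1 H2.
    destruct (lin2_zero _ _ _ _ _ _ x C1 C2 C3 C4
      (lin2_comb _ _ _ _ _ _ _ _ c d S1 S2) H1 H2 y) as [Z1 Z2].
    rewrite E1, E3 in Z1. rewrite E2, E4 in Z2. split.
    - rewrite <- Z1. ring.
    - rewrite <- Z2. ring. }
  (* The coefficients (u2, - u1) and then (v2, - v1) give combinations that vanish at x; so the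
     second column is zero at x, and the coefficients (0, 1) yield the contradiction. *)
  assert (U2 : u2 x = RtoC 0).
  { destruct (dep (u2 x) (- u1 x)%C) as [A _]; [ring| |exact A].
    replace (u2 x * v1 x + - u1 x * v2 x)%C with (- (u1 x * v2 x - u2 x * v1 x))%C by ring.
    rewrite D. ring. }
  assert (V2 : v2 x = RtoC 0).
  { destruct (dep (v2 x) (- v1 x)%C) as [A _]; [|ring|exact A].
    replace (v2 x * u1 x + - v1 x * u2 x)%C with (u1 x * v2 x - u2 x * v1 x)%C by ring.
    exact D. }
  destruct (dep (RtoC 0) (RtoC 1)) as [_ A].
  - rewrite U2. ring.
  - rewrite V2. ring.
  - injection A. lra.
Qed.

Definition half_sqr (z : C) : C := (Ci / RtoC 2 * RtoC (Cmod z ^ 2))%C.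

(** The first column of the Lax system multiplied by e^{i l x}, with l now complex. The factor
    removes l from the equation of u, so that u is constant wherever q vanishes. *)
Definition uv (q : R -> C) (l : C) (u v : R -> C) : Prop :=
  lin2 (fun x => half_sqr (q x))%C q
       (fun x => - l * Cconj (q x))%C
       (fun x => RtoC 2 * Ci * l - half_sqr (q x))%C u v.

Lemma uv_ccont (q : R -> C) (l : C) : ccont q ->
  ccont (fun x => half_sqr (q x))%C /\
  ccont (fun x => - l * Cconj (q x))%C /\
  ccont (fun x => RtoC 2 * Ci * l - half_sqr (q x))%C.
Proof.
  intro H.
  assert (H1 : ccont (fun x => half_sqr (q x))%C).
  { unfold half_sqr. apply ccont_mult; [apply ccont_const|apply ccont_Cmod2, H]. }
  split; [exact H1|]. split.
  - apply ccont_mult; [apply ccont_const|apply ccont_conj, H].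
  - apply ccont_plus; [apply ccont_const|apply ccont_opp, H1].
Qed.

Lemma uv_exists (q : R -> C) (l : C) (y : R) (z1 z2 : C) : ccont q ->
  exists u v, uv q l u v /\ u y = z1 /\ v y = z2.
Proof. intro H. destruct (uv_ccont q l H) as [H1 [H2 H3]]. apply lin2_exists; assumption. Qed.

Lemma uv_unique (q : R -> C) (l : C) (u v u1 v1 : R -> C) (y : R) : ccont q ->
  uv q l u v -> uv q l u1 v1 -> u y = u1 y -> v y = v1 y -> forall x, u x = u1 x /\ v x = v1 x.
Proof. intro H. destruct (uv_ccont q l H) as [H1 [H2 H3]]. apply lin2_unique; assumption. Qed.

(* The dependence on the spectral parameter is affine, so after conjugation by
   the fundamental matrix at l0 the system becomes Z' = (l - l0) B(x) Z, whose
   Picard series is a power series in l - l0. *)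
Lemma uv_entire (q : R -> C) (a b : R) (F : C -> C) : ccont q ->
  (forall l, exists u v, uv q l u v /\ u b = RtoC 1 /\ v b = RtoC 0 /\ F l = u a) ->
  entire F.
Proof.
  intros Cq HF l0.
  destruct (uv_exists q l0 b (RtoC 1) (RtoC 0) Cq) as [u1 [v1 [S1 [E1 E2]]]].
  destruct (uv_exists q l0 b (RtoC 0) (RtoC 1) Cq) as [u2 [v2 [S2 [E3 E4]]]].
  destruct (uv_ccont q l0 Cq) as [Q1 [Q2 Q3]].
  assert (D := lin2_det_neq_0 _ _ _ _ _ _ _ _ b Q1 Cq Q2 Q3 S1 S2 E1 E2 E3 E4).
  destruct (lin2_ccont _ _ _ _ _ _ S1) as [Cu1 Cv1].
  destruct (lin2_ccont _ _ _ _ _ _ S2) as [Cu2 Cv2].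
  set (d := fun x => (/ (u1 x * v2 x - u2 x * v1 x))%C).
  assert (Cd : ccont d).
  { apply ccont_inv; [|exact D]. apply ccont_plus; [|apply ccont_opp]; apply ccont_mult; assumption. }
  (* [s1] and [s2] are the second components of the l-derivative of the coefficient matrix applied
     to the two columns; the first components vanish. Multiplying by the inverse fundamental matrix,
     with [d] the reciprocal determinant, gives the entries of B below. *)
  set (s1 := fun x => (- Cconj (q x) * u1 x + RtoC 2 * Ci * v1 x)%C).
  set (s2 := fun x => (- Cconj (q x) * u2 x + RtoC 2 * Ci * v2 x)%C).
  assert (Cs : forall u v, ccont u -> ccont v ->
    ccont (fun x => - Cconj (q x) * u x + RtoC 2 * Ci * v x)%C).
  { intros u v Hu Hv. apply ccont_plus; (apply ccont_mult; [|assumption]).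
    - apply ccont_opp, ccont_conj, Cq.
    - apply ccont_const. }
  assert (Cs1 : ccont s1) by (apply Cs; assumption).
  assert (Cs2 : ccont s2) by (apply Cs; assumption).
  assert (C3 : forall f g h : R -> C, ccont f -> ccont g -> ccont h -> ccont (fun x => f x * g x * h x)%C).
  { intros f g h Hf Hg Hh. exact (ccont_mult _ _ (ccont_mult _ _ Hf Hg) Hh). }
  destruct (picard_solution (fun x => - u2 x * s1 x * d x)%C (fun x => - u2 x * s2 x * d x)%C
     (fun x => u1 x * s1 x * d x)%C (fun x => u1 x * s2 x * d x)%C b (RtoC 1) (RtoC 0)
     (C3 _ _ _ (ccont_opp _ Cu2) Cs1 Cd) (C3 _ _ _ (ccont_opp _ Cu2) Cs2 Cd)
     (C3 _ _ _ Cu1 Cs1 Cd) (C3 _ _ _ Cu1 Cs2 Cd))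
     as [Y1 [Y2 HY]].
  set (Z1 := fun n => fst (picard (fun x => - u2 x * s1 x * d x)%C (fun x => - u2 x * s2 x * d x)%C
     (fun x => u1 x * s1 x * d x)%C (fun x => u1 x * s2 x * d x)%C b (RtoC 1) (RtoC 0) n)) in *.
  set (Z2 := fun n => snd (picard (fun x => - u2 x * s1 x * d x)%C (fun x => - u2 x * s2 x * d x)%C
     (fun x => u1 x * s1 x * d x)%C (fun x => u1 x * s2 x * d x)%C b (RtoC 1) (RtoC 0) n)) in *.
  exists (fun n => u1 a * Z1 n a + u2 a * Z2 n a)%C, 1. split; [lra|].
  intros l Hl. set (w := (l - l0)%C) in *.
  destruct (HY w ltac:(lra)) as [PS [DY [I1 I2]]].
  destruct (HF l) as [u [v [S [Eu [Ev ->]]]]].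
  assert (SY : uv q l (fun x => u1 x * Y1 w x + u2 x * Y2 w x)%C
                      (fun x => v1 x * Y1 w x + v2 x * Y2 w x)%C).
  { intro x. destruct (DY x) as [D1 D2]. destruct (S1 x) as [A1 A2], (S2 x) as [A3 A4].
    assert (Dx := D x). unfold d, s1, s2 in D1, D2. replace l with (w + l0)%C by (unfold w; ring).
    split.
    - eapply cderiv_eq; [apply cderiv_plus; apply cderiv_mult; eassumption|].
      cbv beta. field. exact Dx.
    - eapply cderiv_eq; [apply cderiv_plus; apply cderiv_mult; eassumption|].
      cbv beta. field. exact Dx. }
  destruct (uv_unique q l _ _ _ _ b Cq S SY) with (x := a) as [Ua _].
  - rewrite I1, I2, E1, E3, Eu. ring.
  - rewrite I1, I2, E2, E4, Ev. ring.
  - rewrite Ua. destruct (PS a) as [P1 P2].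
    apply CPS_to_CSer in P1. apply CPS_to_CSer in P2.
    apply CPS_CSer.
    apply (CSer_ext (fun k => u1 a * (w ^ k * Z1 k a) + u2 a * (w ^ k * Z2 k a))%C).
    + intro k. ring.
    + apply (is_series_plus (V := C_NormedModule));
      apply (is_series_scal (V := C_NormedModule)); assumption.
Qed.

(** * Matrix entries, Jost solutions and the transition matrix *)

Lemma mul2_entry (A B : M2) (i j : nat) : (i < 2)%nat -> (j < 2)%nat ->
  entry (mul2 A B) i j = (entry A i 0 * entry B 0 j + entry A i 1 * entry B 1 j)%C.
Proof.
  intros Hi Hj. unfold entry, mul2, Mmult.
  rewrite (coeff_mat_bij (T := C) 0); try assumption.
  simpl Init.Nat.pred. rewrite sum_Sn, sum_O. reflexivity.
Qed.

Lemma mat2_entry (a b c d : C) (i j : nat) : (i < 2)%nat -> (j < 2)%nat ->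
  entry (mat2 a b c d) i j = match i, j with
    | O, O => a | O, _ => b | _, O => c | _, _ => d end.
Proof. intros Hi Hj. unfold entry, mat2. rewrite coeff_mat_bij; auto. Qed.

Lemma Mone_entry (i j : nat) : (i < 2)%nat -> (j < 2)%nat ->
  entry (@Mone C_Ring 2) i j = match i, j with
    | O, O => RtoC 1 | O, _ => RtoC 0 | _, O => RtoC 0 | _, _ => RtoC 1 end.
Proof.
  intros Hi Hj. unfold entry, Mone. rewrite (coeff_mat_bij (T := C) 0); auto.
  destruct i as [|[|i]], j as [|[|j]]; try lia; reflexivity.
Qed.

Lemma Cmod_Cexpi (t : R) : Cmod (Cexpi t) = 1.
Proof.
  unfold Cexpi, Cmod. cbn [fst snd]. rewrite <- sqrt_1. f_equal.
  rewrite <- (sin2_cos2 t). unfold Rsqr. ring.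
Qed.

Lemma Cexpi_opp (t : R) : (Cexpi (- t) * Cexpi t)%C = RtoC 1.
Proof.
  unfold Cexpi. rewrite cos_neg, sin_neg. apply C_ext; simpl.
  - rewrite <- (sin2_cos2 t). unfold Rsqr. ring.
  - ring.
Qed.

Lemma Cexpi_opp_r (t : R) : (Cexpi t * Cexpi (- t))%C = RtoC 1.
Proof. rewrite Cmult_comm. apply Cexpi_opp. Qed.

Lemma cderiv_Cexpi (k x : R) :
  cderiv (fun y => Cexpi (k * y)) x (Ci * RtoC k * Cexpi (k * x))%C.
Proof.
  unfold Cexpi; split; simpl; auto_derive; auto; ring.
Qed.

Lemma cderiv_zero_const (f : R -> C) (c x : R) :
  (forall t, Rmin c x <= t <= Rmax c x -> cderiv f t (RtoC 0)) -> f x = f c.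
Proof.
  intro H.
  assert (main : forall g : R -> R, (forall t, Rmin c x <= t <= Rmax c x -> is_derive g t 0) -> g x = g c).
  { intros g Hg. destruct (MVT_gen g c x (fun _ => 0)) as [t [_ E]].
    - intros t Ht. apply Hg. lra.
    - intros t Ht. apply continuity_pt_filterlim.
      apply (ex_derive_continuous (V := R_NormedModule) g).
      exists 0. apply Hg, Ht.
    - lra. }
  apply C_ext; [apply (main (fun t => Re (f t)))|apply (main (fun t => Im (f t)))];
  intros t Ht; apply (H t Ht).
Qed.

Definition lax_diag (q : R -> C) (l : R) (x : R) : C :=
  (- Ci * RtoC l + half_sqr (q x))%C.

Definition lax_column (q : R -> C) (l : R) (u v : R -> C) : Prop :=
  lin2 (lax_diag q l) q (fun x => - RtoC l * Cconj (q x))%C (fun x => - lax_diag q l x)%C u v.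

Lemma lax_column_ccont (q : R -> C) (l : R) : ccont q ->
  ccont (lax_diag q l) /\ ccont (fun x => - RtoC l * Cconj (q x))%C /\
  ccont (fun x => - lax_diag q l x)%C.
Proof.
  intro H.
  assert (H1 : ccont (lax_diag q l)).
  { exact (ccont_plus _ _ (ccont_const _) (proj1 (uv_ccont q 0 H))). }
  split; [exact H1|]. split; [|apply ccont_opp, H1].
  apply ccont_mult; [apply ccont_const|apply ccont_conj, H].
Qed.

Lemma lax_solution_columns (l : R) (q : R -> C) (Psi : R -> M2) :
  lax_solution l q Psi <->
  forall j, (j < 2)%nat ->
    lax_column q l (fun x => entry (Psi x) 0 j) (fun x => entry (Psi x) 1 j).
Proof.
  split.
  - intros H j Hj x. split.
    + assert (D := H x O j ltac:(lia) Hj). apply cderiv_is_derive in D.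
      rewrite mul2_entry in D by lia. unfold lax in D. rewrite !mat2_entry in D by lia. exact D.
    + assert (D := H x 1%nat j ltac:(lia) Hj). apply cderiv_is_derive in D.
      rewrite mul2_entry in D by lia. unfold lax in D. rewrite !mat2_entry in D by lia. exact D.
  - intros H x i j Hi Hj. apply cderiv_is_derive. rewrite mul2_entry by lia. unfold lax.
    destruct (H j Hj x) as [D1 D2].
    destruct i as [|[|i]]; [| |lia]; rewrite !mat2_entry by lia; assumption.
Qed.

Lemma lax_column_gauge (q : R -> C) (l : R) (u v : R -> C) : lax_column q l u v ->
  uv q (RtoC l) (fun x => Cexpi (l * x) * u x)%C (fun x => Cexpi (l * x) * v x)%C.
Proof.
  intros S x. destruct (S x) as [D1 D2].
  split; (eapply cderiv_eq; [apply cderiv_mult; [apply cderiv_Cexpi|eassumption]|]);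
  unfold lax_diag; field; intro E; injection E; lra.
Qed.

(** Where q = 0 the system is diagonal and the components oscillate freely, as e^{-ilx} and
    e^{ilx}. *)
Lemma lax_column_free (q : R -> C) (l : R) (u v : R -> C) (c x : R) :
  lax_column q l u v -> (forall t, Rmin c x <= t <= Rmax c x -> q t = RtoC 0) ->
  (Cexpi (l * x) * u x = Cexpi (l * c) * u c)%C /\
  (Cexpi (- l * x) * v x = Cexpi (- l * c) * v c)%C.
Proof.
  intros S Q. split.
  - apply (cderiv_zero_const (fun x => Cexpi (l * x) * u x)%C). intros t Ht.
    destruct (S t) as [D1 D2].
    eapply cderiv_eq; [apply cderiv_mult; [apply cderiv_Cexpi|exact D1]|].
    unfold lax_diag, half_sqr. rewrite (Q t Ht), Cmod_0. simpl (0 ^ 2). rewrite Rmult_0_l. ring.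
  - apply (cderiv_zero_const (fun x => Cexpi (- l * x) * v x)%C). intros t Ht.
    destruct (S t) as [D1 D2].
    eapply cderiv_eq; [apply cderiv_mult; [apply cderiv_Cexpi|exact D2]|].
    unfold lax_diag, half_sqr. rewrite (Q t Ht), Cmod_0. simpl (0 ^ 2). rewrite Rmult_0_l, RtoC_opp.
    replace (Cconj 0) with (RtoC 0) by (apply C_ext; simpl; ring). ring.
Qed.

Lemma exp_sigma3_entry (Psi : M2) (t : R) (i : nat) : (i < 2)%nat ->
  entry (mul2 Psi (exp_sigma3 t)) i 0 = (Cexpi t * entry Psi i 0)%C /\
  entry (mul2 Psi (exp_sigma3 t)) i 1 = (Cexpi (- t) * entry Psi i 1)%C.
Proof.
  intro Hi. split; rewrite mul2_entry by lia; unfold exp_sigma3; rewrite !mat2_entry by lia; ring.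
Qed.

(** One formulation for both infinities: [Rmin] and [Rmax] make the order of c and x immaterial. *)
Definition free_near (q : R -> C) (s : Rbar) (c : R) : Prop :=
  Rbar_locally s (fun x => forall t, Rmin c x <= t <= Rmax c x -> q t = RtoC 0).

Lemma filterlim_eps (f : R -> C) (s : Rbar) (l : C) (P : R -> Prop) (eps : R) :
  filterlim f (Rbar_locally s) (locally l) -> Rbar_locally s P -> 0 < eps ->
  exists x, P x /\ Cmod (f x - l) < eps.
Proof.
  intros H HP He.
  assert (H1 := proj1 (filterlim_locally_ball_norm (K := C_AbsRing) (U := C_NormedModule)
      (F := Rbar_locally s) _ _) H (mkposreal eps He)).
  assert (H2 := filter_and _ _ HP H1). destruct (filter_ex _ H2) as [x [X1 X2]].
  exists x. split; [exact X1|exact X2].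
Qed.

Lemma small_eq_0 (r : R) : (forall eps, 0 < eps -> Rabs r < eps) -> r = 0.
Proof.
  intro H. destruct (Req_dec r 0) as [E|N]; [exact E|].
  specialize (H (Rabs r) (Rabs_pos_lt r N)). lra.
Qed.

(** Between c and s the solution is a free oscillation, so its normalization at infinity can be read
    off at c. *)
Lemma jost_entries (s : Rbar) (q : R -> C) (l c : R) (Psi : R -> M2) :
  free_near q s c -> is_jost s l q Psi ->
  entry (Psi c) 0 0 = Cexpi (- (l * c)) /\ entry (Psi c) 1 0 = RtoC 0 /\ entry (Psi c) 0 1 = RtoC 0.
Proof.
  intros Q [S N].
  assert (S0 := proj1 (lax_solution_columns l q Psi) S 0%nat ltac:(lia)).
  assert (S1 := proj1 (lax_solution_columns l q Psi) S 1%nat ltac:(lia)).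
  assert (inv : forall t z w, (Cexpi t * z = w)%C -> z = (Cexpi (- t) * w)%C).
  { intros t z w <-. rewrite Cmult_assoc, Cexpi_opp. ring. }
  (* An off-diagonal entry may keep oscillating after multiplication by the normalizing factor; only
     its modulus is constant, and the limit 0 forces it to vanish. *)
  assert (zero : forall i j, (i < 2)%nat -> (j < 2)%nat -> entry (@Mone C_Ring 2) i j = RtoC 0 ->
    forall k, (forall x, (forall t, Rmin c x <= t <= Rmax c x -> q t = RtoC 0) ->
      Cmod (entry (mul2 (Psi x) (exp_sigma3 (l * x))) i j) = Cmod k) -> k = RtoC 0).
  { intros i j Hi Hj E0 k Hk. apply Cmod_eq_0, small_eq_0. intros eps He.
    destruct (filterlim_eps _ _ _ _ eps (N i j Hi Hj) Q He) as [x [X1 X2]].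
    rewrite E0 in X2. unfold Cminus in X2. rewrite Copp_0, Cplus_0_r, (Hk x X1) in X2.
    rewrite Rabs_right; [exact X2|]. apply Rle_ge, Cmod_ge_0. }
  split; [|split].
  - rewrite <- (Cmult_1_r (Cexpi _)). apply inv.
    set (k := (Cexpi (l * c) * entry (Psi c) 0 0)%C).
    assert (K : Cmod (k - 1) = 0).
    { apply small_eq_0. intros eps He.
      destruct (filterlim_eps _ _ _ _ eps (N 0%nat 0%nat ltac:(lia) ltac:(lia)) Q He) as [x [X1 X2]].
      rewrite Mone_entry in X2 by lia.
      rewrite (proj1 (exp_sigma3_entry (Psi x) (l * x) 0 ltac:(lia))) in X2.
      rewrite (proj1 (lax_column_free _ _ _ _ c x S0 X1)) in X2.
      rewrite Rabs_right; [exact X2|]. apply Rle_ge, Cmod_ge_0. }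
    apply Cmod_eq_0 in K. replace k with (k - 1 + 1)%C by ring. rewrite K. ring.
  - apply (zero 1%nat 0%nat); try lia; [apply Mone_entry; lia|]. intros x Hx.
    rewrite (proj1 (exp_sigma3_entry (Psi x) (l * x) 1 ltac:(lia))).
    assert (F := proj2 (lax_column_free _ _ _ _ c x S0 Hx)). cbv beta in F.
    apply (f_equal Cmod) in F. rewrite !Cmod_mult, !Cmod_Cexpi in F.
    rewrite Cmod_mult, Cmod_Cexpi. lra.
  - apply (zero 0%nat 1%nat); try lia; [apply Mone_entry; lia|]. intros x Hx.
    rewrite (proj2 (exp_sigma3_entry (Psi x) (l * x) 0 ltac:(lia))).
    assert (F := proj1 (lax_column_free _ _ _ _ c x S1 Hx)). cbv beta in F.
    apply (f_equal Cmod) in F. rewrite !Cmod_mult, !Cmod_Cexpi in F.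
    rewrite Cmod_mult, Cmod_Cexpi. lra.
Qed.

(** With free data at c, the normalized matrix equals the identity from c towards s, so the limit is
    that of an eventually constant function. *)
Lemma jost_exists (s : Rbar) (q : R -> C) (l c : R) : ccont q -> free_near q s c ->
  exists p1 r1 p2 r2 : R -> C,
    is_jost s l q (fun x => mat2 (p1 x) (p2 x) (r1 x) (r2 x)) /\
    p1 c = Cexpi (- (l * c)) /\ r1 c = RtoC 0 /\ p2 c = RtoC 0 /\ r2 c = Cexpi (l * c).
Proof.
  intros Cq Q. destruct (lax_column_ccont q l Cq) as [C1 [C2 C3]].
  destruct (lin2_exists _ _ _ _ c (Cexpi (- (l * c))) (RtoC 0) C1 Cq C2 C3)
    as [p1 [r1 [S1 [E1 E2]]]].
  destruct (lin2_exists _ _ _ _ c (RtoC 0) (Cexpi (l * c)) C1 Cq C2 C3)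
    as [p2 [r2 [S2 [E3 E4]]]].
  exists p1, r1, p2, r2. split; [|repeat split; assumption]. split.
  - apply lax_solution_columns. intros j Hj.
    destruct j as [|[|j]]; [exact S1|exact S2|lia].
  - assert (opp : forall t, (- l * t) = - (l * t)) by (intro; ring).
    assert (ev : Rbar_locally s (fun x =>
      (Cexpi (l * x) * p1 x = 1)%C /\ (Cexpi (l * x) * r1 x = 0)%C /\
      (Cexpi (- (l * x)) * p2 x = 0)%C /\ (Cexpi (- (l * x)) * r2 x = 1)%C)).
    { eapply filter_imp; [|exact Q]. intros x Hx.
      destruct (lax_column_free q l p1 r1 c x S1 Hx) as [F1 F2].
      destruct (lax_column_free q l p2 r2 c x S2 Hx) as [F3 F4].
      rewrite E1, Cexpi_opp_r in F1. rewrite E2, Cmult_0_r in F2.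
      rewrite E3, Cmult_0_r in F3. rewrite E4, opp, opp, Cexpi_opp in F4.
      assert (cancel : forall t z, (Cexpi t * z = 0)%C -> z = RtoC 0).
      { intros t z H. apply Cmod_eq_0. apply (f_equal Cmod) in H.
        rewrite Cmod_mult, Cmod_Cexpi, Cmod_0 in H. lra. }
      repeat split.
      - exact F1.
      - rewrite (cancel _ _ F2). ring.
      - rewrite (cancel _ _ F3). ring.
      - exact F4. }
    intros i j Hi Hj.
    apply (filterlim_ext_loc (fun _ => entry (@Mone C_Ring 2) i j)).
    + eapply filter_imp; [|exact ev]. intros x [G1 [G2 [G3 G4]]].
      rewrite Mone_entry by lia. symmetry.
      destruct i as [|[|i]], j as [|[|j]]; try lia;
      [rewrite (proj1 (exp_sigma3_entry _ _ 0 ltac:(lia)))|rewrite (proj2 (exp_sigma3_entry _ _ 0 ltac:(lia)))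
      |rewrite (proj1 (exp_sigma3_entry _ _ 1 ltac:(lia)))|rewrite (proj2 (exp_sigma3_entry _ _ 1 ltac:(lia)))];
      rewrite mat2_entry by lia; assumption.
    + apply filterlim_const.
Qed.

(** At a the first row of Psi^- is (e^{-ila}, 0), so the (1,1) entry of Psi^+ = Psi^- T isolates
    that of T; the gauge factor e^{ila} cancels the exponential. *)
Lemma transition_entry (q : R -> C) (l a b : R) (T : M2) (u v : R -> C) : ccont q ->
  free_near q m_infty a -> free_near q p_infty b -> is_transition l q T ->
  uv q (RtoC l) u v -> u b = RtoC 1 -> v b = RtoC 0 -> entry T 0 0 = u a.
Proof.
  intros Cq Qa Qb [Pp [Pm [Jp [Jm E]]]] S Eu Ev.
  destruct (jost_entries _ _ _ _ _ Qa Jm) as [M1 [M2 M3]].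
  destruct (jost_entries _ _ _ _ _ Qb Jp) as [P1 [P2 _]].
  assert (S0 := lax_column_gauge _ _ _ _ (proj1 (lax_solution_columns l q Pp) (proj1 Jp) 0%nat ltac:(lia))).
  destruct (uv_unique q (RtoC l) _ _ _ _ b Cq S S0) with (x := a) as [Ua _].
  - cbv beta. rewrite P1, Eu, Cexpi_opp_r. reflexivity.
  - cbv beta. rewrite P2, Ev. ring.
  - rewrite Ua, E, mul2_entry by lia. rewrite M1, M3.
    replace (Cexpi (l * a) * (Cexpi (- (l * a)) * entry T 0 0 + 0 * entry T 1 0))%C
      with ((Cexpi (- (l * a)) * Cexpi (l * a)) * entry T 0 0)%C by ring.
    rewrite Cexpi_opp. ring.
Qed.

Lemma transition_exists (q : R -> C) (l a b : R) : ccont q ->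
  free_near q m_infty a -> free_near q p_infty b -> exists T, is_transition l q T.
Proof.
  intros Cq Qa Qb.
  destruct (jost_exists _ _ l _ Cq Qa) as [p1 [r1 [p2 [r2 [Jm [E1 [E2 [E3 E4]]]]]]]].
  destruct (jost_exists _ _ l _ Cq Qb) as [s1 [t1 [s2 [t2 [Jp _]]]]].
  set (P := fun x => mat2 (s1 x) (s2 x) (t1 x) (t2 x)) in *.
  set (M := fun x => mat2 (p1 x) (p2 x) (r1 x) (r2 x)) in *.
  (* At a, Psi^- is diag (e^{-ila}, e^{ila}); this is its inverse times Psi^+ there. *)
  set (T := mat2 (Cexpi (l * a) * s1 a)%C (Cexpi (l * a) * s2 a)%C
                 (Cexpi (- (l * a)) * t1 a)%C (Cexpi (- (l * a)) * t2 a)%C).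
  exists T, P, M. split; [exact Jp|]. split; [exact Jm|].
  destruct (lax_column_ccont q l Cq) as [C1 [C2 C3]].
  assert (cols : forall j, (j < 2)%nat -> forall x,
    entry (P x) 0 j = (entry T 0 j * p1 x + entry T 1 j * p2 x)%C /\
    entry (P x) 1 j = (entry T 0 j * r1 x + entry T 1 j * r2 x)%C).
  { intros j Hj.
    assert (SP := proj1 (lax_solution_columns l q P) (proj1 Jp) j Hj).
    assert (SM0 := proj1 (lax_solution_columns l q M) (proj1 Jm) 0%nat ltac:(lia)).
    assert (SM1 := proj1 (lax_solution_columns l q M) (proj1 Jm) 1%nat ltac:(lia)).
    apply (lin2_unique _ _ _ _ _ _ _ _ a C1 Cq C2 C3 SP
      (lin2_comb _ _ _ _ _ _ _ _ (entry T 0 j) (entry T 1 j) SM0 SM1)).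
    - change (entry (P a) 0 j = (entry T 0 j * p1 a + entry T 1 j * p2 a)%C).
      rewrite E1, E3. unfold P, T. destruct j as [|[|j]]; [| |lia]; rewrite !mat2_entry by lia.
      + transitivity ((Cexpi (- (l * a)) * Cexpi (l * a)) * s1 a)%C; [rewrite Cexpi_opp|]; ring.
      + transitivity ((Cexpi (- (l * a)) * Cexpi (l * a)) * s2 a)%C; [rewrite Cexpi_opp|]; ring.
    - change (entry (P a) 1 j = (entry T 0 j * r1 a + entry T 1 j * r2 a)%C).
      rewrite E2, E4. unfold P, T. destruct j as [|[|j]]; [| |lia]; rewrite !mat2_entry by lia.
      + transitivity ((Cexpi (- (l * a)) * Cexpi (l * a)) * t1 a)%C; [rewrite Cexpi_opp|]; ring.
      + transitivity ((Cexpi (- (l * a)) * Cexpi (l * a)) * t2 a)%C; [rewrite Cexpi_opp|]; ring. }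
  intro x. apply (coeff_mat_ext_aux (RtoC 0) (RtoC 0)). intros i j Hi Hj.
  change (entry (P x) i j = entry (mul2 (M x) T) i j). rewrite mul2_entry by assumption.
  destruct (cols j Hj x) as [K0 K1]. unfold M.
  destruct i as [|[|i]]; [| |lia]; [rewrite K0|rewrite K1]; rewrite !mat2_entry by lia; ring.
Qed.

Lemma free_near_right (q : R -> C) (b : R) : (forall x, b <= x -> q x = RtoC 0) -> free_near q p_infty b.
Proof.
  intro H. exists b. intros x Hx t Ht. rewrite Rmin_left in Ht by lra. apply H, Ht.
Qed.

Lemma free_near_left (q : R -> C) (a : R) : (forall x, x <= a -> q x = RtoC 0) -> free_near q m_infty a.
Proof.
  intro H. exists a. intros x Hx t Ht. rewrite Rmax_left in Ht by lra. apply H, Ht.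
Qed.

(** [F] witnesses [is_alpha q], so the epsilon choice satisfies it too. Both are entire and agree on
    the real axis, because the transition entry there is the same for every admissible T; the
    identity theorem then gives the formula at every complex l. *)
Lemma alpha_spec (q : R -> C) (a b : R) : ccont q ->
  (forall x, x <= a -> q x = RtoC 0) -> (forall x, b <= x -> q x = RtoC 0) ->
  entire (alpha q) /\
  forall l u v, uv q l u v -> u b = RtoC 1 -> v b = RtoC 0 -> alpha q l = u a.
Proof.
  intros Cq Ha Hb. apply free_near_left in Ha. apply free_near_right in Hb.
  assert (ch : forall l, exists w, exists u v, uv q l u v /\ u b = RtoC 1 /\ v b = RtoC 0 /\ w = u a).
  { intro l. destruct (uv_exists q l b (RtoC 1) (RtoC 0) Cq) as [u [v [S [E1 E2]]]].
    exists (u a), u, v. auto. }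
  set (F := fun l => epsilon (inhabits (RtoC 0))
    (fun w => exists u v, uv q l u v /\ u b = RtoC 1 /\ v b = RtoC 0 /\ w = u a)).
  assert (HF : forall l, exists u v, uv q l u v /\ u b = RtoC 1 /\ v b = RtoC 0 /\ F l = u a).
  { intro l. exact (epsilon_spec (inhabits (RtoC 0)) _ (ch l)). }
  assert (EF := uv_entire q a b F Cq HF).
  assert (AF : is_alpha q F).
  { split; [exact EF|]. intro l. destruct (transition_exists q l a b Cq Ha Hb) as [T HT].
    exists T. split; [exact HT|]. destruct (HF (RtoC l)) as [u [v [S [E1 [E2 ->]]]]].
    symmetry. exact (transition_entry q l a b T u v Cq Ha Hb HT S E1 E2). }
  assert (AA : is_alpha q (alpha q)).
  { unfold alpha. apply epsilon_spec. exists F. exact AF. }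
  destruct AA as [EA HA]. split; [exact EA|].
  intros l u v S E1 E2.
  assert (Z := entire_zero_on_reals (fun z => alpha q z - F z)%C (entire_minus _ _ EA EF)).
  assert (Z0 : (alpha q l - F l)%C = RtoC 0).
  { apply Z. intro x. destruct (HA x) as [T [HT ->]].
    destruct (HF (RtoC x)) as [u1 [v1 [S1 [G1 [G2 ->]]]]].
    rewrite (transition_entry q x a b T u1 v1 Cq Ha Hb HT S1 G1 G2). ring. }
  destruct (HF l) as [u1 [v1 [S1 [G1 [G2 G]]]]].
  destruct (uv_unique q l u v u1 v1 b Cq S S1) with (x := a) as [Ua _]; [congruence|congruence|].
  rewrite Ua, <- G. replace (alpha q l) with (alpha q l - F l + F l)%C by ring. rewrite Z0. ring.
Qed.

(** * Splitting of a multiple zero *)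

Lemma contraction_fixed_point (N : C -> C) (tau : R) : 0 < tau ->
  (forall t, Cmod t <= tau -> Cmod (N t) <= tau) ->
  (forall t t', Cmod t <= tau -> Cmod t' <= tau -> Cmod (N t - N t') <= / 2 * Cmod (t - t')) ->
  exists t, Cmod t <= tau /\ N t = t.
Proof.
  intros Ht Hself Hcon.
  set (x := fix x (k : nat) : C := match k with O => RtoC 0 | S j => N (x j) end).
  assert (Hx : forall k, Cmod (x k) <= tau).
  { induction k as [|k IH]; simpl; [rewrite Cmod_0; lra|apply Hself, IH]. }
  (* The increments, preceded by 0, so that the k-th partial sum is exactly [x k]; this shift
     doubles the constant to [4 * tau] below. *)
  set (a := fun k => match k with O => RtoC 0 | S j => (x (S j) - x j)%C end).
  assert (Sa : forall k, csum a k = x k).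
  { induction k as [|k IH]; [reflexivity|]. cbn [csum]. rewrite IH. unfold a. ring. }
  assert (inc : forall k, Cmod (x (S k) - x k) <= 2 * tau / 2 ^ k).
  { induction k as [|k IH].
    - unfold Cminus. triangle. rewrite Cmod_opp.
      pose proof (Hx 1%nat); pose proof (Hx O). simpl pow. lra.
    - eapply Rle_trans; [apply (Hcon (x (S k)) (x k)); apply Hx|].
      replace (2 * tau / 2 ^ S k) with (/ 2 * (2 * tau / 2 ^ k)).
      + apply Rmult_le_compat_l; lra.
      + simpl. field. apply pow_nonzero. lra. }
  destruct (CSer_exists a (4 * tau)) as [t Hl]; [lra| |].
  { intros [|k].
    - simpl. rewrite Cmod_0. lra.
    - eapply Rle_trans; [apply inc|]. right. simpl. field. apply pow_nonzero. lra. }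
  assert (lim : forall eps, 0 < eps -> exists M, forall k, (M <= k)%nat -> Cmod (x k - t) < eps).
  { intros eps He. destruct (proj1 (CSer_eps _ _) Hl eps He) as [M HM]. exists M.
    intros k Hk. rewrite <- Sa. apply HM, Hk. }
  assert (Bt : Cmod t <= tau).
  { apply le_epsilon. intros eps He. destruct (lim eps He) as [M HM].
    specialize (HM M (le_n M)). replace t with (x M + - (x M - t))%C by ring.
    triangle. rewrite Cmod_opp. specialize (Hx M). lra. }
  exists t. split; [exact Bt|].
  assert (Z : Cmod (N t - t) = 0).
  { apply Rle_antisym; [|apply Cmod_ge_0]. apply le_epsilon. intros eps He.
    destruct (lim (eps / 2) ltac:(lra)) as [M HM].
    assert (H1 := HM M (le_n M)). assert (H2 := HM (S M) ltac:(lia)).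
    replace (N t - t)%C with (- (N (x M) - N t) + (x (S M) - t))%C by (simpl; ring).
    triangle. rewrite Cmod_opp.
    assert (H3 := Hcon (x M) t (Hx M) Bt). lra. }
  apply Cmod_eq_0 in Z. replace (N t) with (N t - t + t)%C by ring. rewrite Z. ring.
Qed.

Definition pow_rem (n : nat) (t : C) : C := ((1 + t) ^ n - 1 - RtoC (INR n) * t)%C.

Lemma pow_rem_0 (n : nat) : pow_rem n 0 = RtoC 0.
Proof. unfold pow_rem. rewrite Cplus_0_r, Cpow_1_l. ring. Qed.

(** The remainder is quadratic at 0, hence the factor tau. The induction uses R_{n+1}(t) = (1 + t)
    R_n(t) + n t^2, which for tau <= 1 gives the recursion K -> 3 K + 2 n. *)
Lemma pow_rem_lipschitz (n : nat) : exists K, 0 <= K /\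
  forall tau, 0 <= tau <= 1 -> forall t t', Cmod t <= tau -> Cmod t' <= tau ->
    Cmod (pow_rem n t - pow_rem n t') <= K * tau * Cmod (t - t').
Proof.
  induction n as [|n [K [HK IH]]].
  - exists 0. split; [lra|]. intros. unfold pow_rem; simpl.
    replace (1 - 1 - 0 * t - (1 - 1 - 0 * t'))%C with (RtoC 0) by ring. rewrite Cmod_0. lra.
  - exists (3 * K + 2 * INR n). pose proof (pos_INR n). split; [lra|].
    intros tau Htau t t' Ht Ht'.
    replace (pow_rem (S n) t - pow_rem (S n) t')%C with
      ((1 + t) * (pow_rem n t - pow_rem n t') + (t - t') * (pow_rem n t' + RtoC (INR n) * (t + t')))%C.
    2:{ unfold pow_rem. rewrite S_INR, RtoC_plus. simpl. ring. }
    assert (D := IH tau Htau t t' Ht Ht').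
    assert (D0 := IH tau Htau t' (RtoC 0) Ht' ltac:(rewrite Cmod_0; lra)).
    rewrite pow_rem_0 in D0.
    replace (pow_rem n t' - 0)%C with (pow_rem n t') in D0 by ring.
    replace (t' - 0)%C with t' in D0 by ring.
    triangle. rewrite !Cmod_mult.
    pose proof (Cmod_ge_0 (t - t')). pose proof (Cmod_ge_0 t'). pose proof (Cmod_ge_0 t).
    assert (A1 : Cmod (1 + t) <= 2).
    { triangle. rewrite Cmod_1. lra. }
    assert (A2 : Cmod (pow_rem n t' + RtoC (INR n) * (t + t')) <= K * tau + INR n * (2 * tau)).
    { triangle. apply Rplus_le_compat.
      - eapply Rle_trans; [exact D0|]. rewrite <- (Rmult_1_r (K * tau)) at 2.
        apply Rmult_le_compat_l; [apply Rmult_le_pos|]; lra.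
      - rewrite Cmod_mult, Cmod_RtoC_pos by lra. apply Rmult_le_compat_l; [lra|].
        triangle. lra. }
    assert (A3 : Cmod (1 + t) * Cmod (pow_rem n t - pow_rem n t') <= 2 * (K * tau * Cmod (t - t'))).
    { apply Rmult_le_compat; try apply Cmod_ge_0; assumption. }
    assert (A4 : Cmod (t - t') * Cmod (pow_rem n t' + RtoC (INR n) * (t + t'))
      <= Cmod (t - t') * (K * tau + INR n * (2 * tau))) by (apply Rmult_le_compat_l; assumption).
    lra.
Qed.

(* Near t = 0 the map (1 + t)^n is a small perturbation of 1 + n t. *)
Lemma nth_power_near_1 (n : nat) : (1 <= n)%nat -> exists tau0, 0 < tau0 <= / 2 /\
  forall tau, 0 < tau <= tau0 -> forall G : C -> C,
    (forall t t', Cmod t <= tau -> Cmod t' <= tau -> Cmod (G t - G t') <= / 4 * Cmod (t - t')) ->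
    (forall t t', Cmod t <= tau -> Cmod t' <= tau ->
       / 2 * Cmod (t - t') <= Cmod (((1 + t) ^ n - G t) - ((1 + t') ^ n - G t'))) /\
    (Cmod (G 0 - 1) <= tau / 4 -> exists t, Cmod t <= 3 / 4 * tau /\ ((1 + t) ^ n)%C = G t).
Proof.
  intro Hn. destruct (pow_rem_lipschitz n) as [K [HK B]].
  assert (Hn1 : 1 <= INR n) by (apply (le_INR 1), Hn).
  exists (Rmin (/ 2) (/ (4 * (K + 1)))).
  assert (P : 0 < / (4 * (K + 1))) by (apply Rinv_0_lt_compat; lra).
  split; [split; [apply Rmin_pos; lra|apply Rmin_l]|].
  intros tau [Htau Hle] G HG.
  assert (T1 : tau <= / 2) by (eapply Rle_trans; [exact Hle|apply Rmin_l]).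
  assert (T2 : tau <= / (4 * (K + 1))) by (eapply Rle_trans; [exact Hle|apply Rmin_r]).
  assert (T3 : K * tau <= / 4).
  { assert ((K + 1) * tau <= (K + 1) * / (4 * (K + 1))) by (apply Rmult_le_compat_l; lra).
    replace ((K + 1) * / (4 * (K + 1))) with (/ 4) in H by (field; lra). lra. }
  assert (HR : forall t t', Cmod t <= tau -> Cmod t' <= tau ->
    Cmod (pow_rem n t - pow_rem n t') <= / 4 * Cmod (t - t')).
  { intros t t' Ht Ht'. eapply Rle_trans; [apply (B tau ltac:(lra) t t' Ht Ht')|].
    apply Rmult_le_compat_r; [apply Cmod_ge_0|exact T3]. }
  assert (Hn0 : RtoC (INR n) <> RtoC 0) by (apply RtoC_neq_0; lra).
  split.
  - intros t t' Ht Ht'.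
    replace ((1 + t) ^ n - G t - ((1 + t') ^ n - G t'))%C with
      (RtoC (INR n) * (t - t') - - ((pow_rem n t - pow_rem n t') - (G t - G t')))%C
      by (unfold pow_rem; ring).
    assert (L : forall z w : C, Cmod z - Cmod w <= Cmod (z - w)).
    { intros z w. assert (Q := Cmod_triangle (z - w) w).
      replace (z - w + w)%C with z in Q by ring. lra. }
    eapply Rle_trans; [|apply L]. rewrite Cmod_mult, Cmod_RtoC_pos, Cmod_opp by lra.
    unfold Cminus at 3. assert (Q := Cmod_triangle (pow_rem n t - pow_rem n t') (- (G t - G t'))).
    rewrite Cmod_opp in Q. specialize (HR t t' Ht Ht'). specialize (HG t t' Ht Ht').
    pose proof (Cmod_ge_0 (t - t')).
    assert (1 * Cmod (t - t') <= INR n * Cmod (t - t')) by (apply Rmult_le_compat_r; assumption).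
    lra.
  - intro H0. set (N := fun t => ((G t - 1 - pow_rem n t) / RtoC (INR n))%C).
    assert (Ninv : forall z, Cmod (z / RtoC (INR n)) <= Cmod z).
    { intro z. rewrite Cmod_div, Cmod_RtoC_pos by (lra || assumption).
      pose proof (Cmod_ge_0 z). apply (Rmult_le_reg_r (INR n)); [lra|].
      unfold Rdiv. rewrite Rmult_assoc, Rinv_l, Rmult_1_r by lra.
      rewrite <- (Rmult_1_r (Cmod z)) at 1. apply Rmult_le_compat_l; lra. }
    assert (NL : forall t t', Cmod t <= tau -> Cmod t' <= tau ->
      Cmod (N t - N t') <= / 2 * Cmod (t - t')).
    { intros t t' Ht Ht'.
      replace (N t - N t')%C with (((G t - G t') + - (pow_rem n t - pow_rem n t')) / RtoC (INR n))%C
        by (unfold N; field; assumption).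
      eapply Rle_trans; [apply Ninv|]. triangle.
      rewrite Cmod_opp. specialize (HR t t' Ht Ht'). specialize (HG t t' Ht Ht'). lra. }
    (* tau / 4 from the centre plus tau / 2 from the contraction: the solution stays at distance tau
       / 4 from the boundary, room that later serves to bound the function below around a zero. *)
    assert (NB : forall t, Cmod t <= tau -> Cmod (N t) <= 3 / 4 * tau).
    { intros t Ht. replace (N t) with (N 0 + (N t - N 0))%C by ring.
      triangle.
      assert (N0 : Cmod (N 0) <= tau / 4).
      { unfold N. eapply Rle_trans; [apply Ninv|]. rewrite pow_rem_0.
        replace (G 0 - 1 - 0)%C with (G 0 - 1)%C by ring. exact H0. }
      assert (Q := NL t (RtoC 0) Ht ltac:(rewrite Cmod_0; lra)).
      replace (t - 0)%C with t in Q by ring. lra. }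
    destruct (contraction_fixed_point N tau Htau) as [t [Ht Et]].
    + intros t Ht. specialize (NB t Ht). lra.
    + exact NL.
    + exists t. split; [rewrite <- Et; apply NB, Ht|].
      assert (E : (RtoC (INR n) * N t)%C = (G t - 1 - pow_rem n t)%C)
        by (unfold N; field; assumption).
      rewrite Et in E. unfold pow_rem in E.
      replace (G t) with ((G t - 1 - ((1 + t) ^ n - 1 - RtoC (INR n) * t)) + 1 + ((1 + t) ^ n - 1 - RtoC (INR n) * t))%C by ring.
      rewrite <- E. ring.
Qed.

(** * Polar form and roots of unity *)

Lemma Cexpi_plus (s t : R) : Cexpi (s + t) = (Cexpi s * Cexpi t)%C.
Proof. unfold Cexpi. rewrite cos_plus, sin_plus. apply C_ext; simpl; ring. Qed.

Lemma Cexpi_0 : Cexpi 0 = RtoC 1.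
Proof. unfold Cexpi. rewrite cos_0, sin_0. reflexivity. Qed.

Lemma Cexpi_pow (t : R) (n : nat) : (Cexpi t ^ n)%C = Cexpi (INR n * t).
Proof.
  induction n as [|n IH].
  - simpl. rewrite Rmult_0_l. symmetry. apply Cexpi_0.
  - rewrite Cpow_S, IH, S_INR, <- Cexpi_plus. f_equal. ring.
Qed.

Lemma Cexpi_2PI : Cexpi (2 * PI) = RtoC 1.
Proof. unfold Cexpi. rewrite cos_2PI, sin_2PI. reflexivity. Qed.

Lemma Cexpi_eq_1 (t : R) : Cexpi t = RtoC 1 -> sin (t / 2) = 0.
Proof.
  intro H. assert (Hc : cos t = 1) by (apply (f_equal fst) in H; exact H).
  replace t with (2 * (t / 2)) in Hc by lra. rewrite cos_2a_sin in Hc.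
  apply Rsqr_0_uniq. unfold Rsqr. lra.
Qed.

Lemma polar (w : C) : Cmod w = 1 -> exists t, 0 <= t < 2 * PI /\ w = Cexpi t.
Proof.
  intro H. destruct w as [x y].
  assert (E : x ^ 2 + y ^ 2 = 1).
  { assert (Q := Cmod2_alt (x, y)). rewrite H in Q. unfold Re, Im in Q; simpl in Q. simpl. lra. }
  assert (Hx : -1 <= x <= 1).
  { pose proof (pow2_ge_0 y). split; apply Rnot_lt_le; intro L.
    - assert (0 < (- x - 1) * (- x + 1)) by (apply Rmult_lt_0_compat; lra). lra.
    - assert (0 < (x - 1) * (x + 1)) by (apply Rmult_lt_0_compat; lra). lra. }
  pose proof PI_RGT_0. destruct (acos_bound x) as [B0 B1].
  assert (S : sqrt (1 - x²) = Rabs y).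
  { replace (1 - x²) with (y²) by (unfold Rsqr; lra). apply sqrt_Rsqr_abs. }
  destruct (Rle_dec 0 y) as [Hy|Hy].
  - exists (acos x). split; [lra|]. unfold Cexpi. rewrite cos_acos, sin_acos by assumption.
    rewrite S, Rabs_right by lra. reflexivity.
  - exists (2 * PI - acos x). split.
    + split; [lra|]. destruct (Req_dec (acos x) 0) as [Z|Z]; [|lra]. exfalso.
      assert (C1 := cos_acos x Hx). rewrite Z, cos_0 in C1. rewrite <- C1 in E.
      assert (0 < y ^ 2) by (apply pow2_gt_0; lra). lra.
    + unfold Cexpi. rewrite cos_minus, sin_minus, cos_2PI, sin_2PI, cos_acos, sin_acos by assumption.
      rewrite S, Rabs_left by lra. apply C_ext; simpl; ring.
Qed.

Lemma nth_root_exists (n : nat) (c : C) : (1 <= n)%nat -> c <> RtoC 0 ->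
  exists z, (z ^ n)%C = c.
Proof.
  intros Hn Hc. assert (P : 0 < Cmod c) by (apply Cmod_gt_0, Hc).
  assert (HcR : RtoC (Cmod c) <> RtoC 0) by (apply RtoC_neq_0; lra).
  assert (Hn1 : 1 <= INR n) by (apply (le_INR 1), Hn).
  destruct (polar (c / RtoC (Cmod c))%C) as [t [_ Et]].
  { rewrite Cmod_div, Cmod_RtoC_pos by (lra || assumption). field. lra. }
  exists (RtoC (Rpower (Cmod c) (/ INR n)) * Cexpi (t / INR n))%C.
  rewrite Cpow_mult_l, Cexpi_pow, <- RtoC_pow, <- Rpower_pow by apply exp_pos.
  rewrite Rpower_mult, Rinv_l, Rpower_1 by lra.
  replace (INR n * (t / INR n)) with t by (field; lra). rewrite <- Et. field. exact HcR.
Qed.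

Lemma roots_of_unity (n : nat) : (1 <= n)%nat -> exists ws : list C,
  length ws = n /\ NoDup ws /\ forall w, In w ws <-> (w ^ n)%C = RtoC 1.
Proof.
  intro Hn. pose proof PI_RGT_0 as HPI.
  assert (Hn1 : 1 <= INR n) by (apply (le_INR 1), Hn).
  set (e := fun k : nat => Cexpi (2 * PI * INR k / INR n)).
  exists (map e (seq 0 n)).
  (* Equal values would make the sine of half the angle difference vanish, but that half lies
     strictly between 0 and PI. *)
  assert (sep : forall j k, (j < k)%nat -> (k < n)%nat -> e j <> e k).
  { intros j k Hjk Hk E. apply lt_INR in Hjk. apply lt_INR in Hk. pose proof (pos_INR j).
    assert (E1 : Cexpi (2 * PI * INR k / INR n - 2 * PI * INR j / INR n) = RtoC 1).
    { unfold Rminus. rewrite Cexpi_plus. fold (e k). rewrite <- E. unfold e.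
      rewrite Cmult_comm. apply Cexpi_opp. }
    apply Cexpi_eq_1 in E1.
    assert (0 < sin ((2 * PI * INR k / INR n - 2 * PI * INR j / INR n) / 2)); [|lra].
    replace ((2 * PI * INR k / INR n - 2 * PI * INR j / INR n) / 2) with (PI * ((INR k - INR j) / INR n))
      by (field; lra).
    assert (Q : 0 < (INR k - INR j) / INR n < 1).
    { split; [apply Rdiv_lt_0_compat; lra|]. apply (Rmult_lt_reg_r (INR n)); [lra|].
      unfold Rdiv. rewrite Rmult_assoc, Rinv_l by lra. lra. }
    apply sin_gt_0.
    - apply Rmult_lt_0_compat; lra.
    - rewrite <- (Rmult_1_r PI) at 2. apply Rmult_lt_compat_l; lra. }
  split; [|split].
  - rewrite length_map, length_seq. reflexivity.
  - apply FinFun.Injective_map_NoDup_in; [|apply seq_NoDup].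
    intros j k Hj Hk E. apply in_seq in Hj. apply in_seq in Hk.
    destruct (Compare_dec.lt_eq_lt_dec j k) as [[L|L]|L]; [|exact L|].
    + exfalso. apply (sep j k L); [lia|exact E].
    + exfalso. apply (sep k j L); [lia|symmetry; exact E].
  - intro w. split.
    + intro H. apply in_map_iff in H. destruct H as [k [<- _]]. unfold e. rewrite Cexpi_pow.
      replace (INR n * (2 * PI * INR k / INR n)) with (INR k * (2 * PI)) by (field; lra).
      rewrite <- Cexpi_pow, Cexpi_2PI. apply Cpow_1_l.
    + intro H. assert (M : Cmod w = 1).
      { assert (Mn : Cmod w ^ n = 1) by (rewrite <- Cmod_pow, H; apply Cmod_1).
        pose proof (Cmod_ge_0 w).
        destruct (Rtotal_order (Cmod w) 1) as [L|[E|L]]; [|exact E|]; exfalso.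
        - assert (Cmod w ^ n < 1); [|lra]. apply pow_lt_1_compat; [lra|lia].
        - assert (1 < Cmod w ^ n); [|lra]. apply Rlt_pow_R1; [lra|lia]. }
      (* Here sin (n t / 2) = 0, so n t / 2 = k PI, and 0 <= t < 2 PI leaves 0 <= k < n. *)
      destruct (polar w M) as [t [Ht ->]]. rewrite Cexpi_pow in H. apply Cexpi_eq_1 in H.
      apply sin_eq_0_0 in H. destruct H as [k Hk].
      assert (Et : t = 2 * PI * IZR k / INR n).
      { apply (Rmult_eq_reg_l (INR n / 2)); [|lra].
        replace (INR n / 2 * t) with (INR n * t / 2) by field. rewrite Hk. field. lra. }
      assert (K0 : (0 <= k)%Z).
      { apply le_IZR. apply Rnot_lt_le. intro L.
        assert (INR n * t / 2 < 0); [rewrite Hk; nra|]. nra. }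
      assert (K1 : (k < Z.of_nat n)%Z).
      { apply lt_IZR. rewrite <- INR_IZR_INZ. apply (Rmult_lt_reg_r PI); [lra|]. rewrite <- Hk.
        nra. }
      apply in_map_iff. exists (Z.to_nat k). split.
      * unfold e. rewrite INR_IZR_INZ, Znat.Z2Nat.id by exact K0. rewrite Et. reflexivity.
      * apply in_seq. lia.
Qed.

(** * Rescaling near a multiple zero *)

Lemma Cmod_minus_le (z w : C) : Cmod (z - w) <= Cmod z + Cmod w.
Proof. unfold Cminus. triangle. rewrite Cmod_opp. lra. Qed.

Lemma Cmod_minus_ge (z w : C) : Cmod z - Cmod w <= Cmod (z - w).
Proof.
  assert (Q := Cmod_triangle (z - w) w). replace (z - w + w)%C with z in Q by ring. lra.
Qed.

(** A crude replacement for the n-th root of K: a number above K + 1 exceeds K already at its first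
    power, and higher powers only increase it. *)
Lemma pow_le_bound (x K : R) (n : nat) : (1 <= n)%nat -> 0 <= x -> 0 <= K -> x ^ n <= K -> x <= K + 1.
Proof.
  intros Hn Hx HK H. apply Rnot_lt_le. intro L. assert (1 <= x ^ (n - 1)) by (apply pow_R1_Rle; lra).
  replace n with (S (n - 1)) in H by lia. simpl in H.
  assert (x * 1 <= x * x ^ (n - 1)) by (apply Rmult_le_compat_l; lra). lra.
Qed.

Lemma root_scale (n : nat) (m : R) : (1 <= n)%nat -> 0 < m -> exists e, 0 < e /\ e ^ n = m.
Proof.
  intros Hn Hm. assert (Hn1 : 1 <= INR n) by (apply (le_INR 1), Hn).
  exists (Rpower m (/ INR n)). split; [apply exp_pos|].
  rewrite <- Rpower_pow by apply exp_pos. rewrite Rpower_mult, Rinv_l, Rpower_1 by lra.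
  reflexivity.
Qed.

Lemma pow_lt_inv (x y : R) (n : nat) : 0 <= y -> x ^ n < y ^ n -> x < y.
Proof.
  intros Hy H. apply Rnot_le_lt. intro L. assert (y ^ n <= x ^ n) by (apply pow_incr; lra). lra.
Qed.

(* Substituting z = e zeta with e^n = m turns z^n g(z) + m E(z) = 0 into
   zeta^n = - E(e zeta) / g(e zeta), whose right-hand side is nearly constant. *)
Lemma split_zeros (n : nat) (g : C -> C) (L rho0 k0 : R) :
  (1 <= n)%nat -> 0 <= L -> 0 < rho0 -> 0 < k0 -> g (RtoC 0) <> RtoC 0 ->
  (forall z w, Cmod z <= rho0 -> Cmod w <= rho0 -> Cmod (g z - g w) <= L * Cmod (z - w)) ->
  exists rho1, 0 < rho1 /\ forall rho, 0 < rho <= rho1 -> exists m0, 0 < m0 /\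
    forall m, 0 < m < m0 -> forall (E : C -> C) (kap : C), Cmod kap = k0 ->
    (forall z w, Cmod z <= rho0 -> Cmod w <= rho0 -> Cmod (E z - E w) <= L * Cmod (z - w)) ->
    Cmod (E (RtoC 0) - kap) <= L * m ->
    exists zs, length zs = n /\ NoDup zs /\
      (forall z, In z zs -> Cmod z < rho /\ (z ^ n * g z + RtoC m * E z)%C = RtoC 0 /\
         exists c eta, 0 < c /\ 0 < eta /\ forall w, Cmod (w - z) < eta ->
           c * Cmod (w - z) <= Cmod (w ^ n * g w + RtoC m * E w)) /\
      (forall z, Cmod z < rho -> (z ^ n * g z + RtoC m * E z)%C = RtoC 0 -> In z zs).
Proof.
  intros Hn HL Hr0 Hk0 Hg0 Lg.
  set (g0 := Cmod (g (RtoC 0))). assert (Pg : 0 < g0) by (apply Cmod_gt_0, Hg0).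
  destruct (nth_power_near_1 n Hn) as [tau0 [Htau0 NP]].
  destruct (roots_of_unity n Hn) as [ws [Lws [NDws Hws]]].
  (* The margin between tau and tau0 is for comparing branches: a quotient of two factors 1 + t with
     |t| <= tau is 1 + s with |s| <= tau0. *)
  set (tau := tau0 / 8). assert (Htau : 0 < tau) by (unfold tau; lra).
  assert (Pq : 0 < g0 / (2 * (L + 1))) by (apply Rdiv_lt_0_compat; lra).
  (* Within rho1 the function g stays within g0 / 2 of its value at 0, hence away from zero. *)
  destruct (pos_min3 rho0 1 (g0 / (2 * (L + 1)))) as [rho1 [H1p [H1a [H1b H1c]]]]; try lra.
  exists rho1. split; [exact H1p|].
  assert (at0 : forall z : C, (z - 0)%C = z) by (intro; ring).
  assert (C00 : Cmod (RtoC 0) <= rho0) by (rewrite Cmod_0; lra).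
  assert (gdiff : forall z, Cmod z <= rho1 -> Cmod (g z - g (RtoC 0)) <= g0 / 2 /\
     Cmod (g z - g (RtoC 0)) <= L).
  { intros z Hz. assert (Q := Lg z (RtoC 0) ltac:(lra) C00). rewrite at0 in Q.
    pose proof (Cmod_ge_0 z). split.
    - apply Rle_trans with (L * (g0 / (2 * (L + 1)))).
      + eapply Rle_trans; [exact Q|]. apply Rmult_le_compat_l; lra.
      + replace (L * (g0 / (2 * (L + 1)))) with (g0 / 2 - g0 / (2 * (L + 1))) by (field; lra). lra.
    - eapply Rle_trans; [exact Q|]. rewrite <- (Rmult_1_r L) at 2. apply Rmult_le_compat_l; lra. }
  assert (glow : forall z, Cmod z <= rho1 -> g0 / 2 <= Cmod (g z)).
  { intros z Hz. destruct (gdiff z Hz) as [Q _].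
    assert (T := Cmod_minus_ge (g (RtoC 0)) (g (RtoC 0) - g z)%C).
    replace (g (RtoC 0) - (g (RtoC 0) - g z))%C with (g z) in T by ring.
    replace (g (RtoC 0) - g z)%C with (- (g z - g (RtoC 0)))%C in T by ring.
    rewrite Cmod_opp in T. fold g0 in T. lra. }
  assert (gup : forall z, Cmod z <= rho1 -> Cmod (g z) <= g0 + L).
  { intros z Hz. destruct (gdiff z Hz) as [_ Q].
    assert (T := Cmod_triangle (g z - g (RtoC 0)) (g (RtoC 0))).
    replace (g z - g (RtoC 0) + g (RtoC 0))%C with (g z) in T by ring. fold g0 in T. lra. }
  (* [c0] is the modulus of the limiting value of zeta^n, [X] bounds its n-th roots, [K1] bounds
     zeta for every actual zero, and [Lp] is a Lipschitz constant of the normalized right-hand side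
     [p] below. *)
  set (c0 := k0 / g0). assert (Pc : 0 < c0) by (apply Rdiv_lt_0_compat; assumption).
  set (X := c0 + 1).
  set (K1 := (k0 + 2 * L) * (2 / g0) + 1).
  assert (PK1 : 1 <= K1).
  { unfold K1. assert (0 <= (k0 + 2 * L) * (2 / g0)); [|lra].
    apply Rmult_le_pos; [lra|]. left. apply Rdiv_lt_0_compat; lra. }
  set (Lp := (L * (g0 + L) + (k0 + 2 * L) * L) * (4 / (g0 ^ 2 * c0))).
  assert (PLp : 0 <= Lp).
  { unfold Lp. apply Rmult_le_pos.
    - assert (0 <= L * (g0 + L)) by (apply Rmult_le_pos; lra).
      assert (0 <= (k0 + 2 * L) * L) by (apply Rmult_le_pos; lra). lra.
    - left. apply Rdiv_lt_0_compat; [lra|]. apply Rmult_lt_0_compat; [apply pow_lt; lra|lra]. }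
  intros rho [Hrho Hrho1].
  (* [e * A1 < 1] keeps all candidates within rho, [e * A2 < 1] makes p close to 1 at 0, and
     [e * A3 < 1] makes p nearly constant at the scale e. As e^n = m, the bound m < (1 / H)^n yields
     all three. *)
  set (A1 := 2 * X / rho). set (A2 := L / k0 * (8 / tau)). set (A3 := Lp * (X + K1) * (8 / tau)).
  assert (PX : 1 < X) by (unfold X; lra).
  assert (PA1 : 0 <= A1) by (unfold A1; left; apply Rdiv_lt_0_compat; lra).
  assert (P8 : 0 < 8 / tau) by (apply Rdiv_lt_0_compat; lra).
  assert (PA2 : 0 <= A2).
  { unfold A2. apply Rmult_le_pos; [|lra]. apply Rmult_le_pos; [lra|].
    left. apply Rinv_0_lt_compat; lra. }
  assert (PA3 : 0 <= A3).
  { unfold A3. apply Rmult_le_pos; [|lra]. apply Rmult_le_pos; [exact PLp|lra]. }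
  set (H := 1 + A1 + A2 + A3). assert (PH : 1 <= H) by (unfold H; lra).
  exists ((/ H) ^ n). split; [apply pow_lt, Rinv_0_lt_compat; lra|].
  intros m [Hm Hm0] E kap Hkap LE E0.
  destruct (root_scale n m Hn Hm) as [e [He Hen]].
  assert (eH : e * H < 1).
  { assert (e < / H). { apply (pow_lt_inv e (/ H) n); [left; apply Rinv_0_lt_compat; lra|]. lra. }
    apply (Rmult_lt_compat_r H) in H0; [|lra]. rewrite Rinv_l in H0 by lra. exact H0. }
  assert (eparts : forall a, 0 <= a -> a <= H -> e * a < 1).
  { intros a Ha Hle. eapply Rle_lt_trans; [|exact eH]. apply Rmult_le_compat_l; lra. }
  assert (e1 : e < 1) by (rewrite <- (Rmult_1_r e); apply eparts; lra).
  assert (eA1 : e * A1 < 1) by (apply eparts; unfold H; lra).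
  assert (eA2 : e * A2 < 1) by (apply eparts; unfold H; lra).
  assert (eA3 : e * A3 < 1) by (apply eparts; unfold H; lra).
  assert (eX : 2 * e * X < rho).
  { unfold A1 in eA1. apply (Rmult_lt_compat_r rho) in eA1; [|lra].
    replace (e * (2 * X / rho) * rho) with (2 * e * X) in eA1 by (field; lra). lra. }
  assert (eL : e * (L / k0) <= tau / 8).
  { unfold A2 in eA2. apply (Rmult_lt_compat_r (tau / 8)) in eA2; [|lra].
    replace (e * (L / k0 * (8 / tau)) * (tau / 8)) with (e * (L / k0)) in eA2 by (field; lra). lra. }
  assert (eLp : e * (Lp * (X + K1)) <= tau / 8).
  { unfold A3 in eA3. apply (Rmult_lt_compat_r (tau / 8)) in eA3; [|lra].
    replace (e * (Lp * (X + K1) * (8 / tau)) * (tau / 8)) with (e * (Lp * (X + K1))) in eA3 by (field; lra). lra. }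
  assert (eLpX : e * (Lp * X) <= tau / 8).
  { eapply Rle_trans; [|exact eLp]. apply Rmult_le_compat_l; [lra|]. apply Rmult_le_compat_l; lra. }
  assert (eLpK : e * (Lp * K1) <= tau / 8).
  { eapply Rle_trans; [|exact eLp]. apply Rmult_le_compat_l; [lra|]. apply Rmult_le_compat_l; lra. }
  assert (me : m <= e).
  { rewrite <- Hen. replace n with (S (n - 1)) by lia. simpl.
    rewrite <- (Rmult_1_r e) at 3. apply Rmult_le_compat_l; [lra|].
    rewrite <- (pow1 (n - 1)). apply pow_incr. lra. }
  clear eA1 eA2 eA3 eparts eH Hm0. clearbody H. clear PH H.
  assert (Hkn : kap <> RtoC 0) by (apply Cmod_gt_0; lra).
  assert (Hen0 : RtoC e <> RtoC 0) by (apply RtoC_neq_0; lra).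
  assert (Hmn0 : RtoC m <> RtoC 0) by (apply RtoC_neq_0; lra).
  assert (Hem : (RtoC e ^ n)%C = RtoC m) by (rewrite <- RtoC_pow, Hen; reflexivity).
  set (c := (- kap / g (RtoC 0))%C).
  assert (Hc : Cmod c = c0).
  { unfold c. rewrite Cmod_div, Cmod_opp, Hkap by exact Hg0. reflexivity. }
  assert (Hcn : c <> RtoC 0) by (apply Cmod_gt_0; lra).
  assert (gn : forall z, Cmod z <= rho1 -> g z <> RtoC 0).
  { intros z Hz. apply Cmod_gt_0. specialize (glow z Hz). lra. }
  assert (Eup : forall z, Cmod z <= rho1 -> Cmod (E z) <= k0 + 2 * L).
  { intros z Hz. assert (Q := LE z (RtoC 0) ltac:(lra) C00). rewrite at0 in Q.
    replace (E z) with ((E z - E (RtoC 0)) + ((E (RtoC 0) - kap) + kap))%C by ring.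
    triangle.
    assert (T := Cmod_triangle (E (RtoC 0) - kap) kap).
    assert (L * Cmod z <= L * 1) by (apply Rmult_le_compat_l; lra).
    assert (L * m <= L * 1) by (apply Rmult_le_compat_l; lra). lra. }
  (* Normalized so that the equation reads zeta^n = c p(z) with p close to 1. *)
  set (p := fun z => (- E z / (g z * c))%C).
  assert (pL : forall z w, Cmod z <= rho1 -> Cmod w <= rho1 -> Cmod (p z - p w) <= Lp * Cmod (z - w)).
  { intros z w Hz Hw.
    replace (p z - p w)%C with (- ((E z - E w) * g w + E w * (g w - g z)) / (g z * g w * c))%C
      by (unfold p; field; repeat split; auto).
    assert (D : Cmod (g z * g w * c) >= g0 ^ 2 * c0 / 4).
    { rewrite !Cmod_mult, Hc. assert (Q1 := glow z Hz). assert (Q2 := glow w Hw).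
      assert (g0 / 2 * (g0 / 2) <= Cmod (g z) * Cmod (g w)) by (apply Rmult_le_compat; lra).
      assert (g0 / 2 * (g0 / 2) * c0 <= Cmod (g z) * Cmod (g w) * c0) by (apply Rmult_le_compat_r; lra).
      lra. }
    assert (PD : 0 < g0 ^ 2 * c0) by (apply Rmult_lt_0_compat; [apply pow_lt; lra|lra]).
    rewrite Cmod_div by (apply Cmod_gt_0; lra). rewrite Cmod_opp.
    assert (Nm : Cmod ((E z - E w) * g w + E w * (g w - g z)) <=
      (L * (g0 + L) + (k0 + 2 * L) * L) * Cmod (z - w)).
    { triangle. rewrite !Cmod_mult.
      assert (Q1 := LE z w ltac:(lra) ltac:(lra)). assert (Q2 := Lg w z ltac:(lra) ltac:(lra)).
      replace (w - z)%C with (- (z - w))%C in Q2 by ring. rewrite Cmod_opp in Q2.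
      assert (T1 : Cmod (E z - E w) * Cmod (g w) <= (L * Cmod (z - w)) * (g0 + L)).
      { apply Rmult_le_compat; auto using Cmod_ge_0. }
      assert (T2 : Cmod (E w) * Cmod (g w - g z) <= (k0 + 2 * L) * (L * Cmod (z - w))).
      { apply Rmult_le_compat; auto using Cmod_ge_0. }
      lra. }
    unfold Rdiv. apply Rle_trans with
      ((L * (g0 + L) + (k0 + 2 * L) * L) * Cmod (z - w) * (4 / (g0 ^ 2 * c0))).
    - apply Rmult_le_compat; [apply Cmod_ge_0|left; apply Rinv_0_lt_compat; lra|exact Nm|].
      replace (4 / (g0 ^ 2 * c0)) with (/ (g0 ^ 2 * c0 / 4)) by (field; lra).
      apply Rinv_le_contravar; lra.
    - unfold Lp. right. ring. }
  assert (p0 : Cmod (p (RtoC 0) - 1) <= tau / 8).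
  { replace (p (RtoC 0) - 1)%C with ((E (RtoC 0) - kap) / kap)%C
      by (unfold p, c; field; split; assumption).
    rewrite Cmod_div, Hkap by exact Hkn. apply Rle_trans with (e * (L / k0)); [|exact eL].
    unfold Rdiv. rewrite <- Rmult_assoc. apply Rmult_le_compat_r; [left; apply Rinv_0_lt_compat; lra|].
    assert (m * L <= e * L) by (apply Rmult_le_compat_r; lra). lra. }
  destruct (nth_root_exists n c Hn Hcn) as [zt Hzt].
  assert (Hztn : zt <> RtoC 0).
  { intro Q. apply Hcn. rewrite <- Hzt, Q. replace n with (S (n - 1)) by lia. simpl. ring. }
  assert (root_mod : forall z, (z ^ n)%C = c -> Cmod z <= X).
  { intros z Hz. unfold X. apply (pow_le_bound _ _ n Hn); [apply Cmod_ge_0|lra|].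
    rewrite <- Cmod_pow, Hz, Hc. lra. }
  assert (root_ws : forall w, In w ws -> ((zt * w) ^ n)%C = c).
  { intros w Hw. apply Hws in Hw. rewrite Cpow_mult_l, Hw, Hzt. ring. }
  assert (wn0 : forall w, In w ws -> w <> RtoC 0).
  { intros w Hw Q. apply Hws in Hw. rewrite Q in Hw. replace n with (S (n - 1)) in Hw by lia.
    simpl in Hw. rewrite Cmult_0_l in Hw. injection Hw. lra. }
  (* The n branches: w runs over the roots of unity and zt is one n-th root of c, so on each branch
     the equation becomes (1 + t)^n = p at [pt w t]. *)
  set (pt := fun w t => (RtoC e * (zt * w) * (1 + t))%C).
  assert (pt_small : forall w t, In w ws -> Cmod t <= tau -> Cmod (pt w t) < rho).
  { intros w t Hw Ht. unfold pt. rewrite !Cmod_mult, Cmod_RtoC_pos by lra.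
    rewrite <- Cmod_mult. assert (Q := root_mod _ (root_ws w Hw)).
    assert (T : Cmod (1 + t) <= 2).
    { triangle. rewrite Cmod_1. unfold tau in Ht. lra. }
    apply Rle_lt_trans with (e * X * 2); [|lra].
    apply Rmult_le_compat; [apply Rmult_le_pos; [lra|apply Cmod_ge_0]|apply Cmod_ge_0| |exact T].
    apply Rmult_le_compat_l; lra. }
  assert (F_pt : forall w t, In w ws -> Cmod t <= tau ->
    (pt w t ^ n * g (pt w t) + RtoC m * E (pt w t))%C
    = (RtoC m * g (pt w t) * c * ((1 + t) ^ n - p (pt w t)))%C).
  { intros w t Hw Ht. assert (S := pt_small w t Hw Ht).
    assert (Q : (pt w t ^ n)%C = (RtoC m * c * (1 + t) ^ n)%C).
    { unfold pt. rewrite 2!Cpow_mult_l, Hem, (root_ws w Hw). reflexivity. }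
    rewrite Q. unfold p. field. split; [exact Hcn|apply gn; lra]. }
  assert (GL : forall w, In w ws -> forall t t', Cmod t <= tau -> Cmod t' <= tau ->
    Cmod (p (pt w t) - p (pt w t')) <= / 4 * Cmod (t - t')).
  { intros w Hw t t' Ht Ht'.
    assert (S := pt_small w t Hw Ht). assert (S' := pt_small w t' Hw Ht').
    eapply Rle_trans; [apply pL; lra|].
    replace (pt w t - pt w t')%C with (RtoC e * (zt * w) * (t - t'))%C by (unfold pt; ring).
    rewrite (Cmod_mult (RtoC e * (zt * w))), (Cmod_mult (RtoC e)), Cmod_RtoC_pos by lra.
    rewrite <- Rmult_assoc. apply Rmult_le_compat_r; [apply Cmod_ge_0|].
    assert (Q := root_mod _ (root_ws w Hw)).
    apply Rle_trans with (e * (Lp * X)); [|unfold tau in *; lra].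
    replace (Lp * (e * Cmod (zt * w))) with (e * (Lp * Cmod (zt * w))) by ring.
    apply Rmult_le_compat_l; [lra|]. apply Rmult_le_compat_l; assumption. }
  assert (Ctau : Cmod (RtoC 0) <= tau) by (rewrite Cmod_0; lra).
  assert (G0 : forall w, In w ws -> Cmod (p (pt w 0) - 1) <= tau / 4).
  { intros w Hw. replace (p (pt w 0) - 1)%C with ((p (pt w 0) - p (RtoC 0)) + (p (RtoC 0) - 1))%C by ring.
    triangle.
    assert (S := pt_small w (RtoC 0) Hw Ctau).
    assert (Q := pL (pt w 0) (RtoC 0) ltac:(lra) ltac:(rewrite Cmod_0; lra)).
    rewrite at0 in Q.
    assert (Cmod (pt w 0) <= e * X).
    { unfold pt. rewrite Cplus_0_r, Cmult_1_r, Cmod_mult, Cmod_RtoC_pos by lra.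
      apply Rmult_le_compat_l; [lra|apply root_mod, root_ws, Hw]. }
    assert (Lp * Cmod (pt w 0) <= Lp * (e * X)) by (apply Rmult_le_compat_l; lra). lra. }
  assert (NPt := fun w Hw => NP tau ltac:(unfold tau in *; lra) (fun t => p (pt w t)) (GL w Hw)).
  set (sol := fun w => epsilon (inhabits (RtoC 0))
    (fun t => Cmod t <= 3 / 4 * tau /\ ((1 + t) ^ n)%C = p (pt w t))).
  assert (Hsol : forall w, In w ws -> Cmod (sol w) <= 3 / 4 * tau /\ ((1 + sol w) ^ n)%C = p (pt w (sol w))).
  { intros w Hw. unfold sol. apply epsilon_spec. apply (NPt w Hw), G0, Hw. }
  assert (one_t : forall t, Cmod t <= tau0 -> (1 + t)%C <> RtoC 0 /\ / 2 <= Cmod (1 + t)).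
  { intros t Ht. assert (Q := Cmod_minus_ge (RtoC 1) (- t)%C).
    replace (1 - - t)%C with (1 + t)%C in Q by ring. rewrite Cmod_1, Cmod_opp in Q.
    split; [apply Cmod_gt_0|]; lra. }
  exists (map (fun w => pt w (sol w)) ws). split; [|split; [|split]].
  - rewrite length_map. exact Lws.
  - apply FinFun.Injective_map_NoDup_in; [|exact NDws]. intros w w' Hw Hw' Q.
    destruct (Hsol w Hw) as [S1 S2]. destruct (Hsol w' Hw') as [S1' S2'].
    set (t := sol w) in *. set (t' := sol w') in *.
    assert (Q' : (w * (1 + t))%C = (w' * (1 + t'))%C).
    { unfold pt in Q. replace (w * (1 + t))%C with ((RtoC e * (zt * w) * (1 + t)) / (RtoC e * zt))%C
        by (field; split; assumption). rewrite Q. field; split; assumption. }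
    destruct (one_t t ltac:(unfold tau in *; lra)) as [T1 T2].
    (* If two branches meet, 1 + s = w / w' is a root of unity near 1; injectivity of s -> (1 + s)^n
       near 0 forces s = 0. *)
    set (s := ((t' - t) / (1 + t))%C).
    assert (Es : (1 + s)%C = ((1 + t') / (1 + t))%C) by (unfold s; field; exact T1).
    assert (Ews : (w' * (1 + s))%C = w).
    { rewrite Es. replace (w' * ((1 + t') / (1 + t)))%C with ((w' * (1 + t')) / (1 + t))%C
        by (field; exact T1). rewrite <- Q'. field. exact T1. }
    assert (Bs : Cmod s <= tau0).
    { unfold s. rewrite Cmod_div by exact T1. assert (Qm := Cmod_minus_le t' t).
      apply (Rmult_le_reg_r (Cmod (1 + t))); [lra|].
      unfold Rdiv. rewrite Rmult_assoc, Rinv_l, Rmult_1_r by lra.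
      apply Rle_trans with (tau0 * / 2); [unfold tau in *; lra|]. apply Rmult_le_compat_l; lra. }
    destruct (NP tau0 ltac:(lra) (fun _ => RtoC 1)) as [U _].
    { intros. replace (1 - 1)%C with (RtoC 0) by ring. rewrite Cmod_0.
      apply Rmult_le_pos; [lra|apply Cmod_ge_0]. }
    assert (Us := U s (RtoC 0) Bs ltac:(rewrite Cmod_0; lra)). cbv beta in Us.
    assert (Esn : ((1 + s) ^ n)%C = RtoC 1).
    { apply Hws in Hw. apply Hws in Hw'. rewrite <- Ews, Cpow_mult_l, Hw' in Hw.
      rewrite Cmult_1_l in Hw. exact Hw. }
    rewrite Esn, Cplus_0_r, Cpow_1_l, at0 in Us.
    replace (1 - 1 - (1 - 1))%C with (RtoC 0) in Us by ring. rewrite Cmod_0 in Us.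
    assert (Zs : s = RtoC 0) by (apply Cmod_eq_0; pose proof (Cmod_ge_0 s); lra).
    rewrite Zs, Cplus_0_r, Cmult_1_r in Ews. symmetry. exact Ews.
  - intros z Hz. apply in_map_iff in Hz. destruct Hz as [w [<- Hw]].
    destruct (Hsol w Hw) as [S1 S2]. set (t := sol w) in *.
    assert (Ht : Cmod t <= tau) by lra.
    split; [apply pt_small; assumption|]. split.
    + rewrite F_pt, S2 by assumption. ring.
    + set (q := (RtoC e * (zt * w))%C).
      assert (Hq : q <> RtoC 0) by (repeat apply Cmult_neq_0; auto).
      assert (Pq' : 0 < Cmod q) by (apply Cmod_gt_0, Hq).
      (* The slope multiplies the lower bounds of the factors m, g, c in [F_pt] by the expansion
         constant 1/2 in t and by dt/dz, of modulus 1 / |q|; the radius uses up the margin left by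
         [3 / 4 * tau]. *)
      exists (m * (g0 / 2) * c0 * (/ 2 * / Cmod q)), (Cmod q * (tau / 4)).
      assert (Pi : 0 < / Cmod q) by (apply Rinv_0_lt_compat; lra).
      assert (P1 : 0 < m * (g0 / 2)) by (apply Rmult_lt_0_compat; lra).
      split; [apply Rmult_lt_0_compat; [apply Rmult_lt_0_compat; lra|lra]|].
      split; [apply Rmult_lt_0_compat; lra|].
      intros v Hv. set (t' := (t + (v - pt w t) / q)%C).
      assert (Ev : v = pt w t').
      { unfold t', pt. fold q. field. exact Hq. }
      assert (Ed : Cmod (t' - t) = Cmod (v - pt w t) * / Cmod q).
      { unfold t'. replace (t + (v - pt w t) / q - t)%C with ((v - pt w t) / q)%C by ring.
        rewrite Cmod_div by exact Hq. reflexivity. }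
      assert (Bd : Cmod (t' - t) <= tau / 4).
      { rewrite Ed. apply (Rmult_le_reg_r (Cmod q)); [lra|].
        rewrite Rmult_assoc, Rinv_l, Rmult_1_r by lra. lra. }
      assert (Ht' : Cmod t' <= tau).
      { replace t' with ((t' - t) + t)%C by ring. triangle. lra. }
      assert (Low := proj1 (NPt w Hw) t' t Ht' Ht). cbv beta in Low.
      rewrite S2 in Low. replace (p (pt w t) - p (pt w t))%C with (RtoC 0) in Low by ring.
      rewrite at0 in Low.
      rewrite Ev at 2 3 4. rewrite F_pt by assumption.
      rewrite !Cmod_mult, Hc, Cmod_RtoC_pos by lra.
      assert (S := pt_small w t' Hw Ht'). assert (Q := glow (pt w t') ltac:(lra)).
      replace (m * (g0 / 2) * c0 * (/ 2 * / Cmod q) * Cmod (v - pt w t)) with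
        (m * (g0 / 2) * c0 * (/ 2 * (Cmod (v - pt w t) * / Cmod q))) by ring.
      rewrite <- Ed. apply Rmult_le_compat; [|
        apply Rmult_le_pos; [lra|apply Cmod_ge_0]| |exact Low].
      * apply Rmult_le_pos; lra.
      * apply Rmult_le_compat_r; [lra|]. apply Rmult_le_compat_l; lra.
  - intros z Hz Fz. set (zeta := (z / RtoC e)%C).
    assert (Ez : z = (RtoC e * zeta)%C) by (unfold zeta; field; exact Hen0).
    assert (gz : g z <> RtoC 0) by (apply gn; lra).
    assert (Eq1 : (zeta ^ n)%C = (c * p z)%C).
    { assert (R1 : (RtoC m * (zeta ^ n * g z + E z))%C = RtoC 0).
      { rewrite <- Fz. rewrite Ez at 3. rewrite Cpow_mult_l, Hem. ring. }
      assert (R2 : (zeta ^ n * g z + E z)%C = RtoC 0).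
      { replace (zeta ^ n * g z + E z)%C with (RtoC m * (zeta ^ n * g z + E z) / RtoC m)%C
          by (field; exact Hmn0). rewrite R1. field. exact Hmn0. }
      replace (zeta ^ n)%C with ((zeta ^ n * g z + E z) / g z - E z / g z)%C by (field; exact gz).
      rewrite R2. unfold p. field. split; assumption. }
    assert (Bz : Cmod zeta <= K1).
    { unfold K1. apply (pow_le_bound _ _ n Hn); [apply Cmod_ge_0|
        unfold K1 in PK1; lra|].
      rewrite <- Cmod_pow, Eq1.
      replace (c * p z)%C with (- E z / g z)%C by (unfold p; field; split; assumption).
      rewrite Cmod_div, Cmod_opp by exact gz.
      assert (Q1 := Eup z ltac:(lra)). assert (Q2 := glow z ltac:(lra)).
      unfold Rdiv at 1. apply Rmult_le_compat; [apply Cmod_ge_0|left; apply Rinv_0_lt_compat; lra|exact Q1|].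
      replace (2 / g0) with (/ (g0 / 2)) by (field; lra). apply Rinv_le_contravar; lra. }
    assert (Pz : Cmod (p z - 1) <= tau / 4).
    { replace (p z - 1)%C with ((p z - p (RtoC 0)) + (p (RtoC 0) - 1))%C by ring.
      triangle.
      assert (Q := pL z (RtoC 0) ltac:(lra) ltac:(rewrite Cmod_0; lra)).
      rewrite at0 in Q. rewrite Ez, Cmod_mult, Cmod_RtoC_pos in Q by lra.
      rewrite <- Ez in Q.
      assert (Lp * (e * Cmod zeta) <= Lp * (e * K1)).
      { apply Rmult_le_compat_l; [lra|]. apply Rmult_le_compat_l; lra. }
      lra. }
    (* Completeness: p z is frozen as a constant near 1 and its n-th root 1 + s near 1 is divided
       out of zeta / zt. What remains is a root of unity, and uniqueness on its branch identifies s
       with [sol w]. *)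
    destruct (NP tau ltac:(unfold tau in *; lra) (fun _ => p z)) as [_ X2].
    { intros. replace (p z - p z)%C with (RtoC 0) by ring. rewrite Cmod_0.
      apply Rmult_le_pos; [lra|apply Cmod_ge_0]. }
    destruct (X2 Pz) as [s [Bs Es]].
    destruct (one_t s ltac:(unfold tau in *; lra)) as [T1 T2].
    set (w := (zeta / ((1 + s) * zt))%C).
    assert (Ewz : zeta = (zt * w * (1 + s))%C) by (unfold w; field; split; assumption).
    assert (Hw : In w ws).
    { apply Hws. assert (Q : (c * w ^ n * p z)%C = (c * p z)%C).
      { rewrite <- Eq1, Ewz, !Cpow_mult_l, Hzt, Es. reflexivity. }
      assert (pn : p z <> RtoC 0).
      { rewrite <- Es. apply Cpow_nz, T1. }
      replace (w ^ n)%C with ((c * w ^ n * p z) / (c * p z))%C by (field; split; assumption).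
      rewrite Q. field. split; assumption. }
    assert (Ept : z = pt w s).
    { unfold pt. rewrite Ez, Ewz. ring. }
    destruct (Hsol w Hw) as [S1 S2].
    assert (Low := proj1 (NPt w Hw) s (sol w) ltac:(lra) ltac:(lra)). cbv beta in Low.
    rewrite S2, Es, <- Ept in Low.
    replace (p z - p z - (p (pt w (sol w)) - p (pt w (sol w))))%C with (RtoC 0) in Low by ring.
    rewrite Cmod_0 in Low.
    assert (Zs : (s - sol w)%C = RtoC 0) by (apply Cmod_eq_0; pose proof (Cmod_ge_0 (s - sol w)); lra).
    apply in_map_iff. exists w. split; [|exact Hw].
    replace (sol w) with (s - (s - sol w))%C by ring. rewrite Zs, at0. symmetry. exact Ept.
Qed.

(** * Profiles of the perturbation *)

(** Carrying the derivatives as functions makes closure under sums, products and affine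
    substitutions a plain induction. *)
Fixpoint diffn (n : nat) (f : R -> R) : Prop :=
  match n with
  | O => True
  | S k => exists f', (forall x, is_derive f x (f' x)) /\ diffn k f'
  end.

Lemma diffn_ex_derive_n (k : nat) : forall f, diffn (S k) f ->
  exists h h', (forall x, Derive_n f k x = h x) /\ (forall x, is_derive h x (h' x)).
Proof.
  induction k as [|k IH]; intros f [f' [Hf Hk]].
  - exists f, f'. split; [reflexivity|exact Hf].
  - destruct (IH f' Hk) as [h [h' [H1 H2]]]. exists h, h'. split; [|exact H2].
    intro x. rewrite <- H1. replace (S k) with (k + 1)%nat by lia. rewrite <- Derive_n_comp.
    apply Derive_n_ext. intro t. simpl. apply is_derive_unique, Hf.
Qed.

Lemma smooth_of_diffn (f : R -> R) : (forall n, diffn n f) -> forall n x, ex_derive_n f n x.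
Proof.
  intros H [|n] x; [exact I|]. simpl.
  destruct (diffn_ex_derive_n n f (H (S n))) as [h [h' [H1 H2]]].
  apply (ex_derive_ext h); [intro t; symmetry; apply H1|]. exists (h' x). apply H2.
Qed.

Lemma diffn_pred (n : nat) : forall f, diffn (S n) f -> diffn n f.
Proof.
  induction n as [|n IH]; intros f H; [exact I|].
  destruct H as [f' [Hf Hn]]. exists f'. split; [exact Hf|apply IH, Hn].
Qed.

Lemma diffn_ext (n : nat) (f g : R -> R) : (forall x, f x = g x) -> diffn n f -> diffn n g.
Proof.
  destruct n as [|n]; intros E H; [exact I|]. destruct H as [f' [Hf Hn]]. exists f'.
  split; [|exact Hn]. intro x. apply (is_derive_ext f); [exact E|apply Hf].
Qed.

Lemma diffn_plus (n : nat) : forall f g, diffn n f -> diffn n g -> diffn n (fun x => f x + g x).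
Proof.
  induction n as [|n IH]; intros f g Hf Hg; [exact I|].
  destruct Hf as [f' [Hf Hf']], Hg as [g' [Hg Hg']].
  exists (fun x => f' x + g' x). split; [|apply IH; assumption].
  intro x. exact (is_derive_plus (V := R_NormedModule) _ _ _ _ _ (Hf x) (Hg x)).
Qed.

Lemma diffn_mult (n : nat) : forall f g, diffn n f -> diffn n g -> diffn n (fun x => f x * g x).
Proof.
  induction n as [|n IH]; intros f g Hf Hg; [exact I|].
  assert (Pf := diffn_pred _ _ Hf). assert (Pg := diffn_pred _ _ Hg).
  destruct Hf as [f' [Hf Hf']], Hg as [g' [Hg Hg']].
  exists (fun x => f' x * g x + f x * g' x). split; [|apply diffn_plus; apply IH; assumption].
  intro x. apply (is_derive_mult (K := R_AbsRing)); auto. intros; apply Rmult_comm.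
Qed.

Lemma diffn_const (n : nat) (c : R) : diffn n (fun _ => c).
Proof.
  revert c. induction n as [|n IH]; intro c; [exact I|]. exists (fun _ => 0). split; [|apply IH].
  intro x. apply (is_derive_const (V := R_NormedModule)).
Qed.

Lemma diffn_affine (n : nat) (a b : R) : forall f, diffn n f -> diffn n (fun x => f (a * x + b)).
Proof.
  induction n as [|n IH]; intros f H; [exact I|]. destruct H as [f' [Hf Hn]].
  exists (fun x => a * f' (a * x + b)). split.
  - intro x. apply (is_derive_comp (V := R_NormedModule) f); [apply Hf|].
    auto_derive; [exact I|ring].
  - apply diffn_mult; [apply diffn_const|apply IH, Hn].
Qed.

Lemma diffn_exp (n : nat) : diffn n exp.
Proof. induction n as [|n IH]; [exact I|]. exists exp. split; [apply is_derive_exp|exact IH]. Qed.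

Lemma diffn_cos_sin (n : nat) : diffn n cos /\ diffn n sin.
Proof.
  induction n as [|n [IC IS]]; [split; exact I|]. split.
  - exists (fun x => (-1) * sin x). split; [|apply diffn_mult; [apply diffn_const|exact IS]].
    intro x. auto_derive; [exact I|ring].
  - exists cos. split; [apply is_derive_sin|exact IC].
Qed.

(** k = 0 is the classical flat function; the other k are included because the linear span of the
    family is closed under differentiation. *)
Definition flat (k : nat) (x : R) : R := if Rle_dec x 0 then 0 else (/ x) ^ k * exp (- / x).

Lemma exp_ge_pow (N : nat) : forall x, 0 <= x -> x ^ N / INR (Factorial.fact N) <= exp x.
Proof.
  intros x Hx. eapply Rle_trans; [|apply (exp_ge_taylor x N Hx)].
  destruct N as [|N]; [right; reflexivity|].
  rewrite tech5. apply Rle_trans with (0 + x ^ S N / INR (Factorial.fact (S N))); [lra|].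
  apply Rplus_le_compat_r.
  apply cond_pos_sum. intro k. apply Rmult_le_pos; [apply pow_le, Hx|].
  left. apply Rinv_0_lt_compat, INR_fact_lt_0.
Qed.

(** exp (1 / x) dominates its Taylor term of order k + 2; the two orders beyond k leave x^2, which
    gives derivative 0 at the origin. *)
Lemma flat_small (k : nat) (x : R) : 0 < x -> Rabs (flat k x) <= INR (Factorial.fact (k + 2)) * x ^ 2.
Proof.
  intro Hx. unfold flat. destruct (Rle_dec x 0); [lra|].
  assert (P : 0 < / x) by (apply Rinv_0_lt_compat, Hx).
  rewrite Rabs_right.
  2:{ apply Rle_ge, Rmult_le_pos; [apply pow_le; lra|left; apply exp_pos]. }
  assert (Q := exp_ge_pow (k + 2) (/ x) ltac:(lra)).
  assert (F := INR_fact_lt_0 (k + 2)). set (N := INR (Factorial.fact (k + 2))) in *.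
  assert (Pp : 0 < (/ x) ^ (k + 2)) by (apply pow_lt, P).
  rewrite exp_Ropp. apply (Rmult_le_reg_r (exp (/ x))); [apply exp_pos|].
  rewrite Rmult_assoc, Rinv_l, Rmult_1_r by (apply Rgt_not_eq, exp_pos).
  apply Rle_trans with (N * x ^ 2 * ((/ x) ^ (k + 2) / N)).
  - right. rewrite pow_add. simpl. field. split; lra.
  - apply Rmult_le_compat_l; [|exact Q]. apply Rmult_le_pos; [lra|apply pow2_ge_0].
Qed.

Lemma flat_derive (k : nat) (x : R) : is_derive (flat k) x (- INR k * flat (S k) x + flat (S (S k)) x).
Proof.
  destruct (Rtotal_order x 0) as [Hx|[Hx|Hx]].
  - apply (is_derive_ext_loc (fun _ => 0)).
    + exists (mkposreal (- x) ltac:(lra)). intros y Hy. apply Rabs_lt_between' in Hy. simpl in Hy.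
      unfold flat. destruct (Rle_dec y 0); [reflexivity|lra].
    + unfold flat. destruct (Rle_dec x 0); [|lra].
      replace (- INR k * 0 + 0) with 0 by ring.
      apply (is_derive_const (V := R_NormedModule)).
  - subst x. unfold flat at 2 3. destruct (Rle_dec 0 0); [|lra].
    replace (- INR k * 0 + 0) with 0 by ring.
    apply is_derive_Reals. intros eps He.
    set (M := INR (Factorial.fact (k + 2))). assert (F := INR_fact_lt_0 (k + 2)). fold M in F.
    exists (mkposreal (eps / M) ltac:(apply Rdiv_lt_0_compat; assumption)). intros h Hh Hd. simpl in Hd.
    replace (flat k (0 + h) - flat k 0) with (flat k h).
    2:{ rewrite Rplus_0_l. unfold flat at 3. destruct (Rle_dec 0 0); lra. }
    rewrite Rminus_0_r. destruct (Rle_dec h 0) as [L|L].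
    + unfold flat. destruct (Rle_dec h 0); [|lra]. unfold Rdiv. rewrite Rmult_0_l, Rabs_R0. exact He.
    + rewrite Rabs_right in Hd by lra.
      unfold Rdiv. rewrite Rabs_mult, Rabs_inv, (Rabs_right h) by lra.
      assert (B := flat_small k h ltac:(lra)). fold M in B.
      apply (Rmult_lt_reg_r h); [lra|]. rewrite Rmult_assoc, Rinv_l, Rmult_1_r by lra.
      eapply Rle_lt_trans; [exact B|].
      assert (M * h < eps).
      { apply (Rmult_lt_compat_l M) in Hd; [|exact F].
        replace (M * (eps / M)) with eps in Hd by (field; lra). exact Hd. }
      replace (M * h ^ 2) with (M * h * h) by ring. apply Rmult_lt_compat_r; lra.
  - apply (is_derive_ext_loc (fun y => (/ y) ^ k * exp (- / y))).
    + exists (mkposreal x Hx). intros y Hy. apply Rabs_lt_between' in Hy. simpl in Hy.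
      unfold flat. destruct (Rle_dec y 0); [lra|reflexivity].
    + unfold flat. destruct (Rle_dec x 0); [lra|].
      auto_derive; [repeat split; lra|].
      destruct k as [|k]; [simpl; field; lra|].
      rewrite S_INR. simpl pred. simpl pow. field. lra.
Qed.

Lemma diffn_flat (n : nat) : forall k, diffn n (flat k).
Proof.
  induction n as [|n IH]; intro k; [exact I|].
  exists (fun x => - INR k * flat (S k) x + flat (S (S k)) x). split; [apply flat_derive|].
  apply diffn_plus; [apply diffn_mult; [apply diffn_const|]|]; apply IH.
Qed.

Lemma bump_exists (c d : R) : c < d -> exists B : R -> R,
  (forall n, diffn n B) /\ (forall x, c < x < d -> 0 < B x) /\ (forall x, ~ (c < x < d) -> B x = 0).
Proof.
  intro Hcd. exists (fun x => flat 0 (1 * x + - c) * flat 0 (-1 * x + d)).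
  split; [|split].
  - intro n. apply diffn_mult; apply diffn_affine, diffn_flat.
  - intros x Hx. unfold flat.
    destruct (Rle_dec (1 * x + - c) 0); [lra|]. destruct (Rle_dec (-1 * x + d) 0); [lra|].
    rewrite !pow_O, !Rmult_1_l. apply Rmult_lt_0_compat; apply exp_pos.
  - intros x Hx. unfold flat.
    destruct (Rle_dec (1 * x + - c) 0); [ring|]. destruct (Rle_dec (-1 * x + d) 0); [ring|lra].
Qed.

(* The first-order response W of the lower component at l is prescribed at the
   left end c; phi is read off from the differential equation for
   W = exp(2 i l x) * int_x^d bump. *)
Lemma profile_exists (c d : R) (l h : C) : c < d -> l <> RtoC 0 -> exists phi W : R -> C,
  Csmooth phi /\ (forall x, ~ (c < x < d) -> phi x = RtoC 0) /\
  (forall x, cderiv W x (- l * Cconj (phi x) + RtoC 2 * Ci * l * W x)%C) /\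
  W d = RtoC 0 /\ W c = h.
Proof.
  intros Hcd Hl. destruct (bump_exists c d Hcd) as [B [SB [PB ZB]]].
  assert (CB : forall x, continuous B x).
  { intro x. destruct (SB 1%nat) as [B' [HB _]].
    apply (ex_derive_continuous (V := R_NormedModule) B). exists (B' x). apply HB. }
  destruct l as [p r]. set (l := (p, r) : C) in *.
  set (I := fun x => - RInt B d x).
  assert (DI : forall x, is_derive I x (- B x)).
  { intro x. apply (is_derive_opp (V := R_NormedModule)).
    apply (is_derive_RInt (V := R_NormedModule) B _ d); [|apply CB].
    apply filter_forall. intro y.
    apply (RInt_correct (V := R_CompleteNormedModule)).
    apply (ex_RInt_continuous (V := R_CompleteNormedModule)). intros; apply CB. }
  assert (Id : I d = 0) by (unfold I; rewrite RInt_point; unfold zero; simpl; ring).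
  assert (Ic : 0 < I c).
  { unfold I. replace (- RInt B d c) with (RInt B c d).
    - apply RInt_gt_0; [exact Hcd|exact PB|intros; apply CB].
    - symmetry. apply (opp_RInt_swap (V := R_CompleteNormedModule)).
      apply (ex_RInt_continuous (V := R_CompleteNormedModule)). intros; apply CB. }
  (* This is e^{2 i l x} for l = p + i r. *)
  set (Ex := fun x => (RtoC (exp (- 2 * r * x)) * Cexpi (2 * p * x))%C).
  assert (DE : forall x, cderiv Ex x (RtoC 2 * Ci * l * Ex x)%C).
  { intro x. eapply cderiv_eq.
    - apply cderiv_mult; [apply cderiv_RtoC|apply cderiv_Cexpi].
      evar_last; [auto_derive; [exact Logic.I|reflexivity]|reflexivity].
    - unfold Ex, l. apply C_ext; simpl; ring. }
  assert (Exn : Ex c <> RtoC 0).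
  { apply Cmod_gt_0. unfold Ex. rewrite Cmod_mult, Cmod_Cexpi, Cmod_RtoC_pos.
    - rewrite Rmult_1_r. apply exp_pos.
    - left. apply exp_pos. }
  assert (Icn : RtoC (I c) <> RtoC 0) by (apply RtoC_neq_0; lra).
  (* The equation for W forces conj phi = k Ex B, and k is then fixed by W c = h; the division uses
     l <> 0 and the positive mass of the bump. *)
  set (k := (h / (Ex c * l * RtoC (I c)))%C).
  exists (fun x => Cconj k * RtoC (B x) * Cconj (Ex x))%C, (fun x => l * k * (Ex x * RtoC (I x)))%C.
  split; [|split; [|split; [|split]]].
  - assert (SE : forall n, diffn n (fun x => B x * (exp (- 2 * r * x + 0) * cos (2 * p * x + 0)))).
    { intro n. apply diffn_mult; [apply SB|].
      apply diffn_mult; [apply (diffn_affine n (- 2 * r) 0 exp), diffn_exp|].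
      apply (diffn_affine n (2 * p) 0 cos), diffn_cos_sin. }
    assert (SS : forall n, diffn n (fun x => B x * (exp (- 2 * r * x + 0) * sin (2 * p * x + 0)))).
    { intro n. apply diffn_mult; [apply SB|].
      apply diffn_mult; [apply (diffn_affine n (- 2 * r) 0 exp), diffn_exp|].
      apply (diffn_affine n (2 * p) 0 sin), diffn_cos_sin. }
    intros n x. split; apply smooth_of_diffn; intro m.
    + apply (diffn_ext m (fun x => Re k * (B x * (exp (- 2 * r * x + 0) * cos (2 * p * x + 0))) +
        - Im k * (B x * (exp (- 2 * r * x + 0) * sin (2 * p * x + 0))))).
      * intro y. rewrite !Rplus_0_r. unfold Ex, Cexpi, Re, Im. simpl. ring.
      * apply diffn_plus; (apply diffn_mult; [apply diffn_const|]); auto.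
    + apply (diffn_ext m (fun x => - Im k * (B x * (exp (- 2 * r * x + 0) * cos (2 * p * x + 0))) +
        - Re k * (B x * (exp (- 2 * r * x + 0) * sin (2 * p * x + 0))))).
      * intro y. rewrite !Rplus_0_r. unfold Ex, Cexpi, Re, Im. simpl. ring.
      * apply diffn_plus; (apply diffn_mult; [apply diffn_const|]); auto.
  - intros x Hx. rewrite (ZB x Hx). ring.
  - intro x. eapply cderiv_eq.
    + apply cderiv_scal, cderiv_mult; [apply DE|apply cderiv_RtoC, DI].
    + rewrite !Cmult_conj, !Cconj_conj, RtoC_opp.
      replace (Cconj (RtoC (B x))) with (RtoC (B x)) by (apply C_ext; simpl; ring). ring.
  - rewrite Id. ring.
  - unfold k. field. repeat split; assumption.
Qed.

(** * Perturbation to the right of the support *)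

(* The system solved by (u, v / conj mu) when the potential is mu * phi and
   s = |mu|^2; for s = 1 it is [uv]. *)
Definition scaled (phi : R -> C) (s : R) (l : C) (u v : R -> C) : Prop :=
  lin2 (fun x => RtoC s * half_sqr (phi x))%C (fun x => RtoC s * phi x)%C
       (fun x => - l * Cconj (phi x))%C
       (fun x => RtoC 2 * Ci * l - RtoC s * half_sqr (phi x))%C u v.

Lemma scaled_ccont (phi : R -> C) (s : R) (l : C) : ccont phi ->
  ccont (fun x => RtoC s * half_sqr (phi x))%C /\
  ccont (fun x => RtoC s * phi x)%C /\ ccont (fun x => - l * Cconj (phi x))%C /\
  ccont (fun x => RtoC 2 * Ci * l - RtoC s * half_sqr (phi x))%C.
Proof.
  intro H. destruct (uv_ccont phi l H) as [H1 [H2 H3]].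
  assert (H4 := ccont_mult _ _ (ccont_const (RtoC s)) H1).
  split; [exact H4|]. split; [exact (ccont_mult _ _ (ccont_const (RtoC s)) H)|].
  split; [exact H2|]. exact (ccont_plus _ _ (ccont_const _) (ccont_opp _ H4)).
Qed.

Lemma uv_scaled (phi : R -> C) (l : C) (u v : R -> C) : uv phi l u v -> scaled phi 1 l u v.
Proof.
  intros S x. destruct (S x) as [D1 D2]. split; (eapply cderiv_eq; [eassumption|]); ring.
Qed.

(** The phase of mu disappears from the system and survives only in the factor conj mu of the second
    component. *)
Lemma scaled_uv (phi : R -> C) (mu l : C) (u v : R -> C) : scaled phi (Cmod mu ^ 2) l u v ->
  uv (fun x => mu * phi x)%C l u (fun x => Cconj mu * v x)%C.
Proof.
  intros S x. destruct (S x) as [D1 D2].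
  assert (E : forall t, half_sqr (mu * phi t)%C = (RtoC (Cmod mu ^ 2) * half_sqr (phi t))%C).
  { intro t. unfold half_sqr. rewrite Cmod_mult, Rpow_mult_distr, RtoC_mult. ring. }
  split.
  - eapply cderiv_eq; [exact D1|]. cbv beta. rewrite E, Cmod2_conj. ring.
  - eapply cderiv_eq; [apply cderiv_scal, D2|]. cbv beta. rewrite E, Cmult_conj. ring.
Qed.

(** A single constant serves all admissible s and l: the coefficients are affine in (s, l), so they
    move by at most D times |l - l'| + |s - s'|. *)
Lemma scaled_stability (phi : R -> C) (a b M : R) : ccont phi -> a <= b -> 0 <= M ->
  exists L, 0 <= L /\ forall s s' l l' u v u' v' x y,
    0 <= s <= 1 -> 0 <= s' <= 1 -> Cmod l <= M -> Cmod l' <= M ->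
    scaled phi s l u v -> scaled phi s' l' u' v' ->
    a <= x <= b -> a <= y <= b -> u y = u' y -> v y = v' y -> Cmod (u' y) + Cmod (v' y) <= 1 ->
    Cmod (u' x) <= L /\ Cmod (v' x) <= L /\
    Cmod (u x - u' x) <= L * (Cmod (l - l') + Rabs (s - s')) /\
    Cmod (v x - v' x) <= L * (Cmod (l - l') + Rabs (s - s')).
Proof.
  intros Cphi Hab HM. destruct (ccont_bounded phi a b Cphi) as [P [HP B]].
  set (K := P ^ 2 + P + M * P + 2 * M).
  assert (P2 : 0 <= P ^ 2) by apply pow2_ge_0.
  assert (PM : 0 <= M * P) by (apply Rmult_le_pos; lra).
  assert (HK : 0 <= K) by (unfold K; lra).
  set (E := exp ((4 * K + 2) * (b - a))).
  assert (PE : 1 <= E) by (apply exp_ge_1, Rmult_le_pos; lra).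
  set (D := P ^ 2 + P + 2).
  exists (E * (D * (2 * E))).
  assert (PD : 0 <= D * (2 * E)) by (apply Rmult_le_pos; unfold D; lra).
  assert (LE : E <= E * (D * (2 * E))).
  { rewrite <- (Rmult_1_r E) at 1. apply Rmult_le_compat_l; [lra|].
    assert (1 * (2 * E) <= D * (2 * E)) by (apply Rmult_le_compat_r; unfold D; lra). lra. }
  split; [lra|].
  intros s s' l l' u v u' v' x y Hs Hs' Hl Hl' S S' Hx Hy Eu Ev N1.
  assert (half : forall t, a <= t <= b -> Cmod (half_sqr (phi t)) <= P ^ 2 / 2).
  { intros t Ht. unfold half_sqr. rewrite Cmod_mult, Cmod_div, Cmod_Ci, Cmod_RtoC_pos by (lra || (apply RtoC_neq_0; lra)).
    rewrite Cmod_RtoC_pos by apply pow2_ge_0.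
    assert (Cmod (phi t) ^ 2 <= P ^ 2) by (apply pow_incr; split; [apply Cmod_ge_0|apply B, Ht]). lra. }
  assert (sm : forall s z Q, 0 <= s <= 1 -> Cmod z <= Q -> Cmod (RtoC s * z) <= Q).
  { intros s0 z Q H0 Hz. rewrite Cmod_mult, Cmod_RtoC_pos by lra. pose proof (Cmod_ge_0 z).
    assert (s0 * Cmod z <= 1 * Cmod z) by (apply Rmult_le_compat_r; lra). lra. }
  assert (C2 : forall z, Cmod (RtoC 2 * Ci * z) = 2 * Cmod z).
  { intro z. rewrite !Cmod_mult, Cmod_Ci, Cmod_RtoC_pos by lra. ring. }
  assert (coef : forall s l, 0 <= s <= 1 -> Cmod l <= M -> forall t, a <= t <= b ->
    Cmod (RtoC s * half_sqr (phi t))%C <= K /\ Cmod (RtoC s * phi t)%C <= K /\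
    Cmod (- l * Cconj (phi t))%C <= K /\
    Cmod (RtoC 2 * Ci * l - RtoC s * half_sqr (phi t))%C <= K).
  { intros s0 l0 H0 H1 t Ht. assert (Bt := B t Ht). assert (Q := sm _ _ _ H0 (half t Ht)).
    split; [unfold K; lra|]. split; [assert (Q' := sm _ _ _ H0 Bt); unfold K; lra|]. split.
    - rewrite Cmod_mult, Cmod_opp, Cmod_conj.
      assert (Cmod l0 * Cmod (phi t) <= M * P) by (apply Rmult_le_compat; auto using Cmod_ge_0).
      unfold K; lra.
    - unfold Cminus. triangle. rewrite Cmod_opp, C2. unfold K; lra. }
  set (dl := Cmod (l - l') + Rabs (s - s')).
  assert (Pl := Cmod_ge_0 (l - l')). assert (Ps := Rabs_pos (s - s')).
  assert (diff : forall t, a <= t <= b ->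
    Cmod (RtoC s * half_sqr (phi t) - RtoC s' * half_sqr (phi t))%C <= dl * D /\
    Cmod (RtoC s * phi t - RtoC s' * phi t)%C <= dl * D /\
    Cmod (- l * Cconj (phi t) - - l' * Cconj (phi t))%C <= dl * D /\
    Cmod (RtoC 2 * Ci * l - RtoC s * half_sqr (phi t) -
      (RtoC 2 * Ci * l' - RtoC s' * half_sqr (phi t)))%C <= dl * D).
  { intros t Ht. assert (Bt := B t Ht). assert (Q := half t Ht).
    set (h := (half_sqr (phi t))) in *.
    assert (prod : forall x y, 0 <= x -> 0 <= y -> 0 <= x * y) by (intros; apply Rmult_le_pos; assumption).
    assert (F1 := prod _ _ Pl P2). assert (F2 := prod _ _ Ps P2).
    assert (F3 := prod _ _ Pl (Rlt_le _ _ HP)). assert (F4 := prod _ _ Ps (Rlt_le _ _ HP)).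
    assert (G1 : Cmod ((RtoC s - RtoC s') * h) <= Rabs (s - s') * (P ^ 2 / 2)).
    { rewrite Cmod_mult, <- RtoC_minus, Cmod_R. apply Rmult_le_compat_l; assumption. }
    assert (G2 : Cmod ((RtoC s - RtoC s') * phi t) <= Rabs (s - s') * P).
    { rewrite Cmod_mult, <- RtoC_minus, Cmod_R. apply Rmult_le_compat_l; assumption. }
    assert (G3 : Cmod ((l - l') * Cconj (phi t)) <= Cmod (l - l') * P).
    { rewrite Cmod_mult, Cmod_conj. apply Rmult_le_compat_l; assumption. }
    replace (RtoC s * h - RtoC s' * h)%C with ((RtoC s - RtoC s') * h)%C by ring.
    replace (RtoC s * phi t - RtoC s' * phi t)%C with ((RtoC s - RtoC s') * phi t)%C by ring.
    replace (- l * Cconj (phi t) - - l' * Cconj (phi t))%C with (- ((l - l') * Cconj (phi t)))%C by ring.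
    replace (RtoC 2 * Ci * l - RtoC s * h - (RtoC 2 * Ci * l' - RtoC s' * h))%C
      with (RtoC 2 * Ci * (l - l') + - ((RtoC s - RtoC s') * h))%C by ring.
    assert (G4 := Cmod_triangle (RtoC 2 * Ci * (l - l')) (- ((RtoC s - RtoC s') * h))).
    rewrite C2 in G4. rewrite !Cmod_opp in *. unfold dl, D. repeat split; lra. }
  assert (Pdl : 0 <= dl * D) by (apply Rmult_le_pos; unfold dl, D; lra).
  destruct (lin2_stability _ _ _ _ _ _ _ _ u v u' v' a b K (dl * D) HK Pdl
    (coef s l Hs Hl) (coef s' l' Hs' Hl') diff (fun t _ => S t) (fun t _ => S' t) x y Hx Hy Eu Ev)
    as [R1 [R2 [R3 R4]]].
  fold E in R1, R2, R3, R4. set (N := Cmod (u' y) + Cmod (v' y)) in *.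
  assert (PN : 0 <= N) by (unfold N; pose proof (Cmod_ge_0 (u' y)); pose proof (Cmod_ge_0 (v' y)); lra).
  assert (EN : E * N <= E * 1) by (apply Rmult_le_compat_l; lra).
  assert (T : E * (dl * D * (2 * E * N)) <= E * (D * (2 * E)) * dl).
  { replace (E * (dl * D * (2 * E * N))) with (E * (D * (2 * E)) * dl * N) by ring.
    rewrite <- (Rmult_1_r (E * (D * (2 * E)) * dl)) at 2. apply Rmult_le_compat_l; [|exact N1].
    apply Rmult_le_pos; [lra|unfold dl; lra]. }
  fold dl. repeat split; lra.
Qed.

(** Integrating from d to c gives the multiples U and conj mu W of the two basis solutions of p at
    c; linearity carries them to a, where the basis solutions have first components alpha and beta.
    [beta] is chosen before d and phi because the perturbation that moves a zero off the axis is
    built from it. *)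
Lemma perturb_alpha_structure (p : R -> C) (a c : R) : a <= c -> ccont p ->
  (forall x, x <= a -> p x = RtoC 0) -> (forall x, c <= x -> p x = RtoC 0) ->
  exists beta : C -> C,
    (forall l, alpha p l = RtoC 0 -> beta l <> RtoC 0) /\
    (forall M, 0 <= M -> exists L, 0 <= L /\ forall l l', Cmod l <= M -> Cmod l' <= M ->
       Cmod (alpha p l) <= L /\ Cmod (beta l) <= L /\ Cmod (beta l - beta l') <= L * Cmod (l - l') /\
       Cmod (alpha p l - alpha p l') <= L * Cmod (l - l')) /\
    forall (d : R) (phi : R -> C), c < d -> ccont phi -> (forall x, ~ (c < x < d) -> phi x = RtoC 0) ->
    exists U W : R -> C -> C,
      (forall mu, entire (alpha (perturb p mu phi))) /\
      (forall mu l, alpha (perturb p mu phi) l =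
         (alpha p l * U (Cmod mu ^ 2)%R l + Cconj mu * beta l * W (Cmod mu ^ 2)%R l)%C) /\
      (forall l, U 0 l = RtoC 1) /\
      (forall l W0, (forall x, cderiv W0 x (- l * Cconj (phi x) + RtoC 2 * Ci * l * W0 x)%C) ->
         W0 d = RtoC 0 -> W 0 l = W0 c) /\
      (forall M, 0 <= M -> exists L, 0 <= L /\ forall s s' l l', 0 <= s <= 1 -> 0 <= s' <= 1 ->
         Cmod l <= M -> Cmod l' <= M ->
         Cmod (U s l) <= L /\ Cmod (W s l) <= L /\
         Cmod (U s l - U s' l') <= L * (Cmod (l - l') + Rabs (s - s')) /\
         Cmod (W s l - W s' l') <= L * (Cmod (l - l') + Rabs (s - s'))).
Proof.
  intros Hac Cp Pa Pc.
  set (is1 := fun l (w : (R -> C) * (R -> C)) => uv p l (fst w) (snd w) /\ fst w c = RtoC 1 /\ snd w c = RtoC 0).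
  set (is2 := fun l (w : (R -> C) * (R -> C)) => uv p l (fst w) (snd w) /\ fst w c = RtoC 0 /\ snd w c = RtoC 1).
  set (w1 := fun l => epsilon (inhabits (fun _ => RtoC 0, fun _ => RtoC 0)) (is1 l)).
  set (w2 := fun l => epsilon (inhabits (fun _ => RtoC 0, fun _ => RtoC 0)) (is2 l)).
  assert (H1 : forall l, is1 l (w1 l)).
  { intro l. apply epsilon_spec. destruct (uv_exists p l c (RtoC 1) (RtoC 0) Cp) as [u [v H]].
    exists (u, v). exact H. }
  assert (H2 : forall l, is2 l (w2 l)).
  { intro l. apply epsilon_spec. destruct (uv_exists p l c (RtoC 0) (RtoC 1) Cp) as [u [v H]].
    exists (u, v). exact H. }
  assert (Al : forall l, alpha p l = fst (w1 l) a).
  { intro l. destruct (H1 l) as [S [E1 E2]]. apply (alpha_spec p a c Cp Pa Pc) with (v := snd (w1 l)); assumption. }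
  exists (fun l => fst (w2 l) a). split; [|split].
  (* alpha and beta form the first row of an invertible matrix. *)
  - intros l Z Z2. rewrite Al in Z. destruct (H1 l) as [S1 [E1 E2]], (H2 l) as [S2 [E3 E4]].
    destruct (uv_ccont p l Cp) as [K1 [K2 K3]].
    apply (lin2_det_neq_0 _ _ _ _ _ _ _ _ c K1 Cp K2 K3 S1 S2 E1 E2 E3 E4 a).
    rewrite Z, Z2. ring.
  - intros M HM. destruct (scaled_stability p a c M Cp Hac HM) as [L [HL St]].
    exists L. split; [exact HL|]. intros l l' Hl Hl'. rewrite !Al.
    destruct (H1 l) as [S1 [E1 E2]], (H2 l) as [S2 [E3 E4]].
    destruct (H1 l') as [S1' [E1' E2']], (H2 l') as [S2' [E3' E4']].
    apply uv_scaled in S1, S2, S1', S2'.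
    assert (one : 0 <= 1 <= 1) by lra. assert (Ia : a <= a <= c) by lra. assert (Ic : a <= c <= c) by lra.
    destruct (St 1 1 l' l _ _ _ _ a c one one Hl' Hl S1' S1 Ia Ic) as [X1 _]; try congruence.
    { rewrite E1, E2, Cmod_0, Cmod_1. lra. }
    destruct (St 1 1 l' l _ _ _ _ a c one one Hl' Hl S2' S2 Ia Ic) as [X2 _]; try congruence.
    { rewrite E3, E4, Cmod_0, Cmod_1. lra. }
    destruct (St 1 1 l l' _ _ _ _ a c one one Hl Hl' S1 S1' Ia Ic) as [_ [_ [X3 _]]]; try congruence.
    { rewrite E1', E2', Cmod_0, Cmod_1. lra. }
    destruct (St 1 1 l l' _ _ _ _ a c one one Hl Hl' S2 S2' Ia Ic) as [_ [_ [X4 _]]]; try congruence.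
    { rewrite E3', E4', Cmod_0, Cmod_1. lra. }
    rewrite Rminus_diag, Rabs_R0, Rplus_0_r in X3, X4. auto.
  - intros d phi Hcd Cphi Zphi.
    set (is3 := fun s l (w : (R -> C) * (R -> C)) =>
      scaled phi s l (fst w) (snd w) /\ fst w d = RtoC 1 /\ snd w d = RtoC 0).
    set (w3 := fun s l => epsilon (inhabits (fun _ => RtoC 0, fun _ => RtoC 0)) (is3 s l)).
    assert (H3 : forall s l, is3 s l (w3 s l)).
    { intros s l. apply epsilon_spec. destruct (scaled_ccont phi s l Cphi) as [K1 [K2 [K3 K4]]].
      destruct (lin2_exists _ _ _ _ d (RtoC 1) (RtoC 0) K1 K2 K3 K4) as [u [v H]].
      exists (u, v). exact H. }
    assert (Cq : forall mu, ccont (perturb p mu phi)).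
    { intro mu. exact (ccont_plus _ _ Cp (ccont_mult _ _ (ccont_const mu) Cphi)). }
    assert (Qa : forall mu x, x <= a -> perturb p mu phi x = RtoC 0).
    { intros mu x Hx. unfold perturb. rewrite Pa, Zphi by lra. ring. }
    assert (Qd : forall mu x, d <= x -> perturb p mu phi x = RtoC 0).
    { intros mu x Hx. unfold perturb. rewrite Pc, Zphi by lra. ring. }
    exists (fun s l => fst (w3 s l) c), (fun s l => snd (w3 s l) c).
    split; [|split; [|split; [|split]]].
    + intro mu. apply (alpha_spec _ a d (Cq mu) (Qa mu) (Qd mu)).
    + intros mu l. rewrite Al.
      destruct (uv_exists (perturb p mu phi) l d (RtoC 1) (RtoC 0) (Cq mu)) as [u [v [S [E1 E2]]]].
      rewrite (proj2 (alpha_spec _ a d (Cq mu) (Qa mu) (Qd mu)) l u v S E1 E2).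
      destruct (H3 (Cmod mu ^ 2) l) as [S3 [E3 E4]]. apply scaled_uv in S3.
      assert (right : u c = fst (w3 (Cmod mu ^ 2)%R l) c /\ v c = (Cconj mu * snd (w3 (Cmod mu ^ 2)%R l) c)%C).
      { assert (Cm : ccont (fun x => mu * phi x)%C) by exact (ccont_mult _ _ (ccont_const mu) Cphi).
        destruct (uv_ccont _ l Cm) as [K1 [K2 K3]].
        apply (lin2_unique_on _ _ _ _ u v (fst (w3 (Cmod mu ^ 2) l))
          (fun x => Cconj mu * snd (w3 (Cmod mu ^ 2)%R l) x)%C c d d K1 Cm K2 K3); try lra.
        - intros t Ht. destruct (S t) as [D1 D2].
          assert (Q : perturb p mu phi t = (mu * phi t)%C) by (unfold perturb; rewrite Pc by lra; ring).
          rewrite Q in D1, D2. split; assumption.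
        - intros t _. apply S3.
        - rewrite E1, E3. reflexivity.
        - rewrite E2, E4. ring. }
      destruct right as [R1 R2].
      destruct (H1 l) as [S1 [G1 G2]], (H2 l) as [S2 [G3 G4]].
      assert (SL := lin2_comb _ _ _ _ _ _ _ _ (u c) (v c) S1 S2).
      assert (left : u a = (u c * fst (w1 l) a + v c * fst (w2 l) a)%C).
      { destruct (uv_ccont _ l Cp) as [K1 [K2 K3]].
        apply (lin2_unique_on _ _ _ _ u v
          (fun x => u c * fst (w1 l) x + v c * fst (w2 l) x)%C
          (fun x => u c * snd (w1 l) x + v c * snd (w2 l) x)%C a c c K1 Cp K2 K3); try lra.
        - intros t Ht. destruct (S t) as [D1 D2].
          assert (Q : perturb p mu phi t = p t) by (unfold perturb; rewrite Zphi by lra; ring).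
          rewrite Q in D1, D2. split; assumption.
        - intros t _. apply SL.
        - rewrite G1, G3. ring.
        - rewrite G2, G4. ring. }
      rewrite left, R1, R2. ring.
    (* For s = 0 the right-hand side of the equation of u is zero, so u stays 1; v then solves the
       inhomogeneous equation of [W0]. *)
    + intro l. destruct (H3 0 l) as [S3 [E3 E4]].
      rewrite <- E3. apply cderiv_zero_const. intros t _.
      eapply cderiv_eq; [exact (proj1 (S3 t))|]. cbv beta; ring.
    + intros l W0 D0 Wd. destruct (H3 0 l) as [S3 [E3 E4]].
      destruct (scaled_ccont phi 0 l Cphi) as [K1 [K2 [K3 K4]]].
      apply (lin2_unique _ _ _ _ _ _ (fun _ => RtoC 1) W0 d K1 K2 K3 K4 S3).
      * intro x. split.
        -- eapply cderiv_eq; [apply cderiv_const|]. ring.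
        -- eapply cderiv_eq; [apply D0|]. ring.
      * exact E3.
      * rewrite E4, Wd. reflexivity.
    + intros M HM. destruct (scaled_stability phi c d M Cphi ltac:(lra) HM) as [L [HL St]].
      exists L. split; [exact HL|]. intros s s' l l' Hs Hs' Hl Hl'.
      destruct (H3 s l) as [S [E1 E2]], (H3 s' l') as [S' [E1' E2']].
      assert (Ic : c <= c <= d) by lra. assert (Id : c <= d <= d) by lra.
      destruct (St s' s l' l _ _ _ _ c d Hs' Hs Hl' Hl S' S Ic Id) as [X1 [X2 _]]; try congruence.
      { rewrite E1, E2, Cmod_0, Cmod_1. lra. }
      destruct (St s s' l l' _ _ _ _ c d Hs Hs' Hl Hl' S S' Ic Id) as [_ [_ X3]]; try congruence.
      { rewrite E1', E2', Cmod_0, Cmod_1. lra. }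
      destruct X3 as [X3 X4]. auto.
Qed.

(** * Proof of the theorem *)

Lemma Csmooth_ccont (f : R -> C) : Csmooth f -> ccont f.
Proof.
  intros H x. destruct (H 1%nat x) as [H1 H2].
  split; apply (ex_derive_continuous (V := R_NormedModule)); assumption.
Qed.

Lemma not_supp_zero (f : R -> C) (x : R) : ~ supp f x -> f x = RtoC 0.
Proof.
  intro H. apply NNPP in H. exact (locally_singleton x (fun y => f y = RtoC 0) H).
Qed.

Lemma supp_between (f : R -> C) (c d : R) : (forall x, ~ (c < x < d) -> f x = RtoC 0) ->
  forall x, supp f x -> c <= x <= d.
Proof.
  intros H x S. split; apply Rnot_lt_le; intro L; apply S.
  - exists (mkposreal (c - x) ltac:(lra)). intros y Hy. apply Rabs_lt_between' in Hy. simpl in Hy.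
    apply H. lra.
  - exists (mkposreal (x - d) ltac:(lra)). intros y Hy. apply Rabs_lt_between' in Hy. simpl in Hy.
    apply H. lra.
Qed.

Lemma C0infty_of_zero_outside (f : R -> C) (c d : R) : Csmooth f ->
  (forall x, ~ (c < x < d) -> f x = RtoC 0) -> C0infty f.
Proof.
  intros S H. split; [exact S|]. exists (Rabs c + Rabs d). intros x Hx.
  apply (supp_between f c d H) in Hx. apply Rabs_le.
  pose proof (Rle_abs c); pose proof (Rle_abs d). pose proof (Rle_abs (- c)); pose proof (Rle_abs (- d)).
  rewrite Rabs_Ropp in *. lra.
Qed.

(** Compactness with one gauge in two roles: [delta x y] is the radius of a neighbourhood of (x, y)
    and a lower bound of |f| on its points in the annulus. Off the annulus the radius is so small
    that no annulus point is met. *)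
Lemma entire_annulus_lower_bound (f : C -> C) (z0 : C) (rho r : R) : entire f ->
  (forall z, rho <= Cmod (z - z0) <= r -> f z <> RtoC 0) ->
  exists eta, 0 < eta /\ forall z, rho <= Cmod (z - z0) <= r -> eta <= Cmod (f z).
Proof.
  intros Hf HN.
  assert (loc : forall x y : R, exists d : posreal, forall z, Rabs (Re z - x) < d -> Rabs (Im z - y) < d ->
    rho <= Cmod (z - z0) <= r -> d <= Cmod (f z)).
  { intros x y. set (pt := (x, y) : C).
    assert (near : forall z d, Rabs (Re z - x) < d -> Rabs (Im z - y) < d -> Cmod (z - pt) < 2 * d).
    { intros z d H1 H2. eapply Rle_lt_trans; [apply Cmod_le_Re_Im|].
      change (Rabs (Re z - x) + Rabs (Im z - y) < 2 * d). lra. }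
    destruct (Rlt_le_dec (Cmod (pt - z0)) rho) as [L|L]; [|destruct (Rlt_le_dec r (Cmod (pt - z0))) as [G|G]].
    - exists (mkposreal ((rho - Cmod (pt - z0)) / 2) ltac:(lra)). intros z H1 H2 Hz. exfalso.
      assert (Q := near z _ H1 H2). simpl in Q.
      assert (T := Cmod_triangle (z - pt) (pt - z0)).
      replace (z - pt + (pt - z0))%C with (z - z0)%C in T by ring. lra.
    - exists (mkposreal ((Cmod (pt - z0) - r) / 2) ltac:(lra)). intros z H1 H2 Hz. exfalso.
      assert (Q := near z _ H1 H2). simpl in Q.
      assert (T := Cmod_minus_ge (pt - z0) (- (z - pt))).
      replace (pt - z0 - - (z - pt))%C with (z - z0)%C in T by ring. rewrite Cmod_opp in T. lra.
    - assert (P : 0 < Cmod (f pt)) by (apply Cmod_gt_0, HN; lra).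
      destruct (analytic_lipschitz f pt (Hf pt)) as [s [L' [Hs [HL B]]]].
      set (q := Cmod (f pt)) in *. assert (Pq : 0 < q / (4 * (L' + 1))) by (apply Rdiv_lt_0_compat; lra).
      destruct (pos_min3 (s / 2) (q / (4 * (L' + 1))) (q / 2)) as [d [Pd [d1 [d2 d3]]]]; try lra.
      exists (mkposreal _ Pd). intros z H1 H2 _. assert (Q := near z _ H1 H2). simpl in Q |- *.
      assert (T := B pt z). replace (pt - pt)%C with (RtoC 0) in T by ring. rewrite Cmod_0 in T.
      specialize (T ltac:(lra) ltac:(lra)). replace (pt - z)%C with (- (z - pt))%C in T by ring.
      rewrite Cmod_opp in T.
      assert (T2 := Cmod_minus_ge (f pt) (f pt - f z)).
      replace (f pt - (f pt - f z))%C with (f z) in T2 by ring. fold q in T2.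
      assert (L' * Cmod (z - pt) <= L' * (2 * (q / (4 * (L' + 1))))) by (apply Rmult_le_compat_l; lra).
      replace (L' * (2 * (q / (4 * (L' + 1))))) with (q / 2 - 2 * (q / (4 * (L' + 1)))) in H by (field; lra).
      lra. }
  set (delta := fun x y => proj1_sig (constructive_indefinite_description _ (loc x y))).
  assert (Hdelta : forall x y z, Rabs (Re z - x) < delta x y -> Rabs (Im z - y) < delta x y ->
    rho <= Cmod (z - z0) <= r -> delta x y <= Cmod (f z)).
  { intros x y. exact (proj2_sig (constructive_indefinite_description _ (loc x y))). }
  (* The covering statement is doubly negated, hence the argument by contradiction from |f z| <
     d. *)
  destruct (compactness_value_2d (Re z0 - r) (Re z0 + r) (Im z0 - r) (Im z0 + r) delta) as [d Hd].
  exists d. split; [apply cond_pos|]. intros z Hz. apply Rnot_lt_le. intro N.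
  assert (H1 := re_le_Cmod (z - z0)). assert (H2 := Im_le_Cmod (z - z0)).
  change (Re (z - z0)) with (Re z - Re z0) in H1. change (Im (z - z0)) with (Im z - Im z0) in H2.
  assert (H1' := proj1 (Rabs_le_between _ _) H1). assert (H2' := proj1 (Rabs_le_between _ _) H2).
  apply (Hd (Re z) (Im z)); [lra|lra|]. intros [u [v [_ [_ [Hu [Hv Hle]]]]]].
  assert (Q := Hdelta u v z Hu Hv Hz). lra.
Qed.

(** U is nonzero near z0 for small s, so the zeros there are those of (l - z0)^n g + conj mu H with
    H = beta W / U. The profile is normalized to W = 1 at z0 for s = 0, which makes H equal to beta
    there. The closeness clause serves to exclude further zeros away from z0. *)
Lemma perturb_splits (p : R -> C) (a c d : R) (z0 : C) (n : nat) : a <= c -> c < d -> ccont p ->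
  (forall x, x <= a -> p x = RtoC 0) -> (forall x, c <= x -> p x = RtoC 0) ->
  z0 <> RtoC 0 -> (1 <= n)%nat -> zero_of_order (alpha p) z0 n ->
  exists phi, Csmooth phi /\ (forall x, ~ (c < x < d) -> phi x = RtoC 0) /\
    (exists rho1, 0 < rho1 /\ forall rho, 0 < rho <= rho1 -> exists delta, 0 < delta /\
       forall mu, 0 < Cmod mu < delta -> exists zs, length zs = n /\ NoDup zs /\
         (forall z, In z zs -> Cmod (z - z0) < rho /\ simple_zero (alpha (perturb p mu phi)) z) /\
         (forall z, Cmod (z - z0) < rho -> alpha (perturb p mu phi) z = RtoC 0 -> In z zs)) /\
    (forall M eta, 0 <= M -> 0 < eta -> exists delta, 0 < delta /\
       forall mu l, Cmod mu < delta -> Cmod l <= M ->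
         Cmod (alpha (perturb p mu phi) l - alpha p l) < eta).
Proof.
  intros Hac Hcd Cp Pa Pc Hz0 Hn [g [Ag [Gn Fg]]].
  destruct (profile_exists c d z0 (RtoC 1) Hcd Hz0) as [phi [W0 [Sphi [Zphi [DW [Wd Wc]]]]]].
  destruct (perturb_alpha_structure p a c Hac Cp Pa Pc) as [beta [Bn [Bl St]]].
  destruct (St d phi Hcd (Csmooth_ccont phi Sphi) Zphi) as [U [W [Ent [Fac [U0 [W00 Lip]]]]]].
  exists phi. split; [exact Sphi|]. split; [exact Zphi|]. split.
  - assert (F0 : alpha p z0 = RtoC 0).
    { rewrite Fg. replace (z0 - z0)%C with (RtoC 0) by ring. replace n with (S (n - 1)) by lia.
      simpl. ring. }
    assert (Bz : beta z0 <> RtoC 0) by (apply Bn, F0).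
    set (M := Cmod z0 + 1). assert (PM : 0 <= M) by (unfold M; pose proof (Cmod_ge_0 z0); lra).
    destruct (Bl M PM) as [Lb [PLb HB]]. destruct (Lip M PM) as [Lu [PLu HU]].
    destruct (analytic_lipschitz g z0 Ag) as [rg [Lg [Prg [PLg HG]]]].
    assert (Pi : 0 < / (2 * (Lu + 1))) by (apply Rinv_0_lt_compat; lra).
    (* For s <= s0 the function U differs from 1 by at most 1/2. *)
    destruct (pos_min3 1 1 (/ (2 * (Lu + 1)))) as [s0 [Ps0 [s01 [_ s02]]]]; try lra.
    assert (Ulow : forall s l, 0 <= s <= s0 -> Cmod l <= M -> / 2 <= Cmod (U s l)).
    { intros s l Hs Hl. destruct (HU s 0 l l ltac:(lra) ltac:(lra) Hl Hl) as [_ [_ [Q _]]].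
      rewrite U0 in Q. replace (l - l)%C with (RtoC 0) in Q by ring.
      rewrite Cmod_0, Rplus_0_l, Rminus_0_r, Rabs_right in Q by lra.
      assert (T : Lu * s <= Lu * / (2 * (Lu + 1))) by (apply Rmult_le_compat_l; lra).
      replace (Lu * / (2 * (Lu + 1))) with (/ 2 - / (2 * (Lu + 1))) in T by (field; lra).
      assert (V := Cmod_minus_ge (RtoC 1) (1 - U s l)).
      replace (1 - (1 - U s l))%C with (U s l) in V by ring.
      replace (1 - U s l)%C with (- (U s l - 1))%C in V by ring. rewrite Cmod_opp, Cmod_1 in V. lra. }
    assert (Un : forall s l, 0 <= s <= s0 -> Cmod l <= M -> U s l <> RtoC 0).
    { intros s l Hs Hl. apply Cmod_gt_0. specialize (Ulow s l Hs Hl). lra. }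
    set (H := fun s l => (beta l * W s l / U s l)%C).
    (* Three terms in the numerator, each at most Lb Lu^2 times the distance, over a denominator of
       modulus at least 1/4. *)
    set (LH := 12 * (Lb * Lu * Lu)).
    assert (PLH : 0 <= LH).
    { unfold LH. assert (0 <= Lb * Lu) by (apply Rmult_le_pos; lra).
      assert (0 <= Lb * Lu * Lu) by (apply Rmult_le_pos; lra). lra. }
    assert (HL : forall s s' l l', 0 <= s <= s0 -> 0 <= s' <= s0 -> Cmod l <= M -> Cmod l' <= M ->
      Cmod (H s l - H s' l') <= LH * (Cmod (l - l') + Rabs (s - s'))).
    { intros s s' l l' Hs Hs' Hl Hl'.
      destruct (HB l l' Hl Hl') as [_ [B1 [B2 _]]]. destruct (HB l' l' Hl' Hl') as [_ [B1' _]].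
      destruct (HU s s' l l' ltac:(lra) ltac:(lra) Hl Hl') as [U1 [W1 [U2 W2]]].
      destruct (HU s' s' l' l' ltac:(lra) ltac:(lra) Hl' Hl') as [U1' [W1' _]].
      assert (N1 := Ulow s l Hs Hl). assert (N2 := Ulow s' l' Hs' Hl').
      replace (H s l - H s' l')%C with
        ((beta l * (W s l - W s' l') * U s' l' + (beta l - beta l') * W s' l' * U s' l'
          + beta l' * W s' l' * - (U s l - U s' l')) / (U s l * U s' l'))%C
        by (unfold H; field; split; apply Un; assumption).
      rewrite Cmod_div by (apply Cmult_neq_0; apply Un; assumption).
      set (D := Cmod (l - l') + Rabs (s - s')) in *.
      assert (PD : Cmod (l - l') <= D) by (unfold D; pose proof (Rabs_pos (s - s')); lra).
      assert (PD0 : 0 <= D) by (pose proof (Cmod_ge_0 (l - l')); lra).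
      assert (Dn : / 4 <= Cmod (U s l * U s' l')).
      { rewrite Cmod_mult. replace (/ 4) with (/ 2 * / 2) by lra. apply Rmult_le_compat; lra. }
      assert (m3 : forall x y z X Y Z, 0 <= x -> 0 <= y -> 0 <= z -> x <= X -> y <= Y -> z <= Z ->
        x * y * z <= X * Y * Z).
      { intros x y z X Y Z. intros. apply Rmult_le_compat; auto.
        - apply Rmult_le_pos; auto.
        - apply Rmult_le_compat; auto. }
      assert (Nm : Cmod (beta l * (W s l - W s' l') * U s' l' + (beta l - beta l') * W s' l' * U s' l'
          + beta l' * W s' l' * - (U s l - U s' l')) <= 3 * (Lb * Lu * Lu) * D).
      { triangle. assert (T := Cmod_triangle (beta l * (W s l - W s' l') * U s' l')
          ((beta l - beta l') * W s' l' * U s' l')).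
        rewrite !Cmod_mult, Cmod_opp in *.
        assert (T1 := m3 _ _ _ _ _ _ (Cmod_ge_0 _) (Cmod_ge_0 _) (Cmod_ge_0 _) B1 W2 U1').
        assert (B2' : Cmod (beta l - beta l') <= Lb * D).
        { eapply Rle_trans; [exact B2|]. apply Rmult_le_compat_l; lra. }
        assert (T2 := m3 _ _ _ _ _ _ (Cmod_ge_0 _) (Cmod_ge_0 _) (Cmod_ge_0 _) B2' W1' U1').
        assert (T3 := m3 _ _ _ _ _ _ (Cmod_ge_0 _) (Cmod_ge_0 _) (Cmod_ge_0 _) B1' W1' U2).
        lra. }
      apply (Rmult_le_reg_r (Cmod (U s l * U s' l'))); [lra|].
      unfold Rdiv. rewrite Rmult_assoc, Rinv_l, Rmult_1_r by lra.
      eapply Rle_trans; [exact Nm|].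
      replace (3 * (Lb * Lu * Lu) * D) with (LH * D * / 4) by (unfold LH; field).
      apply Rmult_le_compat_l; [apply Rmult_le_pos; assumption|exact Dn]. }
    assert (H0 : H 0 z0 = beta z0).
    { unfold H. rewrite U0, (W00 z0 W0 DW Wd), Wc. field. }
    destruct (pos_min3 rg rg 1) as [rho0 [Pr0 [r1 [_ r2]]]]; try lra.
    assert (cen : forall w : C, (z0 + w - z0)%C = w) by (intro; ring).
    assert (inM : forall w, Cmod w <= 1 -> Cmod (z0 + w) <= M).
    { intros w Hw. triangle. unfold M. lra. }
    assert (z00 : (z0 + 0)%C = z0) by ring.
    destruct (split_zeros n (fun w => g (z0 + w)%C) (Lg + LH) rho0 (Cmod (beta z0)) Hn ltac:(lra) Pr0
      ltac:(apply Cmod_gt_0, Bz) ltac:(cbv beta; rewrite z00; exact Gn)) as [rho1 [Pr1 SZ]].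
    { intros z w Hz Hw. eapply Rle_trans; [apply HG; rewrite cen; lra|].
      replace (z0 + z - (z0 + w))%C with (z - w)%C by ring.
      apply Rmult_le_compat_r; [apply Cmod_ge_0|lra]. }
    (* Zeros within 1/2 of z0, tested on neighbourhoods of radius at most 1/2, stay in the unit disc
       around z0, where the bounds for M apply. *)
    exists (Rmin rho1 (/ 2)). split; [apply Rmin_pos; lra|]. intros rho [Pr Hr].
    assert (Hr1 : rho <= rho1) by (eapply Rle_trans; [exact Hr|apply Rmin_l]).
    assert (Hr2 : rho <= / 2) by (eapply Rle_trans; [exact Hr|apply Rmin_r]).
    destruct (SZ rho ltac:(lra)) as [m0 [Pm0 SZ']].
    exists (Rmin m0 s0). split; [apply Rmin_pos; lra|]. intros mu [Pmu Hmu].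
    assert (Hmu1 : Cmod mu < m0) by (eapply Rlt_le_trans; [exact Hmu|apply Rmin_l]).
    assert (Hmu2 : Cmod mu < s0) by (eapply Rlt_le_trans; [exact Hmu|apply Rmin_r]).
    set (m := Cmod mu) in *. set (s := m ^ 2).
    assert (sm : s <= m).
    { unfold s. replace (m ^ 2) with (m * m) by ring. rewrite <- (Rmult_1_r m) at 3.
      apply Rmult_le_compat_l; lra. }
    assert (Hs : 0 <= s <= s0) by (split; [apply pow2_ge_0|lra]).
    assert (mn : RtoC m <> RtoC 0) by (apply RtoC_neq_0; lra).
    (* The phase of conj mu: with conj mu = m e the equation has the real parameter m and a leading
       constant [e * beta z0] whose modulus is independent of mu, as [split_zeros] requires. *)
    set (e := (Cconj mu / RtoC m)%C).
    assert (Me : Cmod e = 1).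
    { unfold e. rewrite Cmod_div, Cmod_conj, Cmod_RtoC_pos by (lra || assumption). unfold m. field.
      fold m. lra. }
    assert (fac : forall w, Cmod w <= 1 -> alpha (perturb p mu phi) (z0 + w)%C =
      (U s (z0 + w)%C * (w ^ n * g (z0 + w) + RtoC m * (e * H s (z0 + w)%C)))%C).
    { intros w Hw. rewrite Fac, Fg, cen. fold m s. unfold H, e. field.
      split; [apply Un; [exact Hs|apply inM, Hw]|exact mn]. }
    destruct (SZ' m ltac:(lra) (fun w => e * H s (z0 + w)%C)%C (e * beta z0)%C) as [zs [LZ [ND [Z1 Z2]]]].
    { rewrite Cmod_mult, Me. lra. }
    { intros z w Hz Hw. replace (e * H s (z0 + z) - e * H s (z0 + w))%C with
        (e * (H s (z0 + z) - H s (z0 + w)))%C by ring.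
      rewrite Cmod_mult, Me, Rmult_1_l.
      eapply Rle_trans; [apply (HL s s _ _ Hs Hs); apply inM; lra|].
      rewrite Rminus_diag, Rabs_R0, Rplus_0_r.
      replace (z0 + z - (z0 + w))%C with (z - w)%C by ring.
      apply Rmult_le_compat_r; [apply Cmod_ge_0|lra]. }
    { rewrite z00. replace (e * H s z0 - e * beta z0)%C with (e * (H s z0 - H 0 z0))%C by (rewrite H0; ring).
      rewrite Cmod_mult, Me, Rmult_1_l.
      assert (zM : Cmod z0 <= M) by (unfold M; lra).
      eapply Rle_trans; [apply (HL s 0 _ _ Hs ltac:(lra) zM zM)|].
      replace (z0 - z0)%C with (RtoC 0) by ring. rewrite Cmod_0, Rplus_0_l, Rminus_0_r, Rabs_right by lra.
      apply Rmult_le_compat; lra. }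
    exists (map (fun w => z0 + w)%C zs). split; [|split; [|split]].
    + rewrite length_map. exact LZ.
    + apply FinFun.Injective_map_NoDup; [|exact ND]. intros w w' Q.
      replace w with (z0 + w - z0)%C by ring. rewrite Q. ring.
    + intros z Hz. apply in_map_iff in Hz. destruct Hz as [w [<- Hw]].
      destruct (Z1 w Hw) as [Hwr [Fw [k [eta [Pk [Peta Low]]]]]].
      rewrite cen. split; [exact Hwr|].
      apply (simple_zero_of_lower_bound _ _ (/ 2 * k) (Rmin eta (/ 2))).
      * apply Ent.
      * rewrite fac by lra. rewrite Fw. ring.
      * lra.
      * apply Rmin_pos; lra.
      * intros z Hz. set (w' := (z - z0)%C). assert (Ez : z = (z0 + w')%C) by (unfold w'; ring).
        rewrite Ez in *. replace (z0 + w' - (z0 + w))%C with (w' - w)%C in * by ring.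
        assert (Q1 : Cmod (w' - w) < eta) by (eapply Rlt_le_trans; [exact Hz|apply Rmin_l]).
        assert (Q2 : Cmod (w' - w) < / 2) by (eapply Rlt_le_trans; [exact Hz|apply Rmin_r]).
        assert (Q3 : Cmod w' <= 1).
        { replace w' with ((w' - w) + w)%C by ring. triangle. lra. }
        rewrite fac, Cmod_mult by exact Q3. rewrite Rmult_assoc.
        apply Rmult_le_compat; [lra| |apply Ulow; [exact Hs|apply inM, Q3]|apply Low, Q1].
        apply Rmult_le_pos; [lra|apply Cmod_ge_0].
    + intros z Hz Fz. apply in_map_iff. exists (z - z0)%C. split; [ring|].
      apply Z2; [exact Hz|]. set (w := (z - z0)%C) in *.
      assert (Ez : z = (z0 + w)%C) by (unfold w; ring).
      rewrite Ez, fac in Fz by lra.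
      assert (Uz : U s (z0 + w)%C <> RtoC 0) by (apply Un; [exact Hs|apply inM; lra]).
      match goal with |- ?X = _ => replace X with (U s (z0 + w)%C * X / U s (z0 + w)%C)%C by (field; exact Uz) end.
      rewrite Fz. field. exact Uz.
  - intros M eta PM Peta. destruct (Bl M PM) as [Lb [PLb HB]]. destruct (Lip M PM) as [Lu [PLu HU]].
    set (k := 2 * (Lb * Lu)). assert (Pk : 0 <= k).
    { unfold k. assert (0 <= Lb * Lu) by (apply Rmult_le_pos; assumption). lra. }
    exists (Rmin 1 (eta / (k + 1))). split; [apply Rmin_pos; [lra|apply Rdiv_lt_0_compat; lra]|].
    intros mu l Hmu Hl.
    assert (Hmu1 : Cmod mu < 1) by (eapply Rlt_le_trans; [exact Hmu|apply Rmin_l]).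
    assert (Hmu2 : Cmod mu < eta / (k + 1)) by (eapply Rlt_le_trans; [exact Hmu|apply Rmin_r]).
    pose proof (Cmod_ge_0 mu) as Pm. set (m := Cmod mu) in *.
    assert (sm : m ^ 2 <= m).
    { replace (m ^ 2) with (m * m) by ring. rewrite <- (Rmult_1_r m) at 3.
      apply Rmult_le_compat_l; lra. }
    assert (s0 := pow2_ge_0 m).
    destruct (HB l l Hl Hl) as [A1 [B1 _]].
    destruct (HU (m ^ 2) 0 l l ltac:(lra) ltac:(lra) Hl Hl) as [_ [W1 [U2 _]]].
    rewrite Fac. fold m.
    replace (alpha p l * U (m ^ 2)%R l + Cconj mu * beta l * W (m ^ 2)%R l - alpha p l)%C with
      (alpha p l * (U (m ^ 2)%R l - U 0 l) + Cconj mu * (beta l * W (m ^ 2)%R l))%C by (rewrite U0; ring).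
    replace (l - l)%C with (RtoC 0) in U2 by ring.
    rewrite Cmod_0, Rplus_0_l, Rminus_0_r, Rabs_right in U2 by lra.
    eapply Rle_lt_trans; [apply Cmod_triangle|]. rewrite !Cmod_mult, Cmod_conj. fold m.
    assert (T1 : Cmod (alpha p l) * Cmod (U (m ^ 2) l - U 0 l) <= Lb * (Lu * m)).
    { apply Rmult_le_compat; auto using Cmod_ge_0. eapply Rle_trans; [exact U2|].
      apply Rmult_le_compat_l; assumption. }
    assert (T2 : m * (Cmod (beta l) * Cmod (W (m ^ 2) l)) <= m * (Lb * Lu)).
    { apply Rmult_le_compat_l; [exact Pm|]. apply Rmult_le_compat; auto using Cmod_ge_0. }
    apply Rle_lt_trans with (k * m); [unfold k; lra|].
    apply (Rmult_lt_compat_r (k + 1)) in Hmu2; [|lra].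
    replace (eta / (k + 1) * (k + 1)) with eta in Hmu2 by (field; lra). lra.
Qed.

(* The direction psi is chosen so that the zero leaves the axis with velocity
   - i: writing t = x - Lambda, the equation reads
   t (1 + o(1)) + mu' (i + o(1)) = 0, whose only real solution is t = mu' = 0. *)
Lemma perturb_no_real_zeros (p : R -> C) (a c d Lambda : R) : a <= c -> c < d -> ccont p ->
  (forall x, x <= a -> p x = RtoC 0) -> (forall x, c <= x -> p x = RtoC 0) ->
  Lambda <> 0 -> simple_zero (alpha p) (RtoC Lambda) ->
  exists psi, Csmooth psi /\ (forall x, ~ (c < x < d) -> psi x = RtoC 0) /\
    exists rho, 0 < rho /\ forall mu : R, 0 < Rabs mu < rho ->
      no_real_zeros_near (alpha (perturb p (RtoC mu) psi)) Lambda rho.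
Proof.
  intros Hac Hcd Cp Pa Pc HL [g [Ag [Gn Fg]]].
  assert (HLC : RtoC Lambda <> RtoC 0) by (intro Q; injection Q; exact HL).
  destruct (perturb_alpha_structure p a c Hac Cp Pa Pc) as [beta [Bn [Bl St]]].
  assert (F0 : alpha p (RtoC Lambda) = RtoC 0).
  { rewrite Fg. replace (RtoC Lambda - RtoC Lambda)%C with (RtoC 0) by ring. simpl. ring. }
  assert (Bz : beta (RtoC Lambda) <> RtoC 0) by (apply Bn, F0).
  set (z0 := RtoC Lambda) in *.
  (* With this value at c the first-order coefficient beta W equals i g at Lambda. *)
  destruct (profile_exists c d z0 (Ci * g z0 / beta z0)%C Hcd HLC)
    as [psi [W0 [Spsi [Zpsi [DW [Wd Wc]]]]]].
  destruct (St d psi Hcd (Csmooth_ccont psi Spsi) Zpsi) as [U [W [_ [Fac [U0 [W00 Lip]]]]]].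
  exists psi. split; [exact Spsi|]. split; [exact Zpsi|].
  set (M := Cmod z0 + 1). assert (PM : 0 <= M) by (unfold M; pose proof (Cmod_ge_0 z0); lra).
  assert (zM : Cmod z0 <= M) by (unfold M; lra).
  destruct (Bl M PM) as [Lb [PLb HB]]. destruct (Lip M PM) as [Lu [PLu HU]].
  destruct (analytic_lipschitz g z0 Ag) as [rg [Lg [Prg [PLg HG]]]].
  set (g0 := Cmod (g z0)). assert (Pg0 : 0 < g0) by (apply Cmod_gt_0, Gn).
  set (K := (g0 + Lg) * Lu + Lg + 2 * (Lb * Lu)).
  assert (P1 : 0 <= (g0 + Lg) * Lu) by (apply Rmult_le_pos; lra).
  assert (P2 : 0 <= Lb * Lu) by (apply Rmult_le_pos; lra).
  assert (PK : 0 <= K) by (unfold K; lra).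
  assert (Pq : 0 < g0 / (8 * (K + 1))) by (apply Rdiv_lt_0_compat; lra).
  (* Since |t| and s stay below rho, this bounds K (|t| + s) by g0 / 4, the size allowed for each of
     the two errors [EA] and [EB]. *)
  destruct (pos_min3 rg 1 (g0 / (8 * (K + 1)))) as [rho [Pr [r1 [r2 r3]]]]; try lra.
  exists rho. split; [exact Pr|]. intros mu [Pmu Hmu] x Hx Fx.
  set (z := RtoC x) in *. set (t := (z - z0)%C).
  assert (Et : t = RtoC (x - Lambda)) by (unfold t, z, z0; rewrite RtoC_minus; reflexivity).
  assert (Mt : Cmod t = Rabs (x - Lambda)) by (rewrite Et; apply Cmod_R).
  rewrite Fac, Fg in Fx. fold t in Fx. rewrite Cmod_R in Fx.
  replace (Cconj (RtoC mu)) with (RtoC mu) in Fx by (apply C_ext; simpl; ring).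
  set (m := Rabs mu) in *. set (s := m ^ 2) in *.
  assert (sm : s <= m).
  { unfold s. replace (m ^ 2) with (m * m) by ring. rewrite <- (Rmult_1_r m) at 3.
    apply Rmult_le_compat_l; lra. }
  assert (s0 : 0 <= s) by apply pow2_ge_0.
  assert (zM' : Cmod z <= M).
  { replace z with (t + z0)%C by (unfold t; ring). triangle. unfold M. lra. }
  assert (Pt := Cmod_ge_0 t). set (T := Cmod t) in *.
  destruct (HB z z0 zM' zM) as [_ [B1 [B2 _]]].
  destruct (HU s 0 z z ltac:(lra) ltac:(lra) zM' zM') as [_ [_ [U2 _]]].
  destruct (HU s 0 z z0 ltac:(lra) ltac:(lra) zM' zM) as [_ [_ [_ W2]]].
  destruct (HU 0 0 z0 z0 ltac:(lra) ltac:(lra) zM zM) as [_ [W3 _]].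
  rewrite U0 in U2. replace (z - z)%C with (RtoC 0) in U2 by ring.
  rewrite Cmod_0, Rplus_0_l, Rminus_0_r, Rabs_right in U2 by lra.
  fold t in B2, W2. fold T in B2, W2. rewrite Rminus_0_r, (Rabs_right s) in W2 by lra.
  assert (G1 := HG z z0). fold t in G1. fold T in G1.
  replace (z0 - z0)%C with (RtoC 0) in G1 by ring. rewrite Cmod_0 in G1.
  specialize (G1 ltac:(lra) ltac:(lra)).
  assert (G2 : Cmod (g z) <= g0 + Lg).
  { replace (g z) with (g z0 + (g z - g z0))%C by ring. triangle.
    fold g0. assert (Lg * T <= Lg * 1) by (apply Rmult_le_compat_l; lra). lra. }
  assert (Kts : K * (T + s) <= g0 / 4).
  { assert (K * (T + s) <= K * (2 * (g0 / (8 * (K + 1))))) by (apply Rmult_le_compat_l; lra).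
    replace (K * (2 * (g0 / (8 * (K + 1))))) with (g0 / 4 - 2 * (g0 / (8 * (K + 1)))) in H by (field; lra).
    lra. }
  assert (bs : 0 <= Lb * Lu * s) by (apply Rmult_le_pos; lra).
  assert (gs : 0 <= (g0 + Lg) * Lu * T) by (apply Rmult_le_pos; lra).
  assert (bT : 0 <= Lb * Lu * T) by (apply Rmult_le_pos; lra).
  assert (ls : 0 <= Lg * s) by (apply Rmult_le_pos; lra).
  assert (lT : 0 <= Lg * T) by (apply Rmult_le_pos; lra).
  assert (us : 0 <= (g0 + Lg) * Lu * s) by (apply Rmult_le_pos; lra).
  assert (EA : Cmod (g z * U s z - g z0) <= g0 / 4).
  { replace (g z * U s z - g z0)%C with (g z * (U s z - 1) + (g z - g z0))%C by ring.
    triangle. rewrite Cmod_mult.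
    assert (Cmod (g z) * Cmod (U s z - 1) <= (g0 + Lg) * (Lu * s)).
    { apply Rmult_le_compat; auto using Cmod_ge_0. }
    unfold K in Kts. lra. }
  assert (EB : Cmod (beta z * W s z - Ci * g z0) <= g0 / 4).
  { replace (Ci * g z0)%C with (beta z0 * W 0 z0)%C
      by (rewrite (W00 z0 W0 DW Wd), Wc; field; exact Bz).
    replace (beta z * W s z - beta z0 * W 0 z0)%C with
      (beta z * (W s z - W 0 z0) + (beta z - beta z0) * W 0 z0)%C by ring.
    triangle. rewrite !Cmod_mult.
    assert (Cmod (beta z) * Cmod (W s z - W 0 z0) <= Lb * (Lu * (T + s))).
    { apply Rmult_le_compat; auto using Cmod_ge_0. }
    assert (Cmod (beta z - beta z0) * Cmod (W 0 z0) <= Lb * T * Lu).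
    { apply Rmult_le_compat; auto using Cmod_ge_0. }
    unfold K in Kts. lra. }
  assert (Key : ((t + RtoC mu * Ci) * g z0)%C =
    (- (t * (g z * U s z - g z0) + RtoC mu * (beta z * W s z - Ci * g z0)))%C).
  { assert (Q : (t * (g z * U s z) + RtoC mu * (beta z * W s z))%C = RtoC 0).
    { rewrite <- Fx. simpl. ring. }
    replace ((t + RtoC mu * Ci) * g z0)%C with
      ((t * (g z * U s z) + RtoC mu * (beta z * W s z)) -
       (t * (g z * U s z - g z0) + RtoC mu * (beta z * W s z - Ci * g z0)))%C by ring.
    rewrite Q. ring. }
  apply (f_equal Cmod) in Key. rewrite Cmod_opp, Cmod_mult in Key. fold g0 in Key.
  assert (Tri := Cmod_triangle (t * (g z * U s z - g z0)) (RtoC mu * (beta z * W s z - Ci * g z0))).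
  rewrite !Cmod_mult, Cmod_R in Tri. fold T m in Tri.
  assert (X1 : T * Cmod (g z * U s z - g z0) <= T * (g0 / 4)) by (apply Rmult_le_compat_l; lra).
  assert (X2 : m * Cmod (beta z * W s z - Ci * g z0) <= m * (g0 / 4)) by (apply Rmult_le_compat_l; lra).
  (* As t is real, |t + i mu| dominates both |t| and |mu|, whereas [Key] bounds it by (|t| + |mu|) /
     4; this contradicts mu <> 0. *)
  set (N := Cmod (t + RtoC mu * Ci)) in *.
  assert (N1 : T <= N).
  { rewrite Mt. eapply Rle_trans; [|apply re_le_Cmod]. right. f_equal.
    rewrite Et. simpl. ring. }
  assert (N2 : m <= N).
  { eapply Rle_trans; [|apply Im_le_Cmod]. right. unfold m. f_equal.
    rewrite Et. simpl. ring. }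
  assert (N * g0 <= (T + m) / 4 * g0) by lra.
  assert (N <= (T + m) / 4) by (apply (Rmult_le_reg_r g0); lra).
  lra.
Qed.

Theorem proposition3p9
  (R0 : R) (hR0 : 0 < R0)
  (q : R -> C) (hq : C0infty_on (- R0) R0 q)
  (m : nat) (lam : nat -> C) (r : nat -> R)
  (hlam : enumerates_zeros (alpha q) m lam)
  (hr : non_overlapping_discs m lam r)
  (i : nat) (hi : (i < m)%nat) (hi0 : lam i <> RtoC 0)
  (n : nat) (hn : (2 <= n)%nat) (hmult : zero_of_order (alpha q) (lam i) n) :
  (exists phi : R -> C,
     C0infty phi /\ supp_in_annulus R0 phi /\
     exists delta : R, 0 < delta /\ splits_zero q phi n (lam i) (r i) delta)
  /\
  (forall (phi : R -> C) (delta : R),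
     C0infty phi -> 0 < delta -> splits_zero q phi n (lam i) (r i) delta ->
     forall mu : C, 0 < Cmod mu < delta ->
     forall Lambda : R, Lambda <> 0 ->
     simple_zero (alpha (perturb q mu phi)) (RtoC Lambda) ->
     exists psi : R -> C,
       C0infty psi /\ (supp_in_annulus R0 phi -> supp_in_annulus R0 psi) /\
       exists rho delta' : R, 0 < rho /\ 0 < delta' /\
         forall mu' : R, 0 < Rabs mu' < delta' ->
           no_real_zeros_near
             (alpha (perturb (perturb q mu phi) (RtoC mu') psi)) Lambda rho).
Proof.
  destruct hq as [Sq supq]. assert (Cq := Csmooth_ccont q Sq).
  assert (Zq : forall x, x < - R0 \/ R0 < x -> q x = RtoC 0).
  { intros x Hx. apply not_supp_zero. intro S. apply supq in S. lra. }
  split.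
  (* The closed interval [c, d] must lie inside (R0, 2 R0), since the support is a closure. *)
  - set (c := 5 / 4 * R0). set (d := 7 / 4 * R0). set (z0 := lam i) in *.
    assert (Qa : forall x, x <= - (2 * R0) -> q x = RtoC 0) by (intros; apply Zq; lra).
    assert (Qc : forall x, c <= x -> q x = RtoC 0) by (intros; apply Zq; unfold c in *; lra).
    destruct (perturb_splits q (- (2 * R0)) c d z0 n) as [phi [Sphi [Zphi [Split Close]]]];
      try assumption; try lia; try (unfold c, d; lra).
    exists phi. split; [exact (C0infty_of_zero_outside phi c d Sphi Zphi)|]. split.
    { intros x Hx. apply (supp_between phi c d Zphi) in Hx. unfold c, d in Hx. lra. }
    destruct Split as [rho1 [Pr1 Split]]. assert (Pri : 0 < r i) by (apply hr, hi).
    set (rho := Rmin rho1 (r i)).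
    assert (Prho : 0 < rho) by (apply Rmin_pos; assumption).
    assert (rho_r : rho <= r i) by apply Rmin_r.
    destruct (Split rho (conj Prho (Rmin_l _ _))) as [d1 [Pd1 Sp]].
    (* The condition in the last clause of [has_n_simple_zeros]. If it fails, the local splitting
       near z0 suffices; if it holds, delta must also exclude zeros between the radii rho and
       [r i]. *)
    destruct (classic (forall z, 0 < Im z -> Cmod (z - z0) <= r i -> alpha q z <> RtoC 0)) as [Up|NUp].
    + assert (Ent : entire (alpha q)).
      { apply (alpha_spec q (- (2 * R0)) c Cq Qa Qc). }
      destruct (entire_annulus_lower_bound (alpha q) z0 rho (r i) Ent) as [eta [Peta Low]].
      { intros z Hz Fz. destruct (Rlt_le_dec 0 (Im z)) as [L|L]; [exact (Up z L (proj2 Hz) Fz)|].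
        destruct hlam as [_ [Enum _]]. destruct (Enum z L Fz) as [j [Hj Ej]].
        assert (Hij : i <> j).
        { intros <-. unfold z0 in Hz. rewrite Ej in Hz.
          replace (z - z)%C with (RtoC 0) in Hz by ring. rewrite Cmod_0 in Hz. lra. }
        assert (Prj : 0 < r j) by (apply hr, Hj).
        set (D := Cmod (z - z0)) in *. assert (PD : 0 < D) by lra.
        (* The zero z is the centre of another disc and might lie on the boundary of the i-th one;
           moving it slightly towards z0 gives a point in both discs. This k keeps the displacement
           within r j / 2. *)
        set (k := Rmin (/ 2) (r j / (2 * D))).
        assert (Pk : 0 < k) by (apply Rmin_pos; [lra|apply Rdiv_lt_0_compat; lra]).
        assert (k1 : k <= / 2) by apply Rmin_l. assert (k2 : k <= r j / (2 * D)) by apply Rmin_r.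
        apply (proj2 hr i j hi Hj Hij (z + RtoC k * (z0 - z))%C). split; unfold disc.
        - fold z0. replace (z + RtoC k * (z0 - z) - z0)%C with (RtoC (1 - k) * (z - z0))%C
            by (rewrite RtoC_minus; ring).
          rewrite Cmod_mult, Cmod_RtoC_pos by lra. fold D.
          assert (0 < k * D) by (apply Rmult_lt_0_compat; lra). lra.
        - rewrite Ej. replace (z + RtoC k * (z0 - z) - z)%C with (- (RtoC k * (z - z0)))%C by ring.
          rewrite Cmod_opp, Cmod_mult, Cmod_RtoC_pos by lra. fold D.
          assert (k * D <= r j / (2 * D) * D) by (apply Rmult_le_compat_r; lra).
          replace (r j / (2 * D) * D) with (r j / 2) in H by (field; lra). lra. }
      destruct (Close (Cmod z0 + r i) eta) as [d2 [Pd2 Cl]];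
        [pose proof (Cmod_ge_0 z0); lra|exact Peta|].
      exists (Rmin d1 d2). split; [apply Rmin_pos; assumption|].
      intros mu [Pmu Hmu].
      destruct (Sp mu (conj Pmu (Rlt_le_trans _ _ _ Hmu (Rmin_l _ _)))) as [zs [LZ [ND [Z1 Z2]]]].
      exists zs. split; [exact LZ|]. split; [exact ND|]. split.
      * intros z Hz. destruct (Z1 z Hz) as [Q1 Q2]. split; [unfold disc; lra|exact Q2].
      (* In the annulus |alpha q| >= eta, while the perturbation changes alpha by less than eta. *)
      * intros _ z Hz Fz. destruct (Rlt_le_dec (Cmod (z - z0)) rho) as [L|L]; [exact (Z2 z L Fz)|].
        exfalso. unfold disc in Hz. assert (Q1 := Low z ltac:(lra)).
        assert (Q2 := Cl mu z (Rlt_le_trans _ _ _ Hmu (Rmin_r _ _))).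
        rewrite Fz in Q2. replace (0 - alpha q z)%C with (- alpha q z)%C in Q2 by ring.
        rewrite Cmod_opp in Q2.
        assert (Cmod z <= Cmod z0 + r i).
        { replace z with (z0 + (z - z0))%C by ring. triangle. lra. }
        specialize (Q2 H). lra.
    + exists d1. split; [exact Pd1|]. intros mu Hmu.
      destruct (Sp mu Hmu) as [zs [LZ [ND [Z1 Z2]]]].
      exists zs. split; [exact LZ|]. split; [exact ND|]. split.
      * intros z Hz. destruct (Z1 z Hz) as [Q1 Q2]. split; [unfold disc; lra|exact Q2].
      * intro Up. contradiction.
  - intros phi delta [Sphi [M HM]] _ _ mu _ Lambda HL SZ.
    assert (Cp : ccont (perturb q mu phi)).
    { exact (ccont_plus _ _ Cq (ccont_mult _ _ (ccont_const mu) (Csmooth_ccont phi Sphi))). }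
    assert (Zp : forall x, x < - R0 \/ R0 < x -> phi x = RtoC 0 -> perturb q mu phi x = RtoC 0).
    { intros x Hx Px. unfold perturb. rewrite Zq, Px by exact Hx. ring. }
    (* psi has to live to the right of both q and phi. If phi is supported in the annulus, 2 R0 is
       not in its support, so phi vanishes near 2 R0 and a slot below 2 R0 remains free; otherwise
       any interval beyond both supports will do. *)
    assert (room : exists a c d, a <= c /\ c < d /\
      (forall x, x <= a -> perturb q mu phi x = RtoC 0) /\
      (forall x, c <= x -> perturb q mu phi x = RtoC 0) /\
      (supp_in_annulus R0 phi -> R0 < c /\ d < 2 * R0)).
    { destruct (classic (supp_in_annulus R0 phi)) as [An|NAn].
      - assert (N2 : ~ supp phi (2 * R0)) by (intro S; apply An in S; lra).
        apply NNPP in N2. destruct N2 as [[e Pe] He].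
        set (c := Rmax (3 / 2 * R0) (2 * R0 - e / 2)).
        assert (c1 : 3 / 2 * R0 <= c) by apply Rmax_l. assert (c2 : 2 * R0 - e / 2 <= c) by apply Rmax_r.
        assert (c3 : c < 2 * R0) by (apply Rmax_lub_lt; lra).
        exists (- (2 * R0)), c, ((c + 2 * R0) / 2).
        split; [lra|]. split; [lra|]. split; [|split].
        + intros x Hx. apply Zp; [lra|]. apply not_supp_zero. intro S. apply An in S. lra.
        + intros x Hx. apply Zp; [lra|]. destruct (Rlt_le_dec x (2 * R0 + e)) as [L|L].
          * apply He. apply Rabs_lt_between'. simpl. lra.
          * apply not_supp_zero. intro S. apply An in S. lra.
        + intros _. lra.
      - set (c := R0 + Rabs M + 1). assert (PM := Rle_abs M). assert (PM0 := Rabs_pos M).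
        assert (out : forall x, c <= Rabs x -> phi x = RtoC 0).
        { intros x Hx. apply not_supp_zero. intro S. apply HM in S. unfold c in Hx. lra. }
        exists (- c), c, (c + 1). split; [unfold c; lra|]. split; [lra|]. split; [|split].
        + intros x Hx. apply Zp; [unfold c in *; lra|]. apply out. rewrite Rabs_left by (unfold c in *; lra). lra.
        + intros x Hx. apply Zp; [unfold c in *; lra|]. apply out. rewrite Rabs_right by (unfold c in *; lra). lra.
        + intro An. contradiction. }
    destruct room as [a [c [d [Hac [Hcd [Pa [Pc An]]]]]]].
    destruct (perturb_no_real_zeros _ a c d Lambda Hac Hcd Cp Pa Pc HL SZ)
      as [psi [Spsi [Zpsi [rho [Prho No]]]]].
    exists psi. split; [exact (C0infty_of_zero_outside psi c d Spsi Zpsi)|]. split.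
    + intros Aphi x Hx. apply (supp_between psi c d Zpsi) in Hx. specialize (An Aphi). lra.
    + exists rho, rho. split; [exact Prho|]. split; [exact Prho|exact No].
Qed.
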